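(* For every fixed $\epsilon>0$, the Directed Power Dominating Set problem, even when restricted to directed acyclic graphs, cannot be approximated in polynomial time within ratio $2^{\log^{1-\epsilon} n}$, where $n$ is the number of nodes, unless $\mathrm{NP}\subseteq\mathrm{DTIME}(n^{\mathrm{polylog}(n)})$.
   Context: Let $G=(V,E)$ be a directed graph (no loops or parallel edges). For $S\subseteq V$, the set $\mathcal{P}_S$ of nodes power dominated by $S$ is obtained by: (D1) if $v\in S$ then $v$ and all its out-neighbors are in $\mathcal{P}_S$; (D2, propagation) repeatedly, if $v\in\mathcal{P}_S$ and exactly one out-neighbor $w$ of $v$ is not in $\mathcal{P}_S$ (all other out-neighbors being in $\mathcal{P}_S$), insert $w$ into $\mathcal{P}_S$. $S$ power dominates $G$ if $\mathcal{P}_S=V$. The Directed PDS problem asks for a minimum-size $S$ power dominating $G$. *)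

(* Defs.v *)
From mathcomp Require Import all_boot all_order all_algebra.
From mathcomp Require Import all_classical all_reals all_analysis.

Set Implicit Arguments.
Unset Strict Implicit.
Unset Printing Implicit Defensive.

Import Order.TTheory GRing.Theory Num.Theory.

Local Open Scope ring_scope.
Local Open Scope classical_set_scope.
Local Open Scope nat_scope.

Inductive move := MoveLeft | Stay | MoveRight.

(* The machine has [tapes.+1] one-way infinite tapes.  The tape alphabet
   consists of a blank ([None]), the two bits and finitely many extra symbols. *)
Record tm := TM {
  tapes : nat;
  state : finType;
  extra : finType;
  start : state;
  final : pred state;
  trans : state -> {ffun 'I_tapes.+1 -> option (bool + extra)} ->
          state * ('I_tapes.+1 -> option (bool + extra) * move)
}.

Definition symbol (M : tm) : Type := option (bool + extra M).

Record config (M : tm) := Config {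
  cstate : state M;
  head_pos : 'I_(tapes M).+1 -> nat;
  cell : 'I_(tapes M).+1 -> nat -> symbol M
}.

(* A left move on the leftmost cell leaves the head where it is. *)
Definition displace (d : move) (i : nat) : nat :=
  match d with MoveLeft => i.-1 | Stay => i | MoveRight => i.+1 end.

(* Final configurations are fixed by [step], so that "halted after exactly
   [t] steps" below means "halted within [t] steps". *)
Definition step (M : tm) (c : config M) : config M :=
  if final (cstate c) then c else
  let: (q, act) := trans (cstate c) [ffun k => cell c k (head_pos c k)] in
  Config q
    (fun k => displace (act k).2 (head_pos c k))
    (fun k i => if i == head_pos c k then (act k).1 else cell c k i).

Definition written (M : tm) (x : seq bool) (i : nat) : symbol M :=
  nth None [seq Some (inl b) | b <- x] i.

Definition init (M : tm) (x : seq bool) : config M :=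
  Config (start M) (fun=> 0) (fun k => written M (if k == ord0 then x else [::])).

(* The input is on the first tape, the output on the last one (they coincide
   for a one-tape machine); the output tape holds the output and only blanks
   after it. *)
Definition computes_in (M : tm) (x y : seq bool) (t : nat) : Prop :=
  let c := iter t (@step M) (init M x) in
  final (cstate c) /\ cell c ord_max =1 written M y.

Definition language := set (seq bool).

(* Time O(T); the additive constant accounts for small lengths where T is 0. *)
Definition DTIME (T : nat -> nat) : set language :=
  [set L : language | exists (M : tm) (C : nat), forall x : seq bool,
     exists b : bool, computes_in M x [:: b] (C * T (size x) + C) /\ (b <-> L x)].

Definition PTIME : set language := \bigcup_(c : nat) DTIME (fun n => n ^ c).

(* Each bit of [x] is doubled and the separator is 10. *)
Definition pairing (x u : seq bool) : seq bool :=
  flatten [seq [:: b; b] | b <- x] ++ [:: true; false] ++ u.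

Definition NP : set language :=
  [set L : language | exists (V : language) (c : nat), PTIME V /\
     forall x : seq bool,
       L x <-> exists u : seq bool, size u <= size x ^ c + c /\ V (pairing x u)].

(* DTIME(n^polylog(n)); replacing log_2 n by its integer part, or a constant
   multiple of it, does not change the union over [c]. *)
Definition DTIME_n_polylog : set language :=
  \bigcup_(c : nat) DTIME (fun n => n ^ (trunc_log 2 n ^ c)).

(* Parallel edges are excluded since edges form a relation. *)
Record digraph := Digraph {
  node :> finType;
  edge : rel node;
  edge_irr : irreflexive edge
}.

Definition acyclic (G : digraph) : Prop :=
  forall p : seq G, cycle (@edge G) p -> p = [::].

Section PowerDomination.
Variable G : digraph.
Implicit Types (S X : {set G}) (v w : G).

Definition out_nbrs v : {set G} := [set w | edge v w]%SET.

Definition initially_dominated S : {set G} :=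
  S :|: (\bigcup_(v in S) out_nbrs v)%SET.

Definition propagate X : {set G} :=
  X :|: [set w | [exists v in X, out_nbrs v :\: X == [set w]%SET]]%SET.

(* Every round that is not stationary adds a node, so #|G| rounds suffice. *)
Definition power_dominated S : {set G} :=
  iter #|G| propagate (initially_dominated S).

Definition power_dominates S : bool := power_dominated S == [set: G]%SET.

Lemma power_dominates_setT : power_dominates [set: G]%SET.
Proof.
rewrite /power_dominates /power_dominated; apply/eqP.
elim: #|G| => [|k /= ->]; first by rewrite /initially_dominated finset.setTU.
by rewrite /propagate finset.setTU.
Qed.

Definition pds_opt : nat :=
  #|[arg min_(S < [set: G]%SET | power_dominates S) #|S| ]|.

(* Number of nodes in unary, then the adjacency matrix row by row. *)
Definition encode_digraph : seq bool :=
  nseq #|G| true ++ false :: [seq edge v w | v <- enum G, w <- enum G].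

Definition encode_set S : seq bool := [seq v \in S | v <- enum G].

End PowerDomination.

(* Some polynomial-time machine maps (the encoding of) every digraph [G] of the
   class [K] to a power dominating set of size at most [rho #|G|] times the
   optimum.  Nothing is required on other inputs. *)
Definition directed_pds_approximable (R : realType)
    (K : digraph -> Prop) (rho : nat -> R) : Prop :=
  exists (M : tm) (C c : nat), forall G : digraph, K G ->
    exists S : {set G},
      [/\ computes_in M (encode_digraph G) (encode_set S)
            (C * size (encode_digraph G) ^ c + C),
          power_dominates S &
          (#|S|%:R <= rho #|G| * (pds_opt G)%:R)%R].

Definition log2 (R : realType) (x : R) : R := (ln x / ln 2)%R.

(* With n <= 1 the conventions ln 0 = 0 and 0 `^ a = 0 (a != 0) apply; such
   graphs are trivial instances. *)
Definition quasi_poly_ratio (R : realType) (eps : R) (n : nat) : R :=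
  (2 `^ (log2 n%:R `^ (1 - eps)))%R.

(* Main.v *)
(* An approximation algorithm for all digraphs is one for acyclic digraphs, so only
   the latter matter.  Power domination in an acyclic digraph can express the least
   number of seeds from which a Horn system derives all its atoms.

   The hardness gap needs no PCP theorem, because a Horn system may be
   quasi-polynomially large.  For an input x of a verifier, a witness is spread out
   into the table of its multi-affine extension over the grid {0,...,m}^d with
   m = 2d and P = (m+1)^d points; a seed asserts one value at one point.  The
   restriction of a table to a half of the cube is read off along the lines in one
   direction, a value being accepted when every two points of the line interpolate
   to it.  The rules decode the witness, run the verifier on it, and derive the
   goal if the run accepts and every point has a value.  The table of an accepted
   witness uses P seeds.  With fewer than P + m^d seeds that give every point a
   value, decoding is unambiguous, so the run is a genuine one; hence rejected
   inputs need P + m^d >= 3P/2 seeds.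

   Replacing every seed by a copy of the system, D times, turns this into P^D
   against (P + m^d)^D.  For D a large power of log |x| the ratio exceeds 2^(D/2),
   while the number n of nodes has log n = O(D log^2 |x|); so it beats
   2^(log^(1-eps) n).  A quasi-polynomial time machine writes the digraph, runs
   the approximation algorithm on it, and compares the size of the result with
   (P + m^d)^D. *)
Require Import Defs.
From HB Require Import structures.
From mathcomp Require Import all_classical all_reals all_analysis.
From mathcomp Require Import all_boot all_order all_algebra zify ring lra.

Set Implicit Arguments.
Unset Strict Implicit.
Unset Printing Implicit Defensive.

(** * Programs for multi-tape machines *)

(** Three obstacles shape the proof. A power dominating set may contain any node, so a chosen rule,
    prime or atom must not be worth more than one seed. The whole system is therefore laid out in
    [B] parallel copies that share their seeds: a set with fewer than [B] nodes misses some copy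
    entirely, and there only genuine derivations count. Horn rules on numbers should not divide, so
    an affine function on {0,...,m} with end values e and f is represented by its multiple
    (m-p)e+pf, a natural number. Symbols are at most 2, so grid values are at most 2m^d, which fixes
    the range of values; and m=2d gives (m+1)^d <= 2m^d, whence the factor 3/2. Finally the decision
    procedure has to be an actual multi-tape machine. All numbers in it are quasi-polynomially
    bounded, so unary counters, kept as head positions, are fast enough. *)

Section Commands.
Variable X : finType.
Notation sym := (option (bool + X)).
Implicit Types b : (nat -> sym) -> bool.

(** There are infinitely many tapes, so that commands can be composed before the number of tapes of
    the final machine is known. *)
Definition tapeconf := ((nat -> nat) * (nat -> nat -> sym))%type.
Implicit Types s : tapeconf.

Definition scan s : nat -> sym := fun i => s.2 i (s.1 i).

Definition apply_act (a : nat -> sym * move) s : tapeconf :=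
  (fun i => displace (a i).2 (s.1 i),
   fun i j => if j == s.1 i then (a i).1 else s.2 i j).

Inductive cmd :=
| Act of ((nat -> sym) -> nat -> sym * move)
| Seq of cmd & cmd
| Ite of ((nat -> sym) -> bool) & cmd & cmd
| While of ((nat -> sym) -> bool) & cmd.

Inductive exec : cmd -> nat -> tapeconf -> tapeconf -> Prop :=
| ExecAct a s : exec (Act a) 1 s (apply_act (a (scan s)) s)
| ExecSeq c1 c2 t1 t2 s s1 s2 :
    exec c1 t1 s s1 -> exec c2 t2 s1 s2 -> exec (Seq c1 c2) (t1 + t2) s s2
| ExecIteT b c1 c2 t s s' :
    b (scan s) -> exec c1 t s s' -> exec (Ite b c1 c2) t.+1 s s'
| ExecIteF b c1 c2 t s s' :
    ~~ b (scan s) -> exec c2 t s s' -> exec (Ite b c1 c2) t.+1 s s'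
| ExecWhileF b c s : ~~ b (scan s) -> exec (While b c) 1 s s
| ExecWhileT b c t1 t2 s s1 s2 :
    b (scan s) -> exec c t1 s s1 -> exec (While b c) t2 s1 s2 ->
    exec (While b c) (t1 + t2).+1 s s2.

(** A blank scanned on a tape from [K] on is never overwritten, so these tapes, blank at the start,
    remain blank and can be cut off. *)
Fixpoint bounded (K : nat) (c : cmd) : Prop :=
  match c with
  | Act a => forall r i, K <= i -> r i = None -> (a r i).1 = None
  | Seq c1 c2 | Ite _ c1 c2 => bounded K c1 /\ bounded K c2
  | While _ c => bounded K c
  end.

Lemma boundedW K K' c : K <= K' -> bounded K c -> bounded K' c.
Proof.
move=> le; elim: c => /= [a h r i|c1 h1 c2 h2|b c1 h1 c2 h2|b c h].
- by move=> Ki; apply: h; apply: leq_trans Ki.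
- by case=> /h1 ? /h2.
- by case=> /h1 ? /h2.
- exact: h.
Qed.

(** Control states of the compiled command: one for each action and one for each test. *)
Fixpoint pos (c : cmd) : finType :=
  match c with
  | Act _ => unit
  | Seq c1 c2 => (pos c1 + pos c2)%type
  | Ite _ c1 c2 => option (pos c1 + pos c2)
  | While _ c => option (pos c)
  end.

Fixpoint entry (c : cmd) : pos c :=
  match c with
  | Act _ => tt
  | Seq c1 _ => inl (entry c1)
  | Ite _ _ _ => None
  | While _ _ => None
  end.

Definition idle (r : nat -> sym) (i : nat) : sym * move := (r i, Stay).

(* [None] as next position means that the command has been left. *)
Fixpoint next (c : cmd) : pos c -> (nat -> sym) -> option (pos c) * (nat -> sym * move) :=
  match c with
  | Act a => fun _ r => (None, a r)
  | Seq c1 c2 => fun q r =>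
      match q with
      | inl q => let: (o, a) := next q r in
                 (Some (if o is Some q' then inl q' else inr (entry c2)), a)
      | inr q => let: (o, a) := next q r in (omap inr o, a)
      end
  | Ite b c1 c2 => fun q r =>
      match q with
      | None => (Some (Some (if b r then inl (entry c1) else inr (entry c2))), idle r)
      | Some (inl q) => let: (o, a) := next q r in (omap (Some \o inl) o, a)
      | Some (inr q) => let: (o, a) := next q r in (omap (Some \o inr) o, a)
      end
  | While b c => fun q r =>
      match q with
      | None => (if b r then Some (Some (entry c)) else None, idle r)
      | Some q => let: (o, a) := next q r in (Some o, a)
      end
  end.

Inductive steps (c : cmd) : pos c -> tapeconf -> nat -> tapeconf -> Prop :=
| StepsExit q s a : next q (scan s) = (None, a) -> steps q s 1 (apply_act a s)
| StepsMove q q' s a t s' : next q (scan s) = (Some q', a) ->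
    steps q' (apply_act a s) t s' -> steps q s t.+1 s'.

Lemma apply_idle s : apply_act (idle (scan s)) s = s.
Proof.
case: s => h c; rewrite /apply_act /idle /scan /=; congr pair.
by apply/funext => i; apply/funext => j; case: eqP => // ->.
Qed.

(** Serves the components whose exit is the exit of the whole command: the second part of a sequence
    and the branches of a conditional. *)
Lemma steps_lift (c c' : cmd) (f : pos c -> pos c') :
  (forall q r, next (f q) r = (omap f (next q r).1, (next q r).2)) ->
  forall q s t s', steps q s t s' -> steps (f q) s t s'.
Proof.
move=> hf q s t s'; elim=> {q s t s'} [q s a e|q q' s a t s1 e h1 ih].
  by apply: StepsExit; rewrite hf e.
by apply: (StepsMove _ ih); rewrite hf e.
Qed.

Lemma steps_seql c1 c2 q s t s1 t2 s2 : @steps c1 q s t s1 ->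
  @steps c2 (entry c2) s1 t2 s2 -> @steps (Seq c1 c2) (inl q) s (t + t2) s2.
Proof.
elim=> {q s t s1} [q s a e /(@steps_lift _ (Seq c1 c2) inr) h2|q q' s a t s1 e h1 ih h2].
  rewrite add1n; apply: (StepsMove _ (h2 _)); first by rewrite /= e.
  by move=> q0 r /=; case: next.
by rewrite addSn; apply: (StepsMove _ (ih h2)); rewrite /= e.
Qed.

Lemma exec_steps c t s s' : exec c t s s' -> steps (entry c) s t s'.
Proof.
elim=> {c t s s'}.
- by move=> a s; apply: StepsExit.
- by move=> c1 c2 t1 t2 s s1 s2 _ h1 _ h2; apply: steps_seql h1 h2.
- move=> b c1 c2 t s s' hb _ h.
  apply: (@StepsMove (Ite b c1 c2) _ (Some (inl (entry c1))) _ (idle (scan s))).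
    by rewrite /= hb.
  rewrite apply_idle.
  apply: (@steps_lift c1 (Ite b c1 c2) (Some \o inl)) h => q r /=.
  by case: next.
- move=> b c1 c2 t s s' hb _ h.
  apply: (@StepsMove (Ite b c1 c2) _ (Some (inr (entry c2))) _ (idle (scan s))).
    by rewrite /= (negbTE hb).
  rewrite apply_idle.
  apply: (@steps_lift c2 (Ite b c1 c2) (Some \o inr)) h => q r /=.
  by case: next.
- move=> b c s hb; rewrite -{2}(apply_idle s); apply: StepsExit.
  by rewrite /= (negbTE hb).
- move=> b c t1 t2 s s1 s2 hb _ h1 _ h2.
  apply: (@StepsMove (While b c) _ (Some (entry c)) _ (idle (scan s))).
    by rewrite /= hb.
  (* Generalised to any position in the body; leaving the body means returning to the test
     [None]. *)
  rewrite apply_idle => {hb}; move: (entry c) h1 h2 => q.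
  elim=> {q s t1 s1} [q s a e h2|q q' s a t s1 e h1 ih h2].
    by rewrite add1n; apply: (StepsMove _ h2); rewrite /= e.
  by rewrite addSn; apply: (StepsMove _ (ih h2)); rewrite /= e.
Qed.

(** * Compilation of a command into a machine *)

Section Machine.
Variables (K : nat) (c : cmd).

Definition extend (f : {ffun 'I_K.+1 -> sym}) (i : nat) : sym :=
  if insub i is Some k then f k else None.

Definition cmd_tm : tm :=
  @TM K (option (pos c)) X (Some (entry c)) (fun q => q == None)
    (fun q f => if q is Some q then
       let: (o, a) := next q (extend f) in (o, fun k : 'I_K.+1 => a k)
     else (None, fun k => (f k, Stay))).

Definition conf (q : option (pos c)) s : config cmd_tm :=
  @Config cmd_tm q (fun k => s.1 k) (fun k => s.2 k).

Definition blank_above s := forall i, K < i -> s.2 i = fun=> None.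

Hypothesis c_bounded : bounded K.+1 c.

Lemma next_bounded q r o a : @next c q r = (o, a) ->
  forall i, K < i -> r i = None -> (a i).1 = None.
Proof.
elim: c c_bounded q r o a => /= [a ha|c1 h1 c2 h2 [b1 b2]|b c1 h1 c2 h2 [b1 b2]|b c1 h1 b1].
- by move=> _ r o _ [_ <-] i Ki ri; apply: ha.
- case=> q r o a.
    by case e: next => [p' a'] [_ <-]; apply: h1 e.
  by case e: next => [p' a'] [_ <-]; apply: h2 e.
- case=> [[q|q]|] r o a.
  + by case e: next => [p' a'] [_ <-]; apply: h1 e.
  + by case e: next => [p' a'] [_ <-]; apply: h2 e.
  by case=> _ <- i _ /= ->.
case=> [q|] r o a.
  by case e: next => [p' a'] [_ <-]; apply: h1 e.
by case=> _ <- i _ /= ->.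
Qed.

Lemma step_conf q s o a : blank_above s -> next q (scan s) = (o, a) ->
  step (conf (Some q) s) = conf o (apply_act a s) /\ blank_above (apply_act a s).
Proof.
move=> bs e; split; last first.
  move=> i Ki; apply/funext => j /=.
  by rewrite (next_bounded e Ki) ?bs //; [case: ifP | rewrite /scan bs].
rewrite /step /=.
have -> : extend [ffun k : 'I_K.+1 => s.2 k (s.1 k)] = scan s.
  apply/funext => i; rewrite /extend /scan.
  by case: insubP => [k _ <-|]; [rewrite ffunE | rewrite -leqNgt => /bs ->].
by rewrite e.
Qed.

Lemma steps_conf q s t s' : blank_above s -> @steps c q s t s' ->
  iter t (@step cmd_tm) (conf (Some q) s) = conf None s'.
Proof.
move=> bs h; elim: h bs => {q s t s'} [q s a e|q q' s a t s1 e h1 ih] bs.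
  by have [h _] := step_conf bs e; apply: h.
by rewrite iterSr; have [-> b'] := step_conf bs e; rewrite ih.
Qed.

End Machine.

Definition init_tapes (x : seq bool) : tapeconf :=
  (fun=> 0, fun i => if i == 0 then nth None [seq Some (inl e) | e <- x] else fun=> None).

Lemma exec_computes K c x t s y T : bounded K.+1 c ->
  exec c t (init_tapes x) s -> t <= T ->
  s.2 K =1 nth None [seq Some (inl e) | e <- y] ->
  computes_in (cmd_tm K c) x y T.
Proof.
move=> bc ex tT ey.
have e0 : init (cmd_tm K c) x = conf K (Some (entry c)) (init_tapes x).
  congr Config; apply/funext => k; apply/funext => i.
  by rewrite /written -val_eqE /=; case: eqP => //= _; rewrite nth_nil.
have e1 : iter t (@step _) (init (cmd_tm K c) x) = conf K None s.
  rewrite e0; apply: (steps_conf bc); last exact: exec_steps.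
  by case.
(* The exit state is final, hence fixed by [step], and a short run can be padded to time [T]. *)
have e2 : forall u, iter u (@step _) (conf (c := c) K None s) = conf K None s.
  by elim=> //= u ->; rewrite /step /=.
rewrite /computes_in -(subnK tT) iterD e1 e2; split => //.
Qed.

End Commands.

(** * Registers *)

Section Registers.
Variables (X : finType) (mk : X) (r0 : nat).
Notation sym := (option (bool + X)).
Notation cmd := (cmd X).
Implicit Types s : tapeconf X.

Definition run (c : cmd) t s s' := exists2 t', t' <= t & exec c t' s s'.

Lemma run_le c t t' s s' : t <= t' -> run c t s s' -> run c t' s s'.
Proof. by move=> h [u hu e]; exists u => //; apply: leq_trans h. Qed.

Lemma run_seq c1 c2 t1 t2 s s1 s2 :
  run c1 t1 s s1 -> run c2 t2 s1 s2 -> run (Seq c1 c2) (t1 + t2) s s2.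
Proof.
by move=> [u hu e] [v hv f]; exists (u + v); [exact: leq_add | apply: ExecSeq f].
Qed.

Lemma run_while (b : (nat -> sym) -> bool) c t n (st : nat -> tapeconf X) :
  (forall j, j < n -> b (scan (st j)) /\ run c t (st j) (st j.+1)) ->
  ~~ b (scan (st n)) -> run (While b c) (n * t.+1).+1 (st 0) (st n).
Proof.
elim: n st => [|n ih] st hst hn; first by exists 1 => //; exact: ExecWhileF.
have [b0 [u hu e]] := hst 0 isT.
have [j hj|v hv f] := ih (fun j => st j.+1) _ hn; first exact: hst.
exists (u + v).+1; last exact: ExecWhileT f.
lia.
Qed.

Definition moves (f : nat -> move) : cmd := Act (fun r j => (r j, f j)).

Lemma exec_moves f s :
  exec (moves f) 1 s (fun j => displace (f j) (s.1 j), s.2).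
Proof.
have -> : (fun j => displace (f j) (s.1 j), s.2) =
    apply_act (fun j => (scan s j, f j)) s.
  congr pair; apply/funext => i; apply/funext => j /=.
  by case: eqP => // ->.
exact: (ExecAct (fun r j => (r j, f j))).
Qed.

Lemma run_moves f s s' :
  s'.1 =1 (fun j => displace (f j) (s.1 j)) -> s'.2 = s.2 -> run (moves f) 1 s s'.
Proof.
case: s' => h c /= /funext -> ->; exists 1 => //; exact: exec_moves.
Qed.

Definition marked : nat -> sym := fun j => if j == 0 then Some (inr mk) else None.

Definition nonzero i (r : nat -> sym) : bool := r i != Some (inr mk).

Lemma nonzeroE i s : s.2 i = marked -> nonzero i (scan s) = (s.1 i != 0).
Proof. by move=> e; rewrite /nonzero /scan e /marked; case: (s.1 i) => [|j] /=; rewrite ?eqxx. Qed.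

(** The basic loop on registers: clearing, moving, copying and rewinding a head are all instances of
    it. *)
Definition drain i (cs ds : seq nat) : cmd :=
  While (nonzero i)
    (moves (fun j => if j == i then MoveLeft else if j \in cs then MoveRight
                     else if j \in ds then MoveLeft else Stay)).

Lemma run_drain i cs ds s s' : s.2 i = marked -> s'.2 = s.2 ->
  s'.1 =1 (fun j => if j == i then 0 else if j \in cs then s.1 j + s.1 i
                    else if j \in ds then s.1 j - s.1 i else s.1 j) ->
  run (drain i cs ds) (2 * s.1 i).+1 s s'.
Proof.
case: s s' => h c [h' c'] /= hi -> /funext ->.
pose st n : tapeconf X := (fun j => if j == i then h i - n else
  if j \in cs then h j + n else if j \in ds then h j - n else h j, c).
have -> : (h, c) = st 0.
  rewrite /st; congr pair; apply/funext => j; case: eqP => [->|_]; first by rewrite subn0.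
  by rewrite addn0 subn0; case: ifP => //; case: ifP.
have -> : (fun j => if j == i then 0 else if j \in cs then h j + h i
    else if j \in ds then h j - h i else h j, c) = st (h i).
  by rewrite /st; congr pair; apply/funext => j; rewrite subnn.
rewrite mulnC; apply: run_while => [j hj|]; last first.
  by rewrite nonzeroE //= eqxx subnn.
rewrite nonzeroE //= eqxx -lt0n subn_gt0; split=> //.
apply: run_moves => // l /=.
case: eqP => _ /=; first by rewrite subnS.
case: ifP => _ /=; first by rewrite addnS.
by case: ifP => _ //=; rewrite subnS.
Qed.

Lemma drain_bounded K i cs ds : bounded K (drain i cs ds).
Proof. by move=> r j _ /= ->. Qed.

Lemma moves_bounded K f : bounded K (moves f).
Proof. by move=> r j _ /= ->. Qed.

Definition input (x : seq bool) : nat -> sym := nth None [seq Some (inl e) | e <- x].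

Definition seth s k v : tapeconf X := (fun i => if i == k then v else s.1 i, s.2).

(* Registers are the tapes from [r0] on; a register holds the position of its
   head, and [marked] makes position 0 recognisable. *)
Definition ready K x k s := [/\ s.2 0 = input x, s.1 0 = 0,
  forall i, r0 <= i < K -> s.2 i = marked & forall i, k <= i < K -> s.1 i = 0].

Definition fn := seq bool -> seq nat -> nat.

Definition vals s (rho : seq nat) := [seq s.1 r | r <- rho].

(** The result goes to the first free register [k]: arguments lie below it, and everything from [k]
    on is scratch space, zero before and, except for [k] itself, zero afterwards. [T] bounds the
    value along with the time, because moving a unary value costs its size. *)
Definition rcomp (f T : fn) : Prop := (forall x a, f x a <= T x a) /\
  forall k rho, r0 <= k -> all (fun r => r0 <= r < k) rho ->
  exists c K, [/\ k < K, bounded K c & forall K' x s, K <= K' -> ready K' x k s ->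
    run c (T x (vals s rho)) s (seth s k (f x (vals s rho)))].

Lemma ready_seth K x k s v : 0 < k -> k < K -> ready K x k s -> ready K x k.+1 (seth s k v).
Proof.
move=> k0 kK [h1 h2 h3 h4]; split=> //=.
  by case: eqP => // e; rewrite -e in k0.
by move=> i /andP[ki iK]; rewrite gtn_eqF // h4 // iK ltnW.
Qed.

Lemma vals_seth s k v rho : all (fun r => r0 <= r < k) rho ->
  vals (seth s k v) rho = vals s rho.
Proof.
move=> /allP h; apply/eq_in_map => r /h /andP[_ rk] /=.
by rewrite ltn_eqF.
Qed.

Lemma all_regsW k k' rho : k <= k' -> all (fun r => r0 <= r < k) rho ->
  all (fun r => r0 <= r < k') rho.
Proof. by move=> kk; apply: sub_all => r /andP[-> h]; apply: leq_trans kk. Qed.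

Lemma rcomp_le f T T' : (forall x a, T x a <= T' x a) -> rcomp f T -> rcomp f T'.
Proof.
move=> le [h1 h2]; split=> [x a|k rho k0 hr]; first exact: leq_trans (le x a).
have [c [K [h3 h4 h5]]] := h2 k rho k0 hr.
exists c, K; split=> // K' x s kk ok; apply: run_le (h5 _ _ _ kk ok); exact: le.
Qed.

Hypothesis r0_gt0 : 0 < r0.

Lemma rcomp_lit n : rcomp (fun _ _ => n) (fun _ _ => n.+1).
Proof.
split=> // k rho k0 hr.
suff [c bc rc] : exists2 c, (forall K, bounded K c) & forall s, s.1 k = 0 ->
    run c n.+1 s (seth s k n).
  exists c, k.+1; split=> // K' x s kk [_ _ _ h]; apply: rc.
  by apply: h; rewrite leqnn.
elim: n => [|n [c bc rc]].
  exists (moves (fun _ => Stay)); first by move=> K; exact: moves_bounded.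
  by move=> s hs; apply: run_moves => //= j; case: eqP => // ->.
exists (Seq c (moves (fun j => if j == k then MoveRight else Stay))).
  by move=> K; split; [exact: bc | exact: moves_bounded].
move=> s hs; rewrite -addn1; apply: run_seq (rc _ hs) _.
by apply: run_moves => //= j; case: eqP.
Qed.

Lemma rcomp_nth i : rcomp (fun _ a => nth 0 a i) (fun _ a => (4 * nth 0 a i).+2).
Proof.
split=> [x a|k rho k0 hr]; first by lia.
have [isz|isz] := ltnP i (size rho); last first.
  have [_ /(_ k rho k0 hr)[c [K [h1 h2 h3]]]] := rcomp_lit 0.
  exists c, K; split=> // K' x s kk ok.
  rewrite nth_default ?size_map //; exact: run_le (h3 _ _ _ kk ok).
have /andP[ri1 ri2] := allP hr _ (mem_nth 0 isz).
(* Reading a register empties it: its value is poured into [k] and [k.+1], then restored from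
   [k.+1]. *)
exists (Seq (drain (nth 0 rho i) [:: k; k.+1] [::]) (drain k.+1 [:: nth 0 rho i] [::])), k.+2.
split=> // [|K' x s kk [h1 h2 h3 h4]].
  by split; exact: drain_bounded.
rewrite (nth_map 0) //; set r := nth 0 rho i in ri1 ri2 *.
have -> : (4 * s.1 r).+2 = (2 * s.1 r).+1 + (2 * s.1 r).+1 by lia.
pose s1 : tapeconf X := (fun j => if j == r then 0 else if j == k then s.1 r else
  if j == k.+1 then s.1 r else s.1 j, s.2).
apply: (run_seq (s1 := s1)).
  apply: run_drain => //; first by rewrite h3 // ri1; lia.
  move=> j /=; rewrite !inE; case: eqP => // _.
  case: eqP => [->|_] /=; first by rewrite (h4 k); lia.
  by case: eqP => [->|_] //=; rewrite (h4 k.+1); lia.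
have e : s1.1 k.+1 = s.1 r by rewrite /= gtn_eqF ?eqxx ?(gtn_eqF (ltnSn k)) //; lia.
rewrite -{1}e; apply: run_drain => //; first by rewrite /= h3 //; lia.
move=> j; rewrite e /= !inE.
case: (eqVneq j k.+1) => [->|n1].
  by rewrite gtn_eqF // (h4 k.+1); lia.
case: (eqVneq j k) => [->|n2]; first by rewrite gtn_eqF.
by case: (eqVneq j r) => // ->.
Qed.

Lemma rcomp_succ f T : rcomp f T -> rcomp (fun x a => (f x a).+1) (fun x a => (T x a).+1).
Proof.
move=> [h1 h2]; split=> [x a|k rho k0 hr]; first by rewrite ltnS.
have [c [K [kK bc rc]]] := h2 k rho k0 hr.
exists (Seq c (moves (fun j => if j == k then MoveRight else Stay))), K; split=> //.
  by split=> //; exact: moves_bounded.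
move=> K' x s kk ok; rewrite -[X in run _ X]addn1.
apply: run_seq (rc _ _ _ kk ok) _.
by apply: run_moves => // j /=; case: eqP.
Qed.

(** The value of [g] is parked in [k], [f] works from [k.+1] on, and its value is then moved down
    into the cleared [k]. *)
Lemma rcomp_let f Tf g Tg : rcomp f Tf -> rcomp g Tg ->
  rcomp (fun x a => f x (g x a :: a))
       (fun x a => 3 * Tg x a + 3 * Tf x (g x a :: a) + 2).
Proof.
move=> [f1 f2] [g1 g2]; split=> [x a|k rho k0 hr].
  by have := f1 x (g x a :: a); lia.
have [cg [Kg [kKg bg rg]]] := g2 k rho k0 hr.
have hr' : all (fun r => r0 <= r < k.+1) (k :: rho).
  by rewrite /= leqnn k0 /=; apply: all_regsW hr.
have [cf [Kf [kKf bf rf]]] := f2 k.+1 (k :: rho) (leqW k0) hr'.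
exists (Seq cg (Seq cf (Seq (drain k [::] [::]) (drain k.+1 [:: k] [::])))), (maxn Kg Kf).
split; first by rewrite leq_max kKg.
  split; first by apply: boundedW bg; rewrite leq_maxl.
  split; first by apply: boundedW bf; rewrite leq_maxr.
  by split; exact: drain_bounded.
move=> K' x s; rewrite geq_max => /andP[kg kf] ok.
set a := vals s rho; set u := g x a; set v := f x (u :: a).
have uT : u <= Tg x a := g1 x a.
have vT : v <= Tf x (u :: a) := f1 x (u :: a).
have k_gt0 : 0 < k := leq_trans r0_gt0 k0.
apply: (@run_le _ (Tg x a + (Tf x (u :: a) + ((2 * u).+1 + (2 * v).+1)))); first by lia.
apply: run_seq (rg _ _ _ kg ok) _; rewrite -/u.
have ok1 : ready K' x k.+1 (seth s k u).
  by apply: ready_seth => //; exact: leq_trans kg.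
have e1 : vals (seth s k u) (k :: rho) = u :: a by rewrite /= eqxx vals_seth.
have := rf _ _ _ kf ok1; rewrite e1 -/v => rf'.
apply: run_seq rf' _.
pose s1 := seth (seth s k 0) k.+1 v.
have [_ _ h3 h4] := ok.
have nk : (k == k.+1) = false by rewrite ltn_eqF.
have nk' : (k.+1 == k) = false by rewrite gtn_eqF.
apply: (run_seq (s1 := s1)).
  set s2 := seth _ k.+1 v.
  have e : s2.1 k = u by rewrite /= nk eqxx.
  rewrite -e; apply: run_drain => //=; first by apply: h3; lia.
  by move=> j; case: (eqVneq j k) => [->|]; rewrite ?nk.
have e : s1.1 k.+1 = v by rewrite /= eqxx.
rewrite -e; apply: run_drain => //=; first by apply: h3; lia.
move=> j; rewrite eqxx inE.
case: (eqVneq j k) => [->|nj]; first by rewrite nk.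
by case: (eqVneq j k.+1) => // ->; rewrite (h4 k.+1); lia.
Qed.

Lemma rcomp_behead f T : rcomp f T ->
  rcomp (fun x a => f x (behead a)) (fun x a => T x (behead a)).
Proof.
move=> [h1 h2]; split=> // k rho k0 hr.
have hr' : all (fun r => r0 <= r < k) (behead rho) by case: rho hr => //= ? ? /andP[].
have [c [K [? ? h]]] := h2 k _ k0 hr'; exists c, K; split=> // K' x s kk ok.
by have := h _ _ _ kk ok; rewrite /vals -behead_map.
Qed.

(** Register [k] holds the accumulator, [k.+1] the number of rounds left, [k.+2] the index and
    [k.+3] the new value. As times bound values, the bound [G] on the cost of one round also
    controls the accumulator. *)
Lemma rcomp_iteri n Tn h Th g Tg G : rcomp n Tn -> rcomp h Th -> rcomp g Tg ->
  (forall x a i, i < n x a ->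
     Tg x [:: i, iteri i (fun i y => g x [:: i, y & a]) (h x a) & a] <= G x a) ->
  rcomp (fun x a => iteri (n x a) (fun i y => g x [:: i, y & a]) (h x a))
       (fun x a => 3 * Tn x a + Th x a + n x a * (5 * G x a + 2 * Th x a + 5) + 2).
Proof.
move=> [n1 n2] [h1 h2] [g1 g2] hG.
pose val x a i := iteri i (fun i y => g x [:: i, y & a]) (h x a).
have valT x a i : i <= n x a -> val x a i <= Th x a + G x a.
  case: i => [|i] lt; first by rewrite /val /= (leq_trans (h1 _ _)) ?leq_addr.
  apply: leq_trans (leq_addl _ _); apply: leq_trans (hG _ _ _ lt); exact: g1.
split=> [x a|k rho k0 hr].
  rewrite -/(val x a _); case e: (n x a) (valT x a (n x a) (leqnn _)) => [|m].
    by move=> _; rewrite /val /=; have := h1 x a; lia.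
  lia.
have [ch [Kh [kKh bh rh]]] := h2 k rho k0 hr.
have hr1 := all_regsW (leqnSn k) hr.
have [cn [Kn [kKn bn rn]]] := n2 k.+1 rho (leqW k0) hr1.
have hr' : all (fun r => r0 <= r < k.+3) [:: k.+2, k & rho].
  by apply/and3P; split; [lia | lia | apply: all_regsW hr; lia].
have [cg [Kg [kKg bg rg]]] := g2 k.+3 [:: k.+2, k & rho] (leqW (leqW (leqW k0))) hr'.
pose body := Seq (moves (fun j => if j == k.+1 then MoveLeft else Stay))
  (Seq cg (Seq (drain k [::] [::]) (Seq (drain k.+3 [:: k] [::])
    (moves (fun j => if j == k.+2 then MoveRight else Stay))))).
exists (Seq ch (Seq cn (Seq (While (nonzero k.+1) body) (drain k.+2 [::] [::])))),
  (maxn Kh (maxn Kn Kg)).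
split; first by rewrite leq_max kKh.
  split; first by apply: boundedW bh; rewrite leq_maxl.
  split; first by apply: boundedW bn; rewrite !leq_max leqnn orbT.
  split; last exact: drain_bounded.
  split; first exact: moves_bounded.
  split; first by apply: boundedW bg; rewrite !leq_max leqnn !orbT.
  by do 2 (split; first exact: drain_bounded); exact: moves_bounded.
move=> K' x s; rewrite !geq_max => /and3P[kh kn kg] ok.
set a := vals s rho; set N := n x a.
have NT : N <= Tn x a := n1 x a.
have k_gt0 : 0 < k := leq_trans r0_gt0 k0.
have [i1 i2 i3 i4] := ok.
pose V := val x a.
pose st i : tapeconf X := (fun j => if j == k then V i else if j == k.+1 then N - i
  else if j == k.+2 then i else s.1 j, s.2).
have ne01 : (k.+1 == k) = false by lia.
have ne02 : (k.+2 == k) = false by lia.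
have ne03 : (k.+3 == k) = false by lia.
have ne12 : (k.+2 == k.+1) = false by lia.
have ne13 : (k.+3 == k.+1) = false by lia.
have nf03 : (k == k.+3) = false by lia.
have nf02 : (k == k.+2) = false by lia.
have ne23 : (k.+3 == k.+2) = false by lia.
pose B := 5 * G x a + 2 * Th x a + 4.
apply: (@run_le _ (Th x a + (Tn x a + ((N * B.+1).+1 + (2 * N).+1)))).
  by rewrite /B; nia.
apply: run_seq (rh _ _ _ kh ok) _; rewrite -/a.
have ok1 : ready K' x k.+1 (seth s k (V 0)).
  by apply: ready_seth => //; exact: leq_trans kh.
have := rn _ _ _ kn ok1; rewrite vals_seth // -/a -/N => rn'.
apply: run_seq rn' _.
have -> : seth (seth s k (V 0)) k.+1 N = st 0.
  congr pair; apply/funext => j /=; rewrite subn0.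
  case: (eqVneq j k) => [->|_]; first by rewrite ltn_eqF.
  case: (eqVneq j k.+1) => // _.
  by case: (eqVneq j k.+2) => // ->; rewrite (i4 k.+2); lia.
have mk1 i : k <= i <= k.+3 -> s.2 i = marked by move=> ?; apply: i3; lia.
apply: (run_seq (s1 := st N)); last first.
  have e : (st N).1 k.+2 = N by rewrite /= ne02 ne12 eqxx.
  rewrite -{1}e; apply: run_drain => //=; first by apply: mk1; lia.
  rewrite -/V => j; rewrite subnn.
  case: (eqVneq j k) => [->|_]; first by rewrite nf02.
  case: (eqVneq j k.+1) => [->|_]; first by rewrite ltn_eqF // (i4 k.+1); lia.
  by case: (eqVneq j k.+2) => // ->; rewrite (i4 k.+2); lia.
apply: run_while => [i iN|]; last first.
  by rewrite nonzeroE /= ?ne01 ?eqxx ?subnn // mk1 //; lia.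
rewrite nonzeroE /= ?ne01 ?eqxx -?lt0n ?subn_gt0 ?iN; last by apply: mk1; lia.
split=> //.
have VT : V i <= Th x a + G x a by apply: valT; exact: ltnW.
have VT' : V i.+1 <= Tg x [:: i, V i & a] := g1 _ _.
have gG := hG x a i iN; rewrite -/(val x a i) -/(V i) in gG.
apply: (@run_le _ (1 + (Tg x [:: i, V i & a] + ((2 * V i).+1 + ((2 * V i.+1).+1 + 1))))).
  by rewrite /B; lia.
pose s1 : tapeconf X := (fun j => if j == k then V i else if j == k.+1 then N - i.+1
  else if j == k.+2 then i else s.1 j, s.2).
apply: (run_seq (s1 := s1)).
  apply: run_moves => // j /=.
  case: (eqVneq j k.+1) => [->|] /=; last by [].
  by rewrite ne01 subnS.
have ok2 : ready K' x k.+3 s1.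
  split=> //=; first by rewrite !ltn_eqF // leqW.
  move=> j hj; rewrite !gtn_eqF; try lia.
  by apply: i4; lia.
have e2 : vals s1 [:: k.+2, k & rho] = [:: i, V i & a].
  rewrite /= eqxx ne02 ne12 eqxx; congr [:: _, _ & _].
  apply/eq_in_map => r /(allP hr) /andP[_ rk] /=.
  by rewrite !ltn_eqF // !leqW.
have := rg _ _ _ kg ok2; rewrite e2 => rg'; apply: run_seq rg' _.
rewrite -/(V i.+1); have -> : g x [:: i, V i & a] = V i.+1 by [].
pose s2 := seth (seth s1 k 0) k.+3 (V i.+1).
apply: (run_seq (s1 := s2)).
  set s3 := seth s1 _ _.
  have e : s3.1 k = V i by rewrite /= nf03 eqxx.
  rewrite -e; apply: run_drain => //=; first by apply: mk1; lia.
  by move=> j; case: (eqVneq j k) => [->|] //; rewrite nf03.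
apply: (run_seq (s1 := seth s1 k (V i.+1))).
  have e : s2.1 k.+3 = V i.+1 by rewrite /= eqxx.
  rewrite -e; apply: run_drain => //=; first by apply: mk1; lia.
  move=> j; rewrite inE eqxx.
  case: (eqVneq j k) => [->|_]; first by rewrite nf03.
  case: (eqVneq j k.+3) => // ->; rewrite ne13 ne23 (i4 k.+3); lia.
apply: run_moves => // j /=.
case: (eqVneq j k.+2) => [->|_] //=; last by case: ifP.
by rewrite ne02 ne12.
Qed.

Definition isbit (b : bool) (x : seq bool) (i : nat) : nat :=
  onth x i == Some b.

Lemma input_bit b x i : (input x i == Some (inl b)) = isbit b x i :> nat.
Proof. by rewrite /input /isbit; elim: x i => [|e x ih] [|i] //=; case: e b {ih} => [] []. Qed.

(** The input head itself walks to the position, driven by register [k]; the copy of the position in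
    [k.+1] brings it back to 0. *)
Lemma rcomp_isbit b f T : rcomp f T ->
  rcomp (fun x a => isbit b x (f x a)) (fun x a => 5 * T x a + 4).
Proof.
move=> [f1 f2]; split=> [x a|k rho k0 hr]; first by rewrite /isbit; case: eqP; lia.
have [c [K [kK bc rc]]] := f2 k rho k0 hr.
pose test (r : nat -> sym) := r 0 == Some (inl b).
exists (Seq c (Seq (drain k [:: 0; k.+1] [::]) (Seq
  (Ite test (moves (fun j => if j == k then MoveRight else Stay)) (moves (fun=> Stay)))
  (drain k.+1 [::] [:: 0])))), (maxn K k.+2).
split; first by rewrite leq_max kK.
  split; first by apply: boundedW bc; rewrite leq_maxl.
  split; first exact: drain_bounded.
  by split; [split; exact: moves_bounded | exact: drain_bounded].
move=> K' x s; rewrite geq_max => /andP[kk k2] ok.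
set a := vals s rho; set u := f x a.
have uT : u <= T x a := f1 x a.
have k_gt0 : 0 < k := leq_trans r0_gt0 k0.
have [i1 i2 i3 i4] := ok.
apply: (@run_le _ (T x a + ((2 * u).+1 + (2 + (2 * u).+1)))); first by lia.
apply: run_seq (rc _ _ _ kk ok) _; rewrite -/a -/u.
pose st v : tapeconf X := (fun j => if j == 0 then u else if j == k then v
  else if j == k.+1 then u else s.1 j, s.2).
have ne : (k == 0) = false by lia.
have ne1 : (k.+1 == k) = false by lia.
apply: (run_seq (s1 := st 0)).
  have e : (seth s k u).1 k = u by rewrite /= eqxx.
  rewrite -{1}e; apply: run_drain => //=; first by apply: i3; lia.
  move=> j; rewrite !inE eqxx.
  case: (eqVneq j 0) => [->|_]; first by rewrite ltn_eqF // i2.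
  case: (eqVneq j k) => //= _.
  by case: (eqVneq j k.+1) => // ->; rewrite (i4 k.+1); lia.
have et : test (scan (st 0)) = isbit b x u :> nat.
  by rewrite /test /scan /= i1 input_bit.
apply: (run_seq (s1 := st (isbit b x u))).
  rewrite -et; case tt: (test _).
    exists 2 => //; apply: ExecIteT => //.
    have [[|[|//]] // _ h] : run (moves (fun j => if j == k then MoveRight else Stay)) 1 (st 0) (st 1).
      apply: run_moves => // j /=.
      by case: (eqVneq j k) => [->|_] //=; rewrite ne.
    by inversion h.
  exists 2 => //; apply: ExecIteF; first by rewrite tt.
  have [[|[|//]] // _ h] : run (moves (fun=> Stay)) 1 (st 0) (st 0) by apply: run_moves.
  by inversion h.
have e v : (st v).1 k.+1 = u by rewrite /= ne1 eqxx.
rewrite -{1}(e (isbit b x u)); apply: run_drain => //=; first by apply: i3; lia.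
move=> j; rewrite !inE ne1 eqxx.
case: (eqVneq j k.+1) => [->|_]; first by rewrite ne1 (i4 k.+1); lia.
by case: (eqVneq j 0) => [->|//]; rewrite subnn ltn_eqF // i2.
Qed.

End Registers.

(** * Running a machine on a computed input *)

Lemma rcomp_size (X : finType) (mk : X) r0 : 0 < r0 ->
  rcomp mk r0 (fun x _ => size x) (fun x _ => 5 * size x + 3).
Proof.
move=> r0_gt0; split=> [x a|k rho k0 hr]; first lia.
pose c := While (fun r : nat -> option (bool + X) => r 0 != None)
  (moves X (fun j => if j \in [:: 0; k; k.+1] then MoveRight else Stay)).
exists (Seq c (drain mk k.+1 [::] [:: 0])), k.+2; split=> //.
  by split; [exact: moves_bounded | exact: drain_bounded].
move=> K' x s kk [i1 i2 i3 i4].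
pose st v : tapeconf X := (fun j => if j \in [:: 0; k; k.+1] then v else s.1 j, s.2).
have ne : (k == 0) = false by lia.
have ne1 : (k.+1 == k) = false by lia.
have -> : s = st 0.
  case: s i1 i2 i3 i4 @st => h cl /= i1 i2 i3 i4; congr pair; apply/funext => j.
  case: ifP => //; rewrite !inE => /or3P[] /eqP -> //; apply: i4; lia.
apply: (@run_le _ _ ((size x * 2).+1 + (2 * size x).+1)); first lia.
apply: (run_seq (s1 := st (size x))).
  apply: run_while => [j hj|]; last first.
    by rewrite /scan /= i1 /input nth_default ?size_map.
  split; first by rewrite /scan /= i1 /input (nth_map false).
  by apply: run_moves => // l /=; case: ifP.
have e : (st (size x)).1 k.+1 = size x by rewrite /= !inE eqxx !orbT.
rewrite -{1}e; apply: run_drain => //=; first by apply: i3; lia.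
move=> j; rewrite !inE eqxx !orbT.
case: (eqVneq j k) => [->|_]; first by rewrite ne ltn_eqF.
case: (eqVneq j k.+1) => [->|_]; first by rewrite orbT.
by case: (eqVneq j 0) => //= _; rewrite subnn.
Qed.

Ltac projs := cbv beta iota delta [fst snd].

Section Decider.
Variable M : tm.
Notation tM := (tapes M).
Definition dX : finType := (extra M + (state M + unit))%type.
Notation sym := (option (bool + dX)).
Implicit Types (s : tapeconf dX) (c : config M).
Definition dmk : dX := inr (inr tt).
(** Tape 0 holds the input, tapes 1 to [tM.+1] are those of [M], and tape [tM.+2] holds the state of
    [M] as a single symbol; the registers come after these. *)
Definition dr0 := tM.+3.

Definition lift_sym (e : symbol M) : sym :=
  match e with
  | None => None
  | Some (inl b) => Some (inl b)
  | Some (inr e) => Some (inr (inl e))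
  end.

Definition unlift_sym (e : sym) : symbol M :=
  match e with
  | Some (inl b) => Some (inl b)
  | Some (inr (inl e)) => Some (inr e)
  | _ => None
  end.

Lemma lift_symK : cancel lift_sym unlift_sym.
Proof. by case=> [[]|]. Qed.

Definition state_sym (q : state M) : sym := Some (inr (inr (inl q))).

Definition sym_state (e : sym) : option (state M) :=
  if e is Some (inr (inr (inl q))) then Some q else None.

Definition tape_of (i : nat) : option 'I_tM.+1 := if i is i'.+1 then insub i' else None.

Lemma tape_ofP (k : 'I_tM.+1) : tape_of k.+1 = Some k.
Proof. by rewrite /tape_of valK. Qed.

Lemma tape_of_ge i : tM.+1 < i -> tape_of i = None.
Proof. by case: i => // i h; rewrite /= insubF //; lia. Qed.

Definition embed c s : tapeconf dX :=
  (fun i => if tape_of i is Some k then head_pos c k else s.1 i,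
   fun i => if tape_of i is Some k then lift_sym \o cell c k
            else if i == tM.+2 then (fun j => if j == 0 then state_sym (cstate c) else None)
            else s.2 i).

Definition running (r : nat -> sym) : bool :=
  if sym_state (r tM.+2) is Some q then ~~ final q else false.

Definition simulate : cmd dX :=
  While running (Act (fun r i =>
    if sym_state (r tM.+2) isn't Some q then (None, Stay) else
    let: (q', act) := trans q [ffun k : 'I_tM.+1 => unlift_sym (r k.+1)] in
    if tape_of i is Some k then (lift_sym (act k).1, (act k).2)
    else if i == tM.+2 then (state_sym q', Stay)
    else (r i, if i == dr0 then MoveRight else Stay))).

(** [n] is the least halting time, counted in register [dr0]. No head moves right by more than [n],
    so this count later suffices to rewind the output head. *)
Lemma run_simulate c s t : s.1 tM.+2 = 0 -> s.1 dr0 = 0 ->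
  final (cstate (iter t (@step M) c)) ->
  exists2 n, n <= t & run simulate (2 * t).+1 (embed c s)
    (embed (iter t (@step M) c) (seth s dr0 n)) /\
    forall k, head_pos (iter t (@step M) c) k <= head_pos c k + n.
Proof.
move=> s1 s2 fin.
have [n fn minn] : exists2 n, n <= t /\ final (cstate (iter n (@step M) c)) &
    forall j, j < n -> ~~ final (cstate (iter j (@step M) c)).
  have ex : exists n, final (cstate (iter n (@step M) c)) by exists t.
  case: (ex_minnP ex) => n fn mn; exists n; first by split=> //; exact: mn.
  by move=> j jn; apply/negP => /mn; rewrite leqNgt jn.
have {fn} [nt fn] := fn.
have et : iter t (@step M) c = iter n (@step M) c.
  rewrite -(subnK nt) iterD; elim: (t - n) => //= u ->.
  by rewrite {1}/step fn.
rewrite et; exists n => //; split; last first.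
  move=> k; elim: n {nt fn minn et} => [|n ih] /=; first by rewrite addn0.
  move: ih; set cn := iter _ _ _ => ih; rewrite /step.
  case: ifP => _; first by apply: leq_trans ih _; lia.
  by case: trans => q act /=; case: (act k).2 => /=; lia.
have -> : s = seth s dr0 0.
  case: s s1 s2 => h cl /= _ h0; congr pair; apply/funext => i.
  by case: eqP => [->|].
set s0 := seth s dr0 0.
have -> : seth s0 dr0 n = seth s dr0 n.
  by congr pair; apply/funext => i /=; case: eqP.
apply: (@run_le _ _ (n * 2).+1); first lia.
pose st j := embed (iter j (@step M) c) (seth s dr0 j).
have eqn : (tM.+2 == dr0) = false by rewrite /dr0; lia.
have es j : scan (st j) tM.+2 = state_sym (cstate (iter j (@step M) c)).
  have t0 : insub tM.+1 = None :> option 'I_tM.+1 by rewrite insubF ?ltnn.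
  by rewrite /scan /= t0 eqxx eqn s1.
apply: (run_while (st := st)) => [j jn|]; last first.
  by rewrite /running es /= fn.
rewrite /running es /= minn //; split=> //; exists 1 => //.
set a := Act _; suff -> : st j.+1 = apply_act
   ((fun r i =>
    if sym_state (r tM.+2) isn't Some q then (None, Stay) else
    let: (q', act) := trans q [ffun k : 'I_tM.+1 => unlift_sym (r k.+1)] in
    if tape_of i is Some k then (lift_sym (act k).1, (act k).2)
    else if i == tM.+2 then (state_sym q', Stay)
    else (r i, if i == dr0 then MoveRight else Stay)) (scan (st j))) (st j).
  exact: ExecAct.
rewrite /apply_act es /=.
set cj := iter j (@step M) c.
have -> : [ffun k : 'I_tM.+1 => unlift_sym (scan (st j) k.+1)] =
    [ffun k => cell cj k (head_pos cj k)].
  by apply/ffunP => k; rewrite !ffunE /scan /st /embed /= valK /= lift_symK.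
rewrite /st /embed iterS -/cj {1 2 3}/step (negbTE (minn j jn)).
case: trans => q act /=; congr pair.
  apply/funext => i; case et' : (tape_of i) => [k|] //.
  case: (eqVneq i tM.+2) => [->|ne] /=; first by rewrite eqn.
  by case: (eqVneq i dr0).
apply/funext => i; apply/funext => l; case et' : (tape_of i) => [k|] /=.
  by rewrite [in LHS]fun_if; case: ifP.
case: (eqVneq i tM.+2) => [->|ne] /=; first by rewrite eqn s1; case: ifP.
by case: (l =P _) => // ->.
Qed.

Lemma simulate_bounded K : dr0 <= K -> bounded K simulate.
Proof.
move=> hK r i iK ri; case: sym_state => // q; case: trans => q' act.
rewrite tape_of_ge; last by rewrite /dr0 in hK; lia.
by rewrite gtn_eqF //; rewrite /dr0 in hK; lia.
Qed.

Variables (len G : seq bool -> nat) (obit dec Tl To Td : fn).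
Hypothesis len_comp : rcomp dmk dr0 (fun x _ => len x) Tl.
Hypothesis obit_comp : rcomp dmk dr0 obit To.
Hypothesis dec_comp : rcomp dmk dr0 dec Td.
Hypothesis obit_time : forall x i, i < len x -> To x [:: i] <= G x.

Definition instance x := mkseq (fun i => obit x [:: i] != 0) (len x).

(** The machine writes [instance x] on the input tape of [M], runs [M], counts the ones in its
    output (the cardinality of an encoded set) and decides from this count by [dec]. The answer is
    written on tape [K], which lies beyond all registers and is the last tape of the machine. *)
Lemma decider_run : exists (c : cmd dX) K, bounded K.+1 c /\ forall x y t,
  computes_in M (instance x) y t ->
  exists2 s', run c (Tl x [::] + len x * (3 * G x + 6) + 4 * t + 2 * size y +
                     Td x [:: count id y] + 10) (init_tapes dX x) s' &
    s'.2 K =1 input dX [:: dec x [:: count id y] != 0].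
Proof.
have r_gt0 : 0 < dr0 by [].
have [_ /(_ dr0 [::] (leqnn _) isT)[cl [Kl [kl bl rl]]]] := len_comp.
have ho : all (fun r => dr0 <= r < dr0.+2) [:: dr0.+1] by rewrite /=; lia.
have [ob1 /(_ dr0.+2 _ (leqW (leqW (leqnn _))) ho)[co [Ko [ko bo ro]]]] := obit_comp.
have hd : all (fun r => dr0 <= r < dr0.+1) [:: dr0] by rewrite /=; lia.
have [_ /(_ dr0.+1 _ (leqW (leqnn _)) hd)[cd [Kd [kd bd rd]]]] := dec_comp.
pose K := maxn Kl (maxn Ko Kd).
have [Kl' Ko' Kd'] : [/\ Kl <= K, Ko <= K & Kd <= K].
  by rewrite /K !leq_max !leqnn !orbT.
pose mark_all : cmd dX := Act (fun r i =>
  if dr0 <= i < K then (Some (inr dmk), Stay) else (r i, Stay)).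
pose emit : cmd dX := Act (fun r i =>
  if i == 1 then (Some (inl (nonzero dmk dr0.+2 r)), MoveRight)
  else (r i, if i == dr0 then MoveLeft else if i == dr0.+1 then MoveRight else Stay)).
pose set_state : cmd dX := Act (fun r i =>
  (if i == tM.+2 then state_sym (start M) else r i, Stay)).
pose count_ones : cmd dX := While (fun r => r tM.+1 != None) (Act (fun r i =>
  (r i, if i == tM.+1 then MoveRight
        else if (i == dr0) && (r tM.+1 == Some (inl true)) then MoveRight else Stay))).
pose answer : cmd dX := Act (fun r i =>
  (if i == K then Some (inl (nonzero dmk dr0.+1 r)) else r i, Stay)).
pose emit_all : cmd dX := While (nonzero dmk dr0) (Seq co (Seq emit (drain dmk dr0.+2 [::] [::]))).
pose code := Seq mark_all (Seq cl (Seq emit_all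
  (Seq (drain dmk dr0.+1 [::] [:: 1]) (Seq set_state (Seq simulate
  (Seq (drain dmk dr0 [::] [:: tM.+1]) (Seq count_ones (Seq cd answer)))))))).
exists code, K.
have K3 : dr0.+2 < K by apply: leq_trans Ko'.
split.
  repeat split; try exact: drain_bounded.
  - by move=> r i Ki /= ri; case: ifP => //; lia.
  - by apply: boundedW bl; exact: leqW.
  - by apply: boundedW bo; exact: leqW.
  - by move=> r i Ki /= ri; case: eqP => //; lia.
  - by move=> r i Ki /= ri; case: eqP => // e; rewrite /dr0 in K3; lia.
  - by apply: simulate_bounded; lia.
  - by move=> r i Ki /= ri.
  - by apply: boundedW bd; exact: leqW.
  - by move=> r i Ki /= ri; case: eqP => //; lia.
move=> x y t [fin out].
pose y0 := instance x; rewrite -/y0 in fin out.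
pose cells u : nat -> nat -> sym := fun i => if i == 0 then input dX x
  else if i == 1 then (fun j => if j < u then Some (inl (obit x [:: j] != 0)) else None)
  else if dr0 <= i < K then marked dmk else fun=> None.
pose B : tapeconf dX := (fun=> 0, cells 0).
have rB h u : (forall i, dr0.+2 <= i < K -> h i = 0) -> h 0 = 0 -> ready dmk dr0 K x dr0.+2 (h, cells u).
  move=> hh h0; split=> // i /= hi; rewrite /cells.
  by rewrite hi !gtn_eqF //; move: hi; rewrite /dr0; lia.
have mB u i : dr0 <= i < K -> cells u i = marked dmk.
  by move=> hi; rewrite /cells hi !gtn_eqF //; move: hi; rewrite /dr0; lia.
suff [s' h1 h2] : exists2 s', run code
   (1 + (Tl x [::] + ((len x * (3 * G x + 3).+1).+1 + ((2 * len x).+1 + (1 + ((2 * t).+1 +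
   ((2 * t).+1 + ((size y * 2).+1 + (Td x [:: count id y] + 1))))))))) (init_tapes dX x) s' &
    s'.2 K =1 input dX [:: dec x [:: count id y] != 0].
  by exists s' => //; apply: run_le h1; nia.
have i0 : run mark_all 1 (init_tapes dX x) B.
  exists 1 => //; suff -> : B = apply_act (fun i => if dr0 <= i < K then (Some (inr dmk), Stay)
     else (scan (init_tapes dX x) i, Stay)) (init_tapes dX x) by exact: ExecAct.
  congr pair; apply/funext => i /=; first by case: ifP.
  apply/funext => j; rewrite /cells /init_tapes /scan /= /marked /input.
  case: (eqVneq i 0) => [->|i0] /=; first by case: eqP => // ->.
  case: (eqVneq i 1) => [->|i1] /=; first by case: eqP.
  by case: ifP => //=; case: eqP.
pose stA u : tapeconf dX := (fun i => if i == 1 then u else if i == dr0 then len x - u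
  else if i == dr0.+1 then u else 0, cells u).
have neq : [/\ (dr0 == 1) = false, (dr0.+1 == 1) = false, (dr0.+2 == 1) = false,
   (dr0.+1 == dr0) = false & (dr0.+2 == dr0) = false] by rewrite /dr0; split; lia.
have [n1 n2 n3 n4 n5] := neq.
have n2' : (dr0 == 0) = false by [].
have n6 : (dr0.+2 == dr0.+1) = false by lia.
have i1 : run cl (Tl x [::]) B (stA 0).
  have -> : stA 0 = seth B dr0 (len x).
    congr pair; apply/funext => i /=; rewrite subn0.
    case: (eqVneq i 1) => [->|_]; first by rewrite eq_sym n1.
    by case: (eqVneq i dr0) => // _; case: ifP.
  apply: (rl K x B Kl'); split=> // i /= hi; exact: mB.
have i2 : run emit_all (len x * (3 * G x + 3).+1).+1 (stA 0) (stA (len x)).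
  apply: run_while => [u ul|]; last first.
    by rewrite nonzeroE /= ?n1 ?eqxx ?subnn // mB //; lia.
  rewrite nonzeroE /= ?n1 ?eqxx -?lt0n ?subn_gt0 ?ul; last by apply: mB; lia.
  split=> //.
  have hG := obit_time ul; have hv := ob1 x [:: u]; set v := obit x [:: u] in hv.
  apply: (@run_le _ _ (To x [:: u] + (1 + (2 * v).+1))); first lia.
  have ok : ready dmk dr0 K x dr0.+2 (stA u).
    apply: rB => // i hi; rewrite !gtn_eqF //; move: hi; rewrite /dr0; lia.
  have ev : vals (stA u) [:: dr0.+1] = [:: u].
    by congr cons; rewrite /stA; cbv beta iota delta [fst]; rewrite n2 n4 eqxx.
  have := ro K x _ Ko' ok; rewrite ev -/v => r1.
  apply: run_seq r1 _.
  pose s2 := seth (stA u.+1) dr0.+2 v.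
  apply: (run_seq (s1 := s2)).
    exists 1 => //; set s1 := seth _ _ _.
    suff -> : s2 = apply_act (fun i => if i == 1 then (Some (inl (nonzero dmk dr0.+2 (scan s1))), MoveRight)
      else (scan s1 i, if i == dr0 then MoveLeft else if i == dr0.+1 then MoveRight else Stay)) s1.
      exact: ExecAct.
    have nz : nonzero dmk dr0.+2 (scan s1) = (v != 0).
      by rewrite nonzeroE /= ?eqxx // mB //; lia.
    rewrite nz; congr pair; apply/funext => i.
      rewrite /s1 /=.
      case: (eqVneq i dr0.+2) => [->|_]; first by rewrite n3 n5 n6.
      case: (eqVneq i 1) => //= _.
      case: (eqVneq i dr0) => //= _; first by rewrite subnS.
      by case: (eqVneq i dr0.+1).
    apply/funext => j; rewrite /s2 /s1 /= /scan /=.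
    have e0 X : (if j == X then cells u i X else cells u i j) = cells u i j.
      by case: eqP => [->|].
    case: (eqVneq i 1) => [->|i1'] /=; last by rewrite e0 /cells (negbTE i1').
    by rewrite /cells /= ltnS leq_eqVlt; case: (eqVneq j u) => [->|_].
  have e : s2.1 dr0.+2 = v by rewrite /= eqxx.
  rewrite -{1}e; apply: run_drain => //=; first by apply: mB; lia.
  move=> i; case: (eqVneq i dr0.+2) => [->|] //; by rewrite n3 n5 n6.
pose W : tapeconf dX := (fun=> 0, cells (len x)).
have i3 : run (drain dmk dr0.+1 [::] [:: 1]) (2 * len x).+1 (stA (len x)) W.
  have e : (stA (len x)).1 dr0.+1 = len x by rewrite /= ?n2 ?n2' n4 eqxx.
  rewrite -{1}e; apply: run_drain => //=; first by apply: mB; lia.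
  move=> i; rewrite ?n2 ?n2' n4 eqxx inE !subnn.
  case: (eqVneq i dr0.+1) => // _; case: (eqVneq i 1) => [_|_]; rewrite ?subnn //.
  by case: ifP.
have i4 : run set_state 1 W (embed (init M y0) W).
  exists 1 => //.
  suff -> : embed (init M y0) W = apply_act (fun i => (if i == tM.+2 then state_sym (start M) else scan W i, Stay)) W.
    exact: ExecAct.
  congr pair; apply/funext => i /=; first by case: tape_of.
  apply/funext => j; rewrite /scan /=.
  case e: (tape_of i) => [k|]; last first.
    case: (eqVneq i tM.+2) => [->|_]; last by case: eqP => // ->.
    case: eqP => // _; rewrite /cells /dr0 /= ltnn; by [].
  have -> : i = k.+1.
    by case: i e => //= i; case: insubP => // k' _ <- [->].
  have kb := ltn_ord k.
  have -> : (k.+1 == tM.+2) = false by lia.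
  suff -> : cells (len x) k.+1 = lift_sym \o written M (if k == ord0 then y0 else [::]).
    by case: (j =P 0) => [->|].
  apply/funext => l; rewrite /cells -val_eqE -[val k == _]/(k.+1 == 1) /comp.
  have -> : dr0 <= k.+1 < K = false by rewrite /dr0; lia.
  have -> : (k.+1 == 0) = false by [].
  case: (k.+1 == 1); last by rewrite /written nth_default.
  have sy : size y0 = len x by exact: size_mkseq.
  rewrite /written; cbv beta; have [jl|jl] := ltnP l (len x); last first.
    by rewrite nth_default; [|rewrite size_map sy].
  by rewrite (nth_map false) ?sy // nth_mkseq.
pose cf := iter t (@step M) (init M y0).
have [n nt [i5 hn]] := @run_simulate (init M y0) W t erefl erefl fin.
rewrite -/cf in i5 hn fin out.
pose E v w : tapeconf dX := (fun i => if i == tM.+1 then v else if i == dr0 then w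
   else if tape_of i is Some k then head_pos cf k else 0, (embed cf W).2).
have tm1 : tape_of tM.+1 = Some ord_max by rewrite -(tape_ofP ord_max).
have tr i : dr0 <= i -> tape_of i = None by move=> h; apply: tape_of_ge; rewrite /dr0 in h; lia.
have n7 : (tM.+1 == dr0) = false by rewrite /dr0; lia.
have mE i : dr0 <= i < K -> (embed cf W).2 i = marked dmk.
  move=> hi /=; rewrite tr; last by case/andP: hi.
  by rewrite gtn_eqF ?mB //; move: hi; rewrite /dr0; lia.
have i6 : run (drain dmk dr0 [::] [:: tM.+1]) (2 * t).+1 (embed cf (seth W dr0 n)) (E 0 0).
  set s1 := embed _ _; have e : s1.1 dr0 = n by rewrite /s1 /embed /seth; projs; rewrite tr // eqxx.
  apply: (@run_le _ _ (2 * s1.1 dr0).+1); first by rewrite e; lia.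
  apply: run_drain => //; first by apply: mE; lia.
  move=> i; rewrite inE e /E; projs.
  case: (eqVneq i dr0) => [->|ne]; first by rewrite eq_sym n7.
  case: (eqVneq i tM.+1) => [->|_] /=.
    by rewrite -/(tape_of tM.+1) tm1; apply/esym/eqP; have := hn ord_max; rewrite add0n.
  by rewrite (negbTE ne).
have i7 : run count_ones (size y * 2).+1 (E 0 0) (E (size y) (count id y)).
  pose st j := E j (count id (take j y)).
  have -> : E 0 0 = st 0 by rewrite /st take0.
  have -> : E (size y) (count id y) = st (size y) by rewrite /st take_size.
  have es j : scan (st j) tM.+1 = input dX y j.
    rewrite /scan /st /E /embed; projs; rewrite eqxx tm1 /= out.
    rewrite /written /input; have [jl|jl] := ltnP j (size y); last by rewrite !nth_default ?size_map.
    by rewrite !(nth_map false).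
  apply: run_while => [j jy|]; last first.
    by rewrite es /input nth_default ?size_map.
  have ej : input dX y j = Some (inl (nth false y j)) by rewrite /input (nth_map false).
  rewrite es ej; split=> //; exists 1 => //.
  suff -> : st j.+1 = apply_act (fun i => (scan (st j) i, if i == tM.+1 then MoveRight
        else if (i == dr0) && (scan (st j) tM.+1 == Some (inl true)) then MoveRight else Stay)) (st j).
    exact: ExecAct.
  rewrite es ej; congr pair; apply/funext => i; last first.
    by apply/funext => l; rewrite /scan; case: (l =P _) => // ->.
  rewrite /st /E /=; case: (eqVneq i tM.+1) => //= _.
  case: (eqVneq i dr0) => //= _.
  rewrite (take_nth false) // -cats1 count_cat /= addn0.
  by case: (nth false y j) => /=; rewrite ?addn1 ?addn0.
have ok : ready dmk dr0 K x dr0.+1 (E (size y) (count id y)).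
  split=> // i hi.
  rewrite /E; projs; rewrite tr ?gtn_eqF //; move: hi; rewrite /dr0; lia.
have := rd K x _ Kd' ok.
have -> : vals (E (size y) (count id y)) [:: dr0] = [:: count id y].
  by rewrite /= eq_sym n7 eqxx.
set v := dec _ _ => i8.
set s8 := seth _ _ _ in i8.
exists (apply_act (fun i => (if i == K then Some (inl (nonzero dmk dr0.+1 (scan s8))) else scan s8 i, Stay)) s8); last first.
  have nz : nonzero dmk dr0.+1 (scan s8) = (v != 0).
    by rewrite nonzeroE; [rewrite /s8 /= eqxx | apply: mE; lia].
  move=> j; transitivity (if j == s8.1 K then Some (inl (v != 0)) else s8.2 K j).
    by rewrite /= eqxx nz.
  have -> : s8.1 K = 0.
    rewrite /s8 /E /=  gtn_eqF; last lia.
    rewrite gtn_eqF; last by rewrite /dr0 in K3; lia.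
    rewrite gtn_eqF; last lia.
    by rewrite -/(tape_of K) tr //; lia.
  case: j => [|j] //=; rewrite -/(tape_of K) tr; last lia.
  rewrite gtn_eqF; last by rewrite /dr0 in K3; lia.
  rewrite /cells ltnn andbF.
  have -> : (K == 0) = false by lia.
  have -> : (K == 1) = false by lia.
  by rewrite /input nth_default.
apply: run_seq i0 _; apply: run_seq i1 _; apply: run_seq i2 _; apply: run_seq i3 _.
apply: run_seq i4 _; apply: run_seq i5 _; apply: run_seq i6 _; apply: run_seq i7 _.
apply: run_seq i8 _; exists 1 => //; exact: ExecAct.
Qed.

End Decider.

(** * Functions computable in quasi-polynomial time *)

Lemma rcomp_sel (X : finType) (mk : X) r0 (sel : seq nat -> seq nat) f T :
  (forall (u : nat -> nat) a, sel (map u a) = map u (sel a)) ->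
  (forall a, {subset sel a <= a}) ->
  rcomp mk r0 f T -> rcomp mk r0 (fun x a => f x (sel a)) (fun x a => T x (sel a)).
Proof.
move=> nat_sel sub [h1 h2]; split=> // k rho k0 hr.
have hr' : all (fun r => r0 <= r < k) (sel rho).
  by apply/allP => r /sub; apply: (allP hr).
have [c [K [? ? h]]] := h2 k _ k0 hr'; exists c, K; split=> // K' x s kk ok.
by have := h _ _ _ kk ok; rewrite /vals nat_sel.
Qed.

(** Only arguments above 1 are considered, so that constants are absorbed into the exponent. *)
Definition poly_bounded (F : nat -> nat) := exists p, forall b, 1 < b -> F b <= b ^ p.

Lemma pb_id : poly_bounded id.
Proof. by exists 1 => b _; rewrite expn1. Qed.

Lemma pb_const n : poly_bounded (fun=> n).
Proof. by exists n => b b1; apply: ltnW; exact: ltn_expl. Qed.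

Lemma pb_add F G : poly_bounded F -> poly_bounded G -> poly_bounded (fun b => F b + G b).
Proof.
move=> [p hp] [q hq]; exists (p + q).+1 => b b1.
have b0 : 0 < b by exact: ltnW.
have := hp b b1; have := hq b b1.
have h1 : b ^ p <= b ^ (p + q) by rewrite leq_pexp2l // leq_addr.
have h2 : b ^ q <= b ^ (p + q) by rewrite leq_pexp2l // leq_addl.
rewrite expnS; nia.
Qed.

Lemma pb_mul F G : poly_bounded F -> poly_bounded G -> poly_bounded (fun b => F b * G b).
Proof.
move=> [p hp] [q hq]; exists (p + q) => b b1.
by rewrite expnD; apply: leq_mul (hp _ b1) (hq _ b1).
Qed.

Lemma pb_exp F n : poly_bounded F -> poly_bounded (fun b => F b ^ n).
Proof.
move=> [p hp]; exists (p * n) => b b1; rewrite expnM.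
by case: n => // n; rewrite leq_exp2r // hp.
Qed.

Ltac pb := repeat first
  [ exact: pb_id | exact: pb_const | apply: pb_add | apply: pb_mul | apply: pb_exp ].

Definition loglen (x : seq bool) := (trunc_log 2 (size x)).+1.
Definition qpoly p (x : seq bool) := 2 ^ (p * loglen x ^ p).
(** The summand 2 keeps the base of the powers above 1. *)
Definition budget p (x : seq bool) (a : seq nat) := qpoly p x + (sumn a).+2.

Lemma qpolyW p q x : p <= q -> qpoly p x <= qpoly q x.
Proof. by move=> pq; rewrite leq_exp2l // leq_mul // leq_pexp2l. Qed.

Lemma budget_gt1 p x a : 1 < budget p x a.
Proof. by rewrite /budget; lia. Qed.

Lemma budgetW p q x a : p <= q -> budget p x a <= budget q x a.
Proof. by move=> pq; rewrite leq_add2r qpolyW. Qed.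

(* Functions computable in time polynomial in the arguments and
   quasi-polynomial in the length of the input word. *)
Definition PC (f : fn) := exists p, forall (X : finType) (mk : X) r0, 0 < r0 ->
  rcomp mk r0 f (fun x a => budget p x a ^ p).

Lemma PC_ext f g : (forall x a, f x a = g x a) -> PC f -> PC g.
Proof. by move=> e; have -> : f = g by apply/funext => x; apply/funext. Qed.

Lemma PC_le f : PC f -> exists p, forall x a, f x a <= budget p x a ^ p.
Proof. by case=> p h; exists p; case: (h bool true 1 isT). Qed.

Lemma PC_intro f p (F : nat -> nat) : poly_bounded F ->
  (forall (X : finType) (mk : X) r0, 0 < r0 -> exists2 T,
     rcomp mk r0 f T & forall x a, T x a <= F (budget p x a)) -> PC f.
Proof.
move=> [q hq] h; exists (p + q) => X mk r0 r1.
have [T hT le] := h X mk r0 r1; apply: rcomp_le hT => x a.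
apply: leq_trans (le x a) _; apply: leq_trans (hq _ (budget_gt1 _ _ _)) _.
apply: (@leq_trans (budget (p + q) x a ^ q)).
  by case: q {hq} => // q; rewrite leq_exp2r // budgetW // leq_addr.
by rewrite leq_pexp2l ?leq_addl // ltnW // budget_gt1.
Qed.

Lemma PC_lit n : PC (fun _ _ => n).
Proof.
apply: (@PC_intro _ 0 (fun=> n.+1)); first pb.
by move=> X mk r0 r1; exists (fun _ _ => n.+1) => //; apply: rcomp_lit.
Qed.

Lemma nth_sumn (a : seq nat) i : nth 0 a i <= sumn a.
Proof.
elim: a i => [|u a ih] [|i] //=; first exact: leq_addr.
by apply: leq_trans (ih i) _; exact: leq_addl.
Qed.

Lemma PC_nth i : PC (fun _ a => nth 0 a i).
Proof.
apply: (@PC_intro _ 0 (fun b => 4 * b)); first pb.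
move=> X mk r0 r1; eexists; first exact: rcomp_nth.
by move=> x a /=; have := nth_sumn a i; rewrite /budget; lia.
Qed.

Lemma PC_size : PC (fun x _ => size x).
Proof.
apply: (@PC_intro _ 1 (fun b => 5 * b + 3)); first pb.
move=> X mk r0 r1; eexists; first exact: rcomp_size.
move=> x a /=; suff : size x < qpoly 1 x by rewrite /budget; lia.
by rewrite /qpoly mul1n expn1; apply: trunc_log_ltn.
Qed.

Lemma PC_succ f : PC f -> PC (fun x a => (f x a).+1).
Proof.
move=> [p hp]; apply: (@PC_intro _ p (fun b => b ^ p + 1)); first pb.
move=> X mk r0 r1; eexists; first exact: rcomp_succ (hp X mk r0 r1).
by move=> x a; rewrite addn1.
Qed.

Lemma PC_isbit b f : PC f -> PC (fun x a => isbit b x (f x a)).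
Proof.
move=> [p hp]; apply: (@PC_intro _ p (fun b => 5 * b ^ p + 4)); first pb.
by move=> X mk r0 r1; eexists; first exact: rcomp_isbit (hp X mk r0 r1).
Qed.

Lemma PC_behead f : PC f -> PC (fun x a => f x (behead a)).
Proof.
move=> [p hp]; apply: (@PC_intro _ p (fun b => b ^ p)); first pb.
move=> X mk r0 r1; eexists; first exact: rcomp_behead (hp X mk r0 r1).
move=> x a /=; case: p {hp} => // p; rewrite leq_exp2r // /budget.
by case: a => //= u a; lia.
Qed.

(** Removes the accumulator from the arguments of a loop body, leaving the index and the outer
    arguments. *)
Definition skip1 (a : seq nat) := take 1 a ++ drop 2 a.

Lemma PC_skip1 f : PC f -> PC (fun x a => f x (skip1 a)).
Proof.
move=> [p hp]; apply: (@PC_intro _ p (fun b => b ^ p)); first pb.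
move=> X mk r0 r1; eexists; first apply: rcomp_sel (hp X mk r0 r1).
- by move=> u a; rewrite /skip1 map_cat map_take map_drop.
- by move=> a i; rewrite mem_cat => /orP[/mem_take|/mem_drop].
move=> x a /=; case: p {hp} => // p; rewrite leq_exp2r // /budget /skip1.
by case: a => [|u [|v a]] //=; rewrite ?take0 ?drop0 /=; lia.
Qed.

Lemma PC_let f g : PC f -> PC g -> PC (fun x a => f x (g x a :: a)).
Proof.
move=> [p hp] [q hq].
apply: (@PC_intro _ (p + q) (fun b => 3 * b ^ q + 3 * (b + b ^ q) ^ p + 2)); first pb.
move=> X mk r0 r1; eexists; first exact: rcomp_let (hp X mk r0 r1) (hq X mk r0 r1).
move=> x a /=; have [le _] := hq X mk r0 r1; have := le x a.
have b1 : budget q x a ^ q <= budget (p + q) x a ^ q.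
  by case: q {hq le} => // q; rewrite leq_exp2r // budgetW // leq_addl.
move=> h; rewrite leq_add2r; apply: leq_add; first by rewrite leq_mul2l b1.
rewrite leq_mul2l /=; case: p {hp} b1 => // p b1; rewrite leq_exp2r //.
rewrite /budget /= in h *; have := qpolyW x (leq_addr q p.+1).
by rewrite /budget in b1; lia.
Qed.

(** Iteration could square its accumulator again and again; the hypothesis on the intermediate
    values rules out such growth. *)
Lemma PC_iteri n h g q : PC n -> PC h -> PC g ->
  (forall x a i, i <= n x a ->
    iteri i (fun i y => g x [:: i, y & a]) (h x a) <= budget q x a ^ q) ->
  PC (fun x a => iteri (n x a) (fun i y => g x [:: i, y & a]) (h x a)).
Proof.
move=> [pn hn] [ph hh] [pg hg] hq.
pose P := pn + ph + pg + q.
have bP m x a : m <= P -> forall e, budget m x a ^ e <= budget P x a ^ e.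
  by move=> mP [|e] //; rewrite leq_exp2r // budgetW.
apply: (@PC_intro _ P (fun b => 3 * b ^ pn + b ^ ph +
   b ^ pn * (5 * (b + b ^ pn + b ^ q) ^ pg + 2 * b ^ ph + 5) + 2)); first pb.
move=> X mk r0 r1; eexists.
  apply: (rcomp_iteri (G := fun x a => (budget P x a + budget P x a ^ pn + budget P x a ^ q) ^ pg) r1
    (hn X mk r0 r1) (hh X mk r0 r1) (hg X mk r0 r1)) => x a i lt.
  set v := iteri _ _ _.
  have hv : v <= budget P x a ^ q by apply: leq_trans (hq x a i (ltnW lt)) (bP _ _ _ _ _); rewrite /P; lia.
  have hi : i <= budget P x a ^ pn.
    have [le _] := hn X mk r0 r1; apply: leq_trans (ltnW lt) (leq_trans (le x a) (bP _ _ _ _ _)); rewrite /P; lia.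
  have gP : pg <= P by rewrite /P; lia.
  clearbody P; clear hg; case: pg gP => // pg gP; rewrite leq_exp2r //.
  rewrite /budget /= -/(budget P x a); have := qpolyW x gP.
  by rewrite /budget in hv hi *; lia.
move=> x a /=.
have nP : n x a <= budget P x a ^ pn.
  have [le _] := hn X mk r0 r1; apply: leq_trans (le x a) (bP _ _ _ _ _); rewrite /P; lia.
have b1 : budget pn x a ^ pn <= budget P x a ^ pn by apply: bP; rewrite /P; lia.
have b2 : budget ph x a ^ ph <= budget P x a ^ ph by apply: bP; rewrite /P; lia.
rewrite leq_add2r; apply: leq_add; first by lia.
by apply: leq_mul => //; lia.
Qed.

Lemma PC_comp1 F g : PC (fun x a => F x (nth 0 a 0)) -> PC g ->
  PC (fun x a => F x (g x a)).
Proof. by move=> hF hg; apply: PC_ext (PC_let hF hg). Qed.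

Lemma PC_comp2 F g h : PC (fun x a => F x (nth 0 a 0) (nth 0 a 1)) -> PC g -> PC h ->
  PC (fun x a => F x (g x a) (h x a)).
Proof.
move=> hF hg hh; apply: PC_ext (PC_let (PC_let hF (PC_behead hg)) hh) => x a //.
Qed.

Lemma PC_comp3 F g h k : PC (fun x a => F x (nth 0 a 0) (nth 0 a 1) (nth 0 a 2)) ->
  PC g -> PC h -> PC k -> PC (fun x a => F x (g x a) (h x a) (k x a)).
Proof.
move=> hF hg hh hk.
by apply: PC_ext (PC_let (PC_let (PC_let hF (PC_behead (PC_behead hg))) (PC_behead hh)) hk).
Qed.

(** * Arithmetic and logic within the class *)

Lemma PC_add f g : PC f -> PC g -> PC (fun x a => f x a + g x a).
Proof.
apply: (@PC_comp2 (fun _ => addn)).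
apply: (@PC_ext (fun x a => iteri (nth 0 a 1) (fun i y => (nth 0 [:: i, y & a] 1).+1) (nth 0 a 0))).
  by move=> x a; elim: (nth 0 a 1) => [|m ih] /=; rewrite ?addn0 ?addnS ?ih.
apply: (@PC_iteri _ _ (fun x a => (nth 0 a 1).+1) 2); [exact: PC_nth|exact: PC_nth| exact: PC_succ (PC_nth 1)|].
move=> x a i le.
have -> : iteri i (fun i y => (nth 0 [:: i, y & a] 1).+1) (nth 0 a 0) = i + nth 0 a 0.
  by elim: i {le} => //= i ->.
have := nth_sumn a 0; have := nth_sumn a 1; rewrite expnS expn1.
by rewrite /budget; nia.
Qed.

Lemma PC_mul f g : PC f -> PC g -> PC (fun x a => f x a * g x a).
Proof.
apply: (@PC_comp2 (fun _ => muln)).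
have e (x : seq bool) a i : iteri i (fun i y => nth 0 [:: i, y & a] 1 + nth 0 [:: i, y & a] 2) 0 = nth 0 a 0 * i.
  by elim: i => [|i] /=; rewrite ?muln0 // mulnS addnC => ->.
apply: (@PC_ext (fun x a => iteri (nth 0 a 1) (fun i y => nth 0 [:: i, y & a] 1 + nth 0 [:: i, y & a] 2) 0)).
  by move=> x a; rewrite (e x).
apply: (@PC_iteri _ _ (fun x a => nth 0 a 1 + nth 0 a 2) 2); [exact: PC_nth|exact: PC_lit| exact: PC_add (PC_nth 1) (PC_nth 2)|].
move=> x a i le; rewrite (e x).
have := nth_sumn a 0; have := nth_sumn a 1; rewrite expnS expn1.
by rewrite /budget; nia.
Qed.

Lemma PC_pred f : PC f -> PC (fun x a => (f x a).-1).
Proof.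
apply: (@PC_comp1 (fun _ => predn)).
apply: (@PC_ext (fun x a => iteri (nth 0 a 0) (fun i y => nth 0 [:: i, y & a] 0) 0)).
  by move=> x a; case: (nth 0 a 0).
apply: (@PC_iteri _ _ (fun x a => nth 0 a 0) 1); [exact: PC_nth|exact: PC_lit| exact: PC_nth|].
move=> x a i le; have := nth_sumn a 0; rewrite expn1 /budget.
by case: i le => [|i] /=; lia.
Qed.

Lemma PC_sub f g : PC f -> PC g -> PC (fun x a => f x a - g x a).
Proof.
apply: (@PC_comp2 (fun _ => subn)).
have e (x : seq bool) a i : iteri i (fun i y => (nth 0 [:: i, y & a] 1).-1) (nth 0 a 0) = nth 0 a 0 - i.
  by elim: i => [|i] /=; rewrite ?subn0 // subnS => ->.
apply: (@PC_ext (fun x a => iteri (nth 0 a 1) (fun i y => (nth 0 [:: i, y & a] 1).-1) (nth 0 a 0))).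
  by move=> x a; rewrite (e x).
apply: (@PC_iteri _ _ (fun x a => (nth 0 a 1).-1) 1); [exact: PC_nth|exact: PC_nth| exact: PC_pred (PC_nth 1)|].
by move=> x a i le; rewrite (e x); have := nth_sumn a 0; rewrite expn1 /budget; lia.
Qed.

Lemma PC_leq f g : PC f -> PC g -> PC (fun x a => f x a <= g x a).
Proof.
move=> hf hg; apply: PC_ext (PC_sub (PC_lit 1) (PC_sub hf hg)) => x a.
by rewrite /leq; case: (f x a - g x a).
Qed.

Lemma PC_ltn f g : PC f -> PC g -> PC (fun x a => f x a < g x a).
Proof. by move=> hf hg; apply: (PC_leq (PC_succ hf) hg). Qed.

Lemma PC_and (p q : seq bool -> seq nat -> bool) : PC p -> PC q -> PC (fun x a => p x a && q x a).
Proof. by move=> hp hq; apply: PC_ext (PC_mul hp hq) => x a; rewrite mulnb. Qed.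

Lemma PC_not (p : seq bool -> seq nat -> bool) : PC p -> PC (fun x a => ~~ p x a).
Proof. by move=> hp; apply: PC_ext (PC_sub (PC_lit 1) hp) => x a; case: (p x a). Qed.

Lemma PC_or (p q : seq bool -> seq nat -> bool) : PC p -> PC q -> PC (fun x a => p x a || q x a).
Proof.
move=> hp hq; apply: PC_ext (PC_not (PC_and (PC_not hp) (PC_not hq))) => x a.
by rewrite negb_and !negbK.
Qed.

Lemma PC_eq f g : PC f -> PC g -> PC (fun x a => f x a == g x a).
Proof.
move=> hf hg; apply: PC_ext (PC_and (PC_leq hf hg) (PC_leq hg hf)) => x a.
by rewrite eqn_leq.
Qed.

Lemma PC_if (p : seq bool -> seq nat -> bool) f g : PC p -> PC f -> PC g ->
  PC (fun x a => if p x a then f x a else g x a).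
Proof.
move=> hp hf hg; apply: PC_ext (PC_add (PC_mul hp hf) (PC_mul (PC_not hp) hg)) => x a.
by case: (p x a); rewrite /= ?mul1n ?mul0n ?addn0.
Qed.

Lemma PC_sum (f : fn) (G : seq bool -> nat -> seq nat -> nat) : PC f ->
  PC (fun x a => G x (head 0 a) (behead a)) ->
  PC (fun x a => \sum_(i < f x a) G x i a).
Proof.
move=> hf hG.
have e x a m : iteri m (fun i y => nth 0 [:: i, y & a] 1 +
    G x (head 0 (skip1 [:: i, y & a])) (behead (skip1 [:: i, y & a]))) 0 = \sum_(i < m) G x i a.
  by elim: m => [|m ih]; rewrite ?big_ord0 // big_ord_recr /= ih /skip1 /= drop0.
have [p hp] := PC_le hf; have [q hq] := PC_le hG.
have le x a m : m <= f x a -> \sum_(i < m) G x i a <=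
    budget (p + q) x a ^ p * (budget (p + q) x a ^ p + budget (p + q) x a) ^ q.
  move=> mf; apply: (@leq_trans (\sum_(i < m) (budget (p + q) x a ^ p + budget (p + q) x a) ^ q)).
    apply: leq_sum => i _; apply: leq_trans (hq x ((i : nat) :: a)) _.
    have h1 : i <= budget (p + q) x a ^ p.
      apply: leq_trans (leq_trans (ltnW (ltn_ord i)) mf) (leq_trans (hp x a) _).
      by case: (p) => // p'; rewrite leq_exp2r // budgetW // leq_addr.
    case: q {hq} h1 => // q h1; rewrite leq_exp2r //.
    rewrite /budget /= in h1 *; have := qpolyW x (leq_addl p q.+1); lia.
  rewrite sum_nat_const card_ord leq_mul2r (leq_trans mf) ?orbT //.
  apply: leq_trans (hp x a) _.
  by case: (p) => // p'; rewrite leq_exp2r // budgetW // leq_addr.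
apply: (PC_ext (fun x a => e x a (f x a))).
have [u hu] : poly_bounded (fun b => b ^ p * (b ^ p + b) ^ q) by pb.
apply: (@PC_iteri _ _ (fun x s => nth 0 s 1 + G x (head 0 (skip1 s)) (behead (skip1 s))) (p + q + u)) => //.
- exact: PC_lit.
- exact: PC_add (PC_nth 1) (PC_skip1 hG).
move=> x a i hi; rewrite e; apply: leq_trans (le _ _ _ hi) _.
apply: leq_trans (hu _ (budget_gt1 _ _ _)) _.
apply: (@leq_trans (budget (p + q + u) x a ^ u)).
  by case: (u) => // u'; rewrite leq_exp2r // budgetW // leq_addr.
by rewrite leq_pexp2l ?leq_addl // ltnW // budget_gt1.
Qed.

Lemma PC_has (f : fn) (P : seq bool -> nat -> seq nat -> bool) : PC f ->
  PC (fun x a => P x (head 0 a) (behead a)) ->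
  PC (fun x a => has (fun y => P x y a) (iota 0 (f x a))).
Proof.
move=> hf hP.
apply: PC_ext (PC_ltn (PC_lit 0) (PC_sum (G := fun x y a => P x y a) hf hP)) => x a.
congr nat_of_bool; rewrite lt0n sum_nat_eq0; apply/idP/hasP => [|[y]].
  case/forallPn=> i; rewrite negb_imply => /andP[_].
  by case e: (P _ _ _) => // _; exists (i : nat); rewrite ?mem_iota ?ltn_ord.
rewrite mem_iota /= => yf Py; apply/forallPn; exists (Ordinal yf).
by rewrite /= Py.
Qed.

(** The quotient is the number of [i] with [i.+1 * g <= f]; the factor [0 < g] implements the
    convention that division by 0 gives 0. *)
Lemma PC_divn f g : PC f -> PC g -> PC (fun x a => f x a %/ g x a).
Proof.
move=> hf hg.
have h : PC (fun x a => (0 < g x a) * \sum_(i < f x a) (i.+1 * g x a <= f x a)).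
  apply: PC_mul (PC_ltn (PC_lit 0) hg) _.
  apply: (PC_sum (G := fun x i a => i.+1 * g x a <= f x a) hf).
  apply: PC_leq (PC_behead hf); apply: PC_mul (PC_behead hg).
  by apply: PC_ext (PC_succ (PC_nth 0)) => x a; rewrite nth0.
apply: PC_ext h => x a; case: (posnP (g x a)) => [->|g0]; first by rewrite divn0.
rewrite mul1n -(big_mkord xpredT (fun i => (i.+1 * g x a <= f x a) : nat)).
rewrite (eq_bigr (fun i => (i < f x a %/ g x a) : nat)); last by move=> i _; rewrite leq_divRL.
rewrite (big_cat_nat _ (n := f x a %/ g x a)) //= ?leq_div //.
rewrite big_nat_cond (eq_bigr (fun=> 1)); last by move=> i /andP[/andP[_ ->]].
rewrite -big_nat_cond sum_nat_const_nat subn0 muln1 big_nat_cond big1 ?addn0 //.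
by move=> i /andP[/andP[h _] _]; rewrite ltnNge h.
Qed.

Lemma PC_modn f g : PC f -> PC g -> PC (fun x a => f x a %% g x a).
Proof.
move=> hf hg; apply: PC_ext (PC_sub hf (PC_mul (PC_divn hf hg) hg)) => x a.
by rewrite {1}(divn_eq (f x a) (g x a)) addKn.
Qed.

Lemma PC_minn f g : PC f -> PC g -> PC (fun x a => minn (f x a) (g x a)).
Proof. by move=> hf hg; apply: PC_if => //; exact: PC_ltn. Qed.

Lemma minn_expn u e b : iteri e (fun _ y => minn (y * u) b) (minn 1 b) = minn (u ^ e) b.
Proof.
elim: e => [|e /= ->] //; rewrite expnSr.
case: u => [|u]; first by rewrite !muln0.
case: (leqP (u.+1 ^ e) b) => h1 //; set w := u.+1 ^ e in h1 *.
by rewrite !(minn_idPr _) //; nia.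
Qed.

(** Capping every partial product keeps the loop within budget. A power known to lie below a
    computable bound is then obtained as a capped one. *)
Lemma PC_capped_exp f g h : PC f -> PC g -> PC h ->
  PC (fun x a => minn (f x a ^ g x a) (h x a)).
Proof.
apply: (@PC_comp3 (fun _ u e b => minn (u ^ e) b)).
have e (x : seq bool) a i : iteri i (fun i y => minn (nth 0 [:: i, y & a] 1 * nth 0 [:: i, y & a] 2)
   (nth 0 [:: i, y & a] 4)) (minn 1 (nth 0 a 2)) = minn (nth 0 a 0 ^ i) (nth 0 a 2).
  exact: minn_expn.
apply: PC_ext (fun x a => e x a (nth 0 a 1)) _.
apply: (@PC_iteri _ _ (fun x s => minn (nth 0 s 1 * nth 0 s 2) (nth 0 s 4)) 1).
- exact: PC_nth.
- exact: PC_minn (PC_lit 1) (PC_nth 2).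
- by apply: PC_minn (PC_nth 4); apply: PC_mul (PC_nth 1) (PC_nth 2).
move=> x a i _; rewrite (e x) expn1 geq_min /budget.
by have := nth_sumn a 2; lia.
Qed.

Lemma PC_expn_lit f c : PC f -> PC (fun x a => f x a ^ c).
Proof.
move=> hf; elim: c => [|c ih]; first exact: PC_lit.
by apply: PC_ext (PC_mul hf ih) => x a; rewrite expnS.
Qed.

Lemma PC_loglen : PC (fun x _ => loglen x).
Proof.
apply: (@PC_ext (fun x a => (\sum_(i < size x) (minn (2 ^ i.+1) (size x).+1 <= size x)).+1)).
  move=> x a; congr S; set n := size x.
  rewrite -(big_mkord xpredT (fun i => (minn (2 ^ i.+1) n.+1 <= n) : nat)).
  have ln : trunc_log 2 n <= n.
    case: n => [|n]; first by rewrite trunc_log0.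
    by apply: leq_trans (trunc_logP (isT : 1 < 2) (ltn0Sn n)); apply: ltnW; exact: ltn_expl.
  rewrite big_nat_cond (eq_bigr (fun i => (i < trunc_log 2 n) : nat)); last first.
    move=> i /andP[/andP[_ hi] _]; rewrite geq_min ltnn orbF; congr nat_of_bool.
    apply/idP/idP => [|h]; first exact: trunc_log_max.
    apply: leq_trans (trunc_logP (isT : 1 < 2) _); last by lia.
    by rewrite leq_exp2l.
  rewrite -big_nat_cond (big_cat_nat _ (n := trunc_log 2 n)) //=.
  rewrite big_nat_cond (eq_bigr (fun=> 1)); last by move=> i /andP[/andP[_ ->]].
  rewrite -big_nat_cond sum_nat_const_nat subn0 muln1 big_nat_cond big1 ?addn0 //.
  by move=> i /andP[/andP[h _] _]; rewrite ltnNge h.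
apply: PC_succ; apply: (PC_sum (G := fun x i _ => minn (2 ^ i.+1) (size x).+1 <= size x) PC_size).
apply: PC_leq PC_size; apply: PC_capped_exp (PC_succ PC_size); first exact: PC_lit.
by apply: PC_succ; apply: PC_ext (PC_nth 0) => x a; rewrite nth0.
Qed.

(** An exponential is affordable when its exponent is polylogarithmic: this is what [qpoly] provides
    for in the budget. *)
Lemma PC_exp2 (f : seq bool -> nat) c : PC (fun x _ => f x) ->
  (forall x, f x <= c * loglen x ^ c) -> PC (fun x _ => 2 ^ f x).
Proof.
move=> hf le.
have e (x : seq bool) a i : iteri i (fun i y => nth 0 [:: i, y & a] 1 + nth 0 [:: i, y & a] 1) 1 = 2 ^ i.
  by elim: i => //= i ->; rewrite addnn -mul2n expnS.
apply: PC_ext (fun x a => e x a (f x)) _.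
apply: (@PC_iteri _ _ (fun x s => nth 0 s 1 + nth 0 s 1) c.+1) => //.
- exact: PC_lit.
- exact: PC_add (PC_nth 1) (PC_nth 1).
move=> x a i hi; rewrite (e x).
apply: (@leq_trans (budget c.+1 x a)); last first.
  by rewrite -{1}(expn1 (budget _ _ _)) leq_pexp2l // ltnW // budget_gt1.
apply: leq_trans (leq_addr _ _); rewrite leq_exp2l //.
apply: leq_trans hi (leq_trans (le x) _); apply: leq_mul => //.
by rewrite leq_pexp2l.
Qed.

Lemma PC_table (l : seq nat) f : PC f -> PC (fun x a => nth 0 l (f x a)).
Proof.
elim: l f => [|u l ih] f hf.
  by apply: PC_ext (PC_lit 0) => x a; rewrite nth_nil.
apply: PC_ext (PC_if (PC_eq hf (PC_lit 0)) (PC_lit u) (ih _ (PC_pred hf))) => x a.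
by case: (f x a).
Qed.

(** * Horn systems as digraphs *)

Lemma acyclic_rank (G : digraph) (rk : G -> nat) :
  (forall v w : G, edge v w -> rk v < rk w) -> acyclic G.
Proof.
move=> h [|x p] //= hp.
have : path (relpre rk ltn) x (rcons p x) by apply: sub_path hp.
move/order_path_min => /(_ (fun u v w => @ltn_trans _ _ _)) /allP /(_ x).
by rewrite mem_rcons inE eqxx /= ltnn => /(_ isT).
Qed.

Section Propagation.
Variable G : digraph.
Implicit Types S X : {set G}.

Lemma subset_propagate X : X \subset propagate X.
Proof. exact: subsetUl. Qed.

(** If none of the first [#|G|.+1] rounds were stationary, each would add a node. *)
Lemma power_dominated_fix S : propagate (power_dominated S) = power_dominated S.
Proof.
rewrite /power_dominated; set X := initially_dominated S.
have [k kG hk] : exists2 k, k <= #|G| & propagate (iter k (@propagate G) X) = iter k (@propagate G) X.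
  have [/existsP[k /eqP hk]|/existsPn h] :=
    boolP [exists k : 'I_#|G|.+1, propagate (iter k (@propagate G) X) == iter k (@propagate G) X].
    by exists k => //; rewrite -ltnS.
  have : forall k, k <= #|G|.+1 -> k <= #|iter k (@propagate G) X|.
    elim=> // k ih kG; apply: leq_ltn_trans (ih (ltnW kG)) _ => /=.
    apply: proper_card; rewrite properEneq subset_propagate andbT eq_sym.
    exact: (h (Ordinal kG)).
  move=> /(_ _ (leqnn _)) /leq_trans /(_ (max_card _)).
  by rewrite ltnn.
by rewrite -(subnK kG) iterD; elim: (#|G| - k) => //= n ih; rewrite !ih.
Qed.

Lemma sub_power_dominated S : initially_dominated S \subset power_dominated S.
Proof.
rewrite /power_dominated; elim: #|G| => //= n ih.
exact: subset_trans ih (subset_propagate _).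
Qed.

Lemma power_dominated_closed S v w : v \in power_dominated S ->
  out_nbrs v :\: power_dominated S \subset [set w] -> edge v w ->
  w \in power_dominated S.
Proof.
move=> vP sub vw; apply: contraT => wP.
suff : w \in propagate (power_dominated S) by rewrite power_dominated_fix (negbTE wP).
rewrite !inE; apply/orP; right; apply/existsP; exists v; rewrite vP /= eqEsubset sub /=.
by apply/subsetP => u; rewrite inE => /eqP ->; rewrite !inE wP.
Qed.

(** When [v] forces [w], its other out-neighbours are already dominated, so the invariant is
    available for all of them. *)
Lemma power_dominated_ind S (I : G -> Prop) :
  (forall v, v \in initially_dominated S -> I v) ->
  (forall v w, I v -> edge v w -> (forall u, edge v u -> u != w -> I u) -> I w) ->
  forall v, v \in power_dominated S -> I v.
Proof.
move=> h0 hs; rewrite /power_dominated; elim: #|G| => //= n ih v.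
rewrite inE => /orP[/ih //|]; rewrite inE => /existsP[u /andP[uX /eqP e]].
have uv : v \in [set v] by rewrite inE.
move: (uv); rewrite -e !inE => /andP[_ euv].
apply: (hs u v (ih _ uX) euv) => w uw wv; apply: ih.
by apply: contraNT wv => wX; rewrite -(in_set1 w v) -e !inE wX.
Qed.

End Propagation.

(* Rule [v] derives the out-neighbour of its prime from the atoms in its body:
   the root dominates [v], and [v] then has to pass on its prime once the body
   is dominated. *)
Section Horn.
Variables (G : digraph) (r : G) (free hlp prm atm : pred G) (mate body head : rel G).
Hypothesis edgeE : forall v w : G, edge v w =
  [|| (v == r) && (w != r) && free w, hlp v && (mate v w || body v w) | prm v && head v w].
Hypothesis kinds : forall v, [|| free v, prm v | atm v].
Hypothesis mate_prm : forall v w, mate v w -> prm w.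
Hypothesis mate_fun : forall v w w', mate v w -> mate v w' -> w = w'.
Hypothesis mate_inj : forall v v' w, mate v w -> mate v' w -> v = v'.
Hypothesis prm_mate : forall w, prm w -> exists2 v, hlp v & mate v w.
Hypothesis hlp_mate : forall v, hlp v -> exists w, mate v w.
Hypothesis body_atm : forall v w, body v w -> atm w.
Hypothesis head_atm : forall v w, head v w -> atm w.
Hypothesis head_fun : forall v w w', head v w -> head v w' -> w = w'.
Hypothesis hlp_free : forall v, hlp v -> free v.
Hypothesis prm_free : forall v, prm v -> ~~ free v.
Hypothesis atm_free : forall v, atm v -> ~~ free v && ~~ prm v.
Hypothesis r_free : free r.
Hypothesis r_hlp : ~~ hlp r.

Lemma free_dominated U v : free v -> v \in power_dominated (r |: U).
Proof.
move=> fv; apply: (subsetP (sub_power_dominated _)); rewrite !inE.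
have [//|vr] := eqVneq v r; apply/orP; right.
by apply/bigcupP; exists r; rewrite !inE ?eqxx // edgeE eqxx vr fv.
Qed.

Lemma prime_dominated U v w : hlp v -> mate v w ->
  (forall a, body v a -> a \in power_dominated (r |: U)) ->
  w \in power_dominated (r |: U).
Proof.
move=> hv vw hb; apply: (@power_dominated_closed _ _ v).
- exact/free_dominated/hlp_free.
- apply/subsetP => u; rewrite !inE => /andP[uX]; rewrite edgeE.
  have vr : v != r by apply: contraNneq r_hlp => <-.
  rewrite (negbTE vr) /= hv /= => /orP[/orP[/mate_fun-/(_ _ vw) -> //|/hb]|/andP[/prm_free]].
    by rewrite (negbTE uX).
  by rewrite hlp_free.
- by rewrite edgeE hv vw orbT.
Qed.

(** Derivability is expressed as membership in every [Y] that contains [U] and is closed under the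
    rules. Once all atoms are dominated, every rule passes on its prime, so the primes follow. *)
Lemma horn_complete (U : {set G}) :
  (forall Y : G -> Prop, (forall u, u \in U -> Y u) ->
     (forall v p w, hlp v -> mate v p -> head p w ->
        (forall a, body v a -> Y a) -> Y w) -> forall a, atm a -> Y a) ->
  power_dominates (r |: U).
Proof.
move=> hU.
have hA : forall a, atm a -> a \in power_dominated (r |: U).
  apply: hU => [u uU|v p w hv vp pw hb].
    by apply: (subsetP (sub_power_dominated _)); rewrite !inE uU orbT.
  have pP := prime_dominated hv vp hb; have pp := mate_prm vp.
  have ph : ~~ hlp p by apply: contra (prm_free pp); exact: hlp_free.
  have pr : p != r by apply: contraNneq (prm_free pp) => ->.
  apply: (power_dominated_closed pP); last by rewrite edgeE pp pw !orbT.
  apply/subsetP => u; rewrite !inE => /andP[uX]; rewrite edgeE.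
  by rewrite (negbTE pr) (negbTE ph) /= => /andP[_ /head_fun-/(_ _ pw) ->].
rewrite /power_dominates eqEsubset subsetT /=; apply/subsetP => v _.
case/or3P: (kinds v) => [fv|pv|/hA //]; first exact: free_dominated.
have [u hu uv] := prm_mate pv; apply: (prime_dominated hu uv) => a /body_atm; exact: hA.
Qed.

(** Under [J], a dominated prime means that the whole body of its rule satisfies [I]. Propagation
    may also run backwards: when the prime and all but one atom of the body are dominated, the rule
    forces the last atom. But [J] of the prime already gives [I] of that atom, so nothing is gained.
    The last three hypotheses cover what chosen atoms, rules and primes give at once. *)
Lemma horn_sound (S : {set G}) (I : G -> Prop) : power_dominates S ->
  (forall v p w, hlp v -> mate v p -> head p w ->
     (forall a, body v a -> I a) -> I w) ->
  (forall v, v \in S -> atm v -> I v) ->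
  (forall v a, v \in S -> hlp v -> body v a -> I a) ->
  (forall v p a, p \in S -> hlp v -> mate v p -> body v a -> I a) ->
  forall a, atm a -> I a.
Proof.
move=> /eqP pd hr hSa hSh hSp.
pose J v := (atm v -> I v) /\ (forall u a, hlp u -> mate u v -> body u a -> I a).
suff h : forall v, v \in power_dominated S -> J v.
  by move=> a aa; case: (h a _) => [|hi _]; [rewrite pd inE | exact: hi].
have J_free v : free v -> J v.
  move=> fv; split=> [/atm_free|u a _ /mate_prm /prm_free]; by rewrite fv.
have J_atm a : atm a -> I a -> J a.
  move=> aa ia; split=> // u b _ /mate_prm pa.
  by have := atm_free aa; rewrite pa andbF.
apply: power_dominated_ind => [v|v w [va vp] vw hv].
  rewrite !inE => /orP[vS|/bigcupP[u uS]].
    split=> [va|u a hu uv ua]; first exact: hSa.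
    exact: hSp uv ua.
  rewrite inE edgeE => /or3P[/andP[/andP[_ _] /J_free //]|/andP[hu]|/andP[pu uv]].
    case/orP=> [uv|uv].
      split=> [/atm_free|u' a hu' u'v]; first by rewrite (mate_prm uv) andbF.
      by rewrite (mate_inj u'v uv); exact: hSh.
    by apply: (J_atm _ (body_atm uv)); exact: hSh uv.
  have [u' hu' u'u] := prm_mate pu.
  apply: (J_atm _ (head_atm uv)); apply: (hr u' u v hu' u'u uv) => a; exact: (hSp u' u a uS hu' u'u).
move: (vw); rewrite edgeE => /or3P[/andP[/andP[_ _] /J_free //]|/andP[hv']|/andP[pv vw']].
  case/orP=> [mvw|bvw].
    split=> [/atm_free|u a hu uw]; first by rewrite (mate_prm mvw) andbF.
    rewrite (mate_inj uw mvw) => va'.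
    have va2 : edge v a by rewrite edgeE hv' va' !orbT.
    have aw : a != w.
      by apply: contraTneq (mate_prm mvw) => <-; have /andP[] := atm_free (body_atm va').
    by case: (hv a va2 aw) => ia _; exact: ia (body_atm va').
  have [p vp'] := hlp_mate hv'.
  apply: (J_atm _ (body_atm bvw)).
  have vp2 : edge v p by rewrite edgeE hv' vp' !orbT.
  have pw : p != w.
    by apply: contraTneq (mate_prm vp') => ->; have /andP[] := atm_free (body_atm bvw).
  by case: (hv p vp2 pw) => _; apply; eauto.
have [u hu uv] := prm_mate pv.
apply: (J_atm _ (head_atm vw')); apply: (hr u v w hu uv vw') => a; exact: (vp u a hu uv).
Qed.

End Horn.

(** * The Horn system of a verifier *)

Lemma big_ord_mul a b (F : nat -> nat) :
  \sum_(v < a * b) F v = \sum_(p < a) \sum_(u < b) F (p * b + u).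
Proof.
elim: a => [|a ih]; first by rewrite !big_ord0.
rewrite big_ord_recr /= -ih -!(big_mkord xpredT).
rewrite -(big_mkord xpredT (fun u => F (a * b + u))) mulSn addnC.
rewrite (big_cat_nat _ (n := a * b)) ?leq_addr //=; congr (_ + _).
rewrite -{1}(add0n (a * b)) big_addn addKn; apply: eq_bigr => i _.
by rewrite addnC.
Qed.

(* [Item h k] is the [k]-th item of level [h]: a seed at level 0, and above it the
   goal of the [k]-th copy of the system at that level, whose own seeds are items
   of level [h - 1].  The other atoms belong to one copy:
   [Val s y e], the restriction of the table to the heap-numbered tree node [s]
   takes value [e] at [y]; [Dec s y e p q], so say the points [p < q] of the line
   through [y]; [Ne y], some value is given at [y]; [Wit i e], symbol [i - 1] of
   the witness is [e] (2 past its end); [Cell t c i e], [Head t c i],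
   [Read t c e], [View t z], the run of the verifier at time [t] on tape [c]. *)
Inductive atom :=
| Item of nat & nat
| Val of nat & nat & nat & nat & nat
| Dec of nat & nat & nat & nat & nat & nat & nat
| Ne of nat & nat & nat
| Wit of nat & nat & nat & nat
| Cell of nat & nat & nat & nat & nat & nat
| Head of nat & nat & nat & nat & nat
| Read of nat & nat & nat & nat & nat
| View of nat & nat & nat & nat
| Acc of nat & nat.

Definition atom_code (a : atom) : seq nat :=
  match a with
  | Item h k => [:: 0; h; k; 0; 0; 0; 0; 0]
  | Val h k s y e => [:: 1; h; k; s; y; e; 0; 0]
  | Dec h k s y e p q => [:: 2; h; k; s; y; e; p; q]
  | Ne h k y => [:: 3; h; k; y; 0; 0; 0; 0]
  | Wit h k i e => [:: 4; h; k; i; e; 0; 0; 0]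
  | Cell h k t c i e => [:: 5; h; k; t; c; i; e; 0]
  | Head h k t c i => [:: 6; h; k; t; c; i; 0; 0]
  | Read h k t c e => [:: 7; h; k; t; c; e; 0; 0]
  | View h k t z => [:: 8; h; k; t; z; 0; 0; 0]
  | Acc h k => [:: 9; h; k; 0; 0; 0; 0; 0]
  end.

Lemma atom_code_inj : injective atom_code.
Proof. by intros [] []; move=> //= [=] *; subst. Qed.

HB.instance Definition _ := Equality.copy atom (inj_type atom_code_inj).

(** A rule carries all variables of its clause, also those absent from the conclusion, so that a
    bounded tuple of numbers determines both body and head. *)
Inductive rule :=
| RBridge of nat & nat & nat & nat
| RGoal of nat & nat
| RNe of nat & nat & nat & nat
| RVal of nat & nat & nat & nat & nat
| RDec0 of nat & nat & nat & nat & nat & nat & nat & nat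
| RDec1 of nat & nat & nat & nat & nat & nat & nat & nat
| RWit0 of nat & nat
| RWit of nat & nat & nat & nat & nat
| RWitEnd of nat & nat & nat & nat
| RCellW of nat & nat & nat & nat
| RCellX of nat & nat & nat
| RCellB of nat & nat & nat & nat
| RHead0 of nat & nat & nat
| RRead of nat & nat & nat & nat & nat & nat
| RView0 of nat & nat & nat
| RView of nat & nat & nat & nat & nat
| RHead of nat & nat & nat & nat & nat & nat
| RCellNew of nat & nat & nat & nat & nat & nat
| RCell of nat & nat & nat & nat & nat & nat & nat
| RAcc of nat & nat.

Definition rule_code (r : rule) : seq nat :=
  match r with
  | RBridge h k y e => [:: 0; h; k; y; e; 0; 0; 0; 0]
  | RGoal h k => [:: 1; h; k; 0; 0; 0; 0; 0; 0]
  | RNe h k y e => [:: 2; h; k; y; e; 0; 0; 0; 0]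
  | RVal h k s y e => [:: 3; h; k; s; y; e; 0; 0; 0]
  | RDec0 h k s y e f p q => [:: 4; h; k; s; y; e; f; p; q]
  | RDec1 h k s y e f p q => [:: 5; h; k; s; y; e; f; p; q]
  | RWit0 h k => [:: 6; h; k; 0; 0; 0; 0; 0; 0]
  | RWit h k i e e' => [:: 7; h; k; i; e; e'; 0; 0; 0]
  | RWitEnd h k i e => [:: 8; h; k; i; e; 0; 0; 0; 0]
  | RCellW h k i e => [:: 9; h; k; i; e; 0; 0; 0; 0]
  | RCellX h k i => [:: 10; h; k; i; 0; 0; 0; 0; 0]
  | RCellB h k c i => [:: 11; h; k; c; i; 0; 0; 0; 0]
  | RHead0 h k c => [:: 12; h; k; c; 0; 0; 0; 0; 0]
  | RRead h k t c i e => [:: 13; h; k; t; c; i; e; 0; 0]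
  | RView0 h k z => [:: 14; h; k; z; 0; 0; 0; 0; 0]
  | RView h k t z z' => [:: 15; h; k; t; z; z'; 0; 0; 0]
  | RHead h k t c i z => [:: 16; h; k; t; c; i; z; 0; 0]
  | RCellNew h k t c i z => [:: 17; h; k; t; c; i; z; 0; 0]
  | RCell h k t c i j e => [:: 18; h; k; t; c; i; j; e; 0]
  | RAcc h k => [:: 19; h; k; 0; 0; 0; 0; 0; 0]
  end.

Section Codes.
Variable M : tm.
Notation K := (tapes M).+1.

Definition view : finType := (state M * {ffun 'I_K -> symbol M})%type.

Definition view_of (c : config M) : view :=
  (cstate c, [ffun k => cell c k (head_pos c k)]).

(** Extended to final states by the idle action, so that [stepE] has one form for all configurations
    and the rules of the run need no case for halting. *)
Definition response (z : view) : state M * ('I_K -> symbol M * move) :=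
  if final z.1 then (z.1, fun k => (z.2 k, Stay)) else trans z.1 z.2.

Lemma stepE c : step c = let: (q, act) := response (view_of c) in
  Config q (fun k => displace (act k).2 (head_pos c k))
    (fun k i => if i == head_pos c k then (act k).1 else cell c k i).
Proof.
rewrite /step /response /=; case: ifP => // _; case: c => q hd cl /=.
congr Config; apply/funext => k; apply/funext => i; rewrite ffunE.
by case: eqP => // ->.
Qed.

(** Bits have codes 0 and 1 and the blank has code 2, as do the symbols of the witness, so that leaf
    values can be copied to the input tape as they are. *)
Definition sym_code (e : symbol M) : nat :=
  match e with
  | None => 2
  | Some (inl b) => b
  | Some (inr e) => 3 + index e (enum (extra M))
  end.

Lemma sym_code_inj : injective sym_code.
Proof.
case=> [[[]|e]|] [[[]|e']|] //= [] /=; rewrite !add0n => h.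
by have := nth_index e (mem_enum predT e); rewrite h nth_index ?mem_enum // => ->.
Qed.

Definition view_code (z : view) : nat := index z (enum view).
Definition view_at (i : nat) : view := nth (start M, [ffun=> None]) (enum view) i.

Lemma view_codeK z : view_at (view_code z) = z.
Proof. by rewrite /view_at nth_index // mem_enum. Qed.

Lemma view_code_lt z : view_code z < #|view|.
Proof. by rewrite cardE index_mem mem_enum. Qed.

Definition state_code (q : state M) : nat := index q (enum (state M)).

Lemma state_code_inj : injective state_code.
Proof.
move=> q q' h; have := nth_index q (mem_enum predT q).
by rewrite -/(state_code q) h /state_code nth_index ?mem_enum // => ->.
Qed.

Definition tb_read z c := sym_code ((view_at z).2 (inord c)).
Definition tb_state z := state_code (view_at z).1.
Definition tb_next z := state_code (response (view_at z)).1.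
Definition tb_write z c := sym_code ((response (view_at z)).2 (inord c)).1.
Definition tb_right z c : nat := if ((response (view_at z)).2 (inord c)).2 is MoveRight then 1 else 0.
Definition tb_left z c : nat := if ((response (view_at z)).2 (inord c)).2 is MoveLeft then 1 else 0.

End Codes.

Section System.
(* [ell] bounds the witness length, the grid is [{0,...,m}^d] with [P] points,
   values at the grid points are below [A], and the verifier runs for [T] steps. *)
Variables (M : tm) (x : seq bool) (ell d m A T B : nat).
Notation K := (tapes M).+1.
Definition points := m.+1 ^ d.
Definition width := points * A.
Notation P := points.
Notation W := width.
Definition xlen := (2 * size x).+2.

(** This is [m] times the value at [p] of the affine function taking the values [e] at 0 and [f] at
    [m]. *)
Definition interp p e f := (m - p) * e + p * f.

(** Values at the root 1 are to come from items only, hence the condition on [RVal]; [e' < 2] in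
    [RWit] says that the witness has not ended yet. *)
Definition guard (r : rule) : bool :=
  match r with
  | RBridge _ _ y e => (y < P) && (e < A)
  | RVal _ _ s _ _ => 1 < s
  | RDec0 _ _ s _ _ _ p q | RDec1 _ _ s _ _ _ p q => [&& 0 < s, p < q & q <= m]
  | RWit _ _ i e e' => [&& e < 3, e' < 2 & i < ell]
  | RWitEnd _ _ i e => (e == 2) || (ell <= i)
  | RCellX _ _ i => i < xlen
  | RCellB _ _ c _ => (0 < c) && (c < K)
  | RHead0 _ _ c => c < K
  | RView0 _ _ z => (z < #|view M|) && (tb_state M z == state_code (start M))
  | RView _ _ _ z z' => [&& z < #|view M|, z' < #|view M| & tb_state M z' == tb_next M z]
  | RHead _ _ _ c _ z | RCellNew _ _ _ c _ z => (z < #|view M|) && (c < K)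
  | RCell _ _ _ _ i j _ => i != j
  | _ => true
  end.

Definition reads h k t z := [seq Read h k t c (tb_read M z c) | c <- iota 0 K].

Definition body (r : rule) : seq atom :=
  match r with
  | RBridge h k y e => [:: Item h (k * W + y * A + e)]
  | RGoal h k => Acc h k :: [seq Ne h k y | y <- iota 0 P]
  | RNe h k y e => [:: Val h k 1 y e]
  | RVal h k s y e => [seq Dec h k s y e p q | q <- iota 0 m.+1, p <- iota 0 q]
  | RDec0 h k s y e f p q => [:: Val h k s (y * m.+1 + p) (interp p e f);
                                Val h k s (y * m.+1 + q) (interp q e f)]
  | RDec1 h k s y e f p q => [:: Val h k s (y * m.+1 + p) (interp p f e);
                                Val h k s (y * m.+1 + q) (interp q f e)]
  | RWit h k i e e' => [:: Wit h k i e'; Val h k (2 ^ d + i) 0 e]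
  | RWitEnd h k i e => [:: Wit h k i e]
  | RCellW h k i e => [:: Wit h k i.+1 e]
  | RRead h k t c i e => [:: Head h k t c i; Cell h k t c i e]
  | RView0 h k z => reads h k 0 z
  | RView h k t z z' => View h k t z :: reads h k t.+1 z'
  | RHead h k t c i z | RCellNew h k t c i z => [:: View h k t z; Head h k t c i]
  | RCell h k t c i j e => [:: Cell h k t c i e; Head h k t c j]
  | RAcc h k => [:: Cell h k T (tapes M) 0 1]
  | _ => [::]
  end.

Definition concl (r : rule) : atom :=
  match r with
  | RBridge h k y e => Val h.+1 k 1 y e
  | RGoal h k => Item h k
  | RNe h k y e => Ne h k y
  | RVal h k s y e => Val h k s y e
  | RDec0 h k s y e f p q => Dec h k (2 * s) y e p q
  | RDec1 h k s y e f p q => Dec h k (2 * s).+1 y e p q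
  | RWit0 h k => Wit h k 0 0
  | RWit h k i e e' => Wit h k i.+1 e
  | RWitEnd h k i e => Wit h k i.+1 2
  | RCellW h k i e => Cell h k 0 0 (xlen + i) e
  | RCellX h k i => Cell h k 0 0 i (nth false (pairing x [::]) i)
  | RCellB h k c i => Cell h k 0 c i 2
  | RHead0 h k c => Head h k 0 c 0
  | RRead h k t c i e => Read h k t c e
  | RView0 h k z => View h k 0 z
  | RView h k t z z' => View h k t.+1 z'
  | RHead h k t c i z => Head h k t.+1 c (i + tb_right M z c - tb_left M z c)
  | RCellNew h k t c i z => Cell h k t.+1 c i (tb_write M z c)
  | RCell h k t c i j e => Cell h k t.+1 c i e
  | RAcc h k => Acc h k
  end.

(** Parameters are bounded by [B] because every admissible instance of a rule becomes a node of a
    finite digraph. *)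
Inductive der (U : nat -> Prop) : atom -> Prop :=
| DerSeed th : U th -> der U (Item 0 th)
| DerRule r : guard r -> all (fun i => i < B) (rule_code r) ->
    (forall b, b \in body r -> der U b) -> der U (concl r).

End System.

(** * Soundness: few seeds force a genuine accepting run *)

Section Soundness.
Variables (M : tm) (x : seq bool) (ell d m A T B : nat) (U : nat -> Prop).
Notation K := (tapes M).+1.
Notation P := (points d m).
Notation W := (width d m A).
Notation guard := (@guard M x ell d m A).
Notation body := (@body M d m A T).
Notation concl := (@concl M x).
Notation der := (@der M x ell d m A T B U).

Lemma der_inv a : der a -> (exists2 th, a = Item 0 th & U th) \/
  (exists r, [/\ guard r, concl r = a & forall b, b \in body r -> der b]).
Proof. by case=> [th|r g _ h]; [left; exists th | right; exists r]. Qed.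

Lemma der_val h k s y e : der (Val h k s y e) ->
  (exists2 h', h = h'.+1 & [/\ s = 1, y < P, e < A & der (Item h' (k * W + y * A + e))]) \/
  (1 < s /\ forall p q, p < q -> q <= m -> der (Dec h k s y e p q)).
Proof.
move=> /der_inv [[th // _]|[r []]]; case: r => //=.
- move=> h' k' y' e' /andP[yP eA] [<- <- <- <- <-] hb; left; exists h' => //.
  by split=> //; apply: hb; rewrite inE.
- move=> h' k' s' y' e' s2 [<- <- <- <- <-] hb; right; split=> // p q pq qm.
  apply: hb; apply/allpairsPdep; exists q, p.
  by rewrite !mem_iota; split=> //; lia.
Qed.

Definition amb h k s y := exists e e', [/\ e <> e', der (Val h k s y e) & der (Val h k s y e')].

(** Two points determine an affine function: the linear system has determinant m(q-p), and [v.+1]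
    stands for q-p. *)
Lemma interp_inj p q e f e' f' : p < q -> q <= m ->
  interp m p e f = interp m p e' f' -> interp m q e f = interp m q e' f' -> e = e' /\ f = f'.
Proof.
rewrite /interp => pq qm h1 h2.
have [u hu] : exists u, m = q + u by exists (m - q); lia.
have [v hv] : exists v, q = p + v.+1 by exists (q - p).-1; lia.
have e1 : m - p = v.+1 + u by lia.
have e2 : m - q = u by lia.
rewrite e1 in h1; rewrite e2 in h2.
have : (v.+1 * m) * e = (v.+1 * m) * e' by subst; nia.
have : (v.+1 * m) * f = (v.+1 * m) * f' by subst; nia.
have m0 : 0 < v.+1 * m by subst; nia.
by move=> /eqP; rewrite eqn_pmul2l // => /eqP -> /eqP; rewrite eqn_pmul2l // => /eqP ->.
Qed.

Lemma der_dec h k b s y e p q : der (Dec h k (2 * s + (b : bool)) y e p q) ->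
  exists e0 e1, [/\ (if b then e1 else e0) = e, p < q, q <= m &
    der (Val h k s (y * m.+1 + p) (interp m p e0 e1)) /\
    der (Val h k s (y * m.+1 + q) (interp m q e0 e1))].
Proof.
move=> /der_inv [[th // _]|[r []]]; case: r => //=.
- move=> h' k' s' y' e' f' p' q' /and3P[s0 pq qm] [<- <- es <- <- <- <-] hb.
  have {es} [es eb] : s = s' /\ b = false by case: b es => /= es; split=> //; lia.
  subst; exists e', f'; split=> //; split; apply: hb; rewrite !inE eqxx ?orbT //.
- move=> h' k' s' y' e' f' p' q' /and3P[s0 pq qm] [<- <- es <- <- <- <-] hb.
  have {es} [es eb] : s = s' /\ b = true by case: b es => /= es; split=> //; lia.
  subst; exists f', e'; split=> //; split; apply: hb; rewrite !inE eqxx ?orbT //.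
Qed.

Lemma amb_step h k s (b : bool) y p q : 0 < s -> p < q -> q <= m ->
  amb h k (2 * s + b) y -> amb h k s (y * m.+1 + p) \/ amb h k s (y * m.+1 + q).
Proof.
move=> s0 pq qm [e [e' [ne de de']]].
have s1 : (2 * s + b == 1) = false by lia.
case: (der_val de) => [[? _ [/eqP]]|[_ /(_ p q pq qm) {}de]]; first by rewrite s1.
case: (der_val de') => [[? _ [/eqP]]|[_ /(_ p q pq qm) {}de']]; first by rewrite s1.
have [e0 [e1 [ee _ _ [dp dq]]]] := der_dec de.
have [f0 [f1 [ff _ _ [dp' dq']]]] := der_dec de'.
have [hp|hp] := eqVneq (interp m p e0 e1) (interp m p f0 f1); last first.
  by left; do 2 eexists; split; [apply/eqP; exact: hp | exact: dp | exact: dp'].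
have [hq|hq] := eqVneq (interp m q e0 e1) (interp m q f0 f1); last first.
  by right; do 2 eexists; split; [apply/eqP; exact: hq | exact: dq | exact: dq'].
have [h0 h1] := interp_inj pq qm hp hq.
by case: ne; rewrite -ee -ff h0 h1.
Qed.

Definition namb h k s y : nat := `[< amb h k s y >].

(* Two unambiguous points of a line would determine both halves, so an ambiguous
   value in one half leaves at most one unambiguous point. *)
Lemma amb_line h k s (b : bool) y : 0 < s -> amb h k (2 * s + b) y ->
  m <= \sum_(p < m.+1) namb h k s (y * m.+1 + p).
Proof.
move=> s0 ha.
have [/forallP h1|/forallPn[p0 np0]] := boolP [forall p : 'I_m.+1, `[< amb h k s (y * m.+1 + p) >]].
  rewrite (eq_bigr (fun=> 1)); last by move=> p _; rewrite /namb h1.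
  by rewrite sum_nat_const card_ord muln1.
rewrite (bigD1 p0) //= (eq_bigr (fun=> 1)); last first.
  move=> p np; rewrite /namb asboolT //.
  have n0 : ~ amb h k s (y * m.+1 + p0) by move/asboolP; exact/negP.
  have [lt|gt|/val_inj e] := ltngtP p p0; last by rewrite e eqxx in np.
    have q0 : p0 <= m by rewrite -ltnS.
    by case: (amb_step s0 lt q0 ha).
  have q0 : p <= m by rewrite -ltnS.
  by case: (amb_step s0 gt q0 ha).
rewrite sum1_card cardC1 card_ord /=; exact: leq_addl.
Qed.

(** On the way up to the root, [amb_line] multiplies the number of ambiguous points by at least [m]
    at each of the [i] levels. *)
Lemma amb_count i h k s y : 2 ^ i <= s < 2 ^ i.+1 -> amb h k s y ->
  m ^ i <= \sum_(u < m.+1 ^ i) namb h k 1 (y * m.+1 ^ i + u).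
Proof.
elim: i s y => [|i ih] s y hs ha.
  have -> : 1 = s by move: hs; rewrite expn0 expn1; lia.
  by rewrite !expn0 big_ord1 muln1 addn0 /namb asboolT.
have es : s = 2 * s./2 + odd s by rewrite mul2n addnC odd_double_half.
have hs2 : 2 ^ i <= s./2 < 2 ^ i.+1.
  by move: hs; rewrite {1}es [2 ^ i.+2]expnS [2 ^ i.+1]expnS; case: (odd s); lia.
have s0 : 0 < s./2 by case/andP: hs2 => h1 _; apply: leq_trans h1; rewrite expn_gt0.
rewrite es in ha; have hl := amb_line s0 ha.
rewrite expnS (expnS m.+1) (big_ord_mul _ _ (fun u => namb h k 1 (y * (m.+1 * m.+1 ^ i) + u))).
apply: (@leq_trans (\sum_(p < m.+1) namb h k s./2 (y * m.+1 + p) * m ^ i)).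
  by rewrite -big_distrl /= leq_mul2r hl orbT.
apply: leq_sum => p _; rewrite /namb; case: asboolP => [ap|_]; last by [].
rewrite mul1n; apply: leq_trans (ih _ _ hs2 ap) _.
by apply: eq_leq; apply: eq_bigr => u _; congr namb; rewrite mulnDl -mulnA addnA.
Qed.

Definition seeds h k : nat := \sum_(y < P) \sum_(e < A) `[< der (Val h k 1 y e) >].

Definition no_leaf_amb h k := forall i, i < 2 ^ d -> ~ amb h k (2 ^ d + i) 0.

(** Every point has at least one value and an ambiguous point at least two, so an ambiguous leaf
    costs m^d seeds on top of P. *)
Lemma few_seeds h k : (forall y, y < P -> der (Ne h k y)) ->
  seeds h k < P + m ^ d -> no_leaf_amb h k.
Proof.
move=> hne hs i id ha; move: hs; apply/negP; rewrite -leqNgt.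
have hl : 2 ^ d <= 2 ^ d + i < 2 ^ d.+1 by rewrite expnS; lia.
have := amb_count hl ha; under eq_bigr => u _ do rewrite mul0n add0n.
move=> hm; apply: (@leq_trans (\sum_(y < P) (1 + namb h k 1 y))).
  by rewrite big_split /= sum1_card card_ord leq_add2l.
apply: leq_sum => y _.
have val1 e : der (Val h k 1 y e) -> e < A.
  by move=> /der_val [[h' _ []]|[]].
have [e0 d0] : exists e, der (Val h k 1 y e).
  have := hne y (ltn_ord y) => /der_inv [[th // _]|[r []]]; case: r => //=.
  by move=> h' k' y' e' _ [<- <- <-] hb; exists e'; apply: hb; rewrite inE.
rewrite /namb; case: asboolP => [[e [e' [ne de de']]]|_]; last first.
  rewrite (bigD1 (Ordinal (val1 _ d0))) //= asboolT //; exact: leq_addr.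
rewrite (bigD1 (Ordinal (val1 _ de))) //= asboolT // leq_add2l.
rewrite (bigD1 (Ordinal (val1 _ de'))) /= ?asboolT //.
by apply/eqP => /(congr1 val) /= /esym.
Qed.

Definition wit_of (f : nat -> nat) :=
  [seq f i == 1 | i <- iota 0 (find (fun i => 1 < f i) (iota 0 ell))].

Lemma wit_of_size f : size (wit_of f) <= ell.
Proof. by rewrite size_map size_iota -{2}(size_iota 0 ell) find_size. Qed.

Lemma pairing_cat v : pairing x v = pairing x [::] ++ v.
Proof. by rewrite /pairing -!catA. Qed.

Lemma size_pairing0 : size (pairing x [::]) = xlen x.
Proof.
rewrite /pairing size_cat /xlen /=.
have -> : size (flatten [seq [:: b; b] | b <- x]) = 2 * size x by elim: (x) => //= b y ->; lia.
lia.
Qed.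

Lemma input_code v i : sym_code (written M (pairing x v) i) =
  if i < xlen x then nth false (pairing x [::]) i : nat
  else if i - xlen x < size v then nth false v (i - xlen x) : nat else 2.
Proof.
rewrite /written pairing_cat map_cat nth_cat size_map size_pairing0.
case: ltnP => ix; first by rewrite (nth_map false) // size_pairing0.
by case: ltnP => il; [rewrite (nth_map false) | rewrite nth_default // size_map].
Qed.

Section Run.
Variables (h k : nat) (f : nat -> nat).
Hypothesis hf : forall i e, i < ell -> der (Val h k (2 ^ d + i) 0 e) -> f i = e.
Let len := find (fun i => 1 < f i) (iota 0 ell).
Let u := wit_of f.
Let cfg t := iter t (@step M) (init M (pairing x u)).

Let wsym i := if i < len then f i else 2.

Lemma len_le : len <= ell.
Proof. by rewrite /len -{2}(size_iota 0 ell) find_size. Qed.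

Lemma f_small i : i < len -> f i < 2.
Proof.
move=> il; have := before_find 0 il; rewrite nth_iota ?add0n.
  by move/negbT; rewrite -leqNgt.
exact: leq_trans il len_le.
Qed.

Lemma f_len : len < ell -> 1 < f len.
Proof.
move=> h1; have : has (fun i => 1 < f i) (iota 0 ell) by rewrite has_find size_iota.
by move/(nth_find 0); rewrite nth_iota.
Qed.

Lemma input_sym i : sym_code (written M (pairing x u) i) =
  if i < xlen x then nth false (pairing x [::]) i : nat else wsym (i - xlen x).
Proof.
rewrite input_code /wsym /u /wit_of size_map size_iota -/len.
case: ifP => // _; case: ltnP => // il.
rewrite (nth_map 0) ?size_iota // nth_iota // add0n.
by have := f_small il; case: (f _) => [|[|]].
Qed.

(** Truth of an atom of the copy [h], [k] for the run on the decoded witness [u]; nothing is claimed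
    about other copies. *)
Definition run_inv (a : atom) : Prop :=
  match a with
  | Wit h' k' i e => h' = h -> k' = k ->
      (i = 0 /\ e = 0) \/ (exists2 i', i = i'.+1 & e = wsym i')
  | Cell h' k' t c i e => h' = h -> k' = k -> c < K -> e = sym_code (cell (cfg t) (inord c) i)
  | Head h' k' t c i => h' = h -> k' = k -> c < K /\ i = head_pos (cfg t) (inord c)
  | Read h' k' t c e => h' = h -> k' = k -> c < K -> e = sym_code ((view_of (cfg t)).2 (inord c))
  | View h' k' t z => h' = h -> k' = k -> z < #|view M| /\ view_at M z = view_of (cfg t)
  | Acc h' k' => h' = h -> k' = k -> cell (cfg T) ord_max 0 = Some (inl true)
  | _ => True
  end.

Lemma reads_inv t z : (forall b, b \in reads M h k t z -> run_inv b) ->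
  (view_at M z).2 = (view_of (cfg t)).2.
Proof.
move=> hb; apply/ffunP => c; apply: (@sym_code_inj M).
have := hb (Read h k t c (tb_read M z c)); rewrite /reads map_f ?mem_iota ?ltn_ord //.
by move=> /(_ isT erefl erefl (ltn_ord c)); rewrite /tb_read inord_val.
Qed.

Lemma view_pair (z z' : view M) : z.1 = z'.1 -> z.2 = z'.2 -> z = z'.
Proof. by case: z z' => ? ? [? ?] /= -> ->. Qed.

Lemma der_run a : der a -> run_inv a.
Proof.
elim=> [th //|r g _ hd hb]; case: r g hd hb => //=.
- by move=> h' k' _ _ _ _ _; left.
- move=> h' k' i e e' /and3P[e3 e2 il] hd hb ? ?; subst; right; exists i => //.
  have hv : f i = e by apply: (hf il); apply: hd; rewrite !inE eqxx orbT.
  have := hb (Wit h k i e'); rewrite inE eqxx => /(_ isT erefl erefl) hw.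
  (* At or after the end, the premise being a bit or the start forces [i = len]; there [f] exceeds
     1, and [e < 3] leaves only 2. *)
  rewrite /wsym -hv; case: ltnP => // li.
  have {hw} hw : i <= len.
    case: hw => [[-> _] //|[i' -> ee]]; move: ee; rewrite /wsym.
    by case: ltnP => // _ ee; move: e2; rewrite ee.
  have el : i = len by apply/eqP; rewrite eqn_leq hw li.
  by have := f_len; rewrite -el hv => /(_ il); lia.
- move=> h' k' i e hg _ hb ? ?; subst; right; exists i => //.
  rewrite /wsym; case: ltnP => // li.
  case/orP: hg => [/eqP e2|]; last by have := len_le; lia.
  have := hb (Wit h k i e); rewrite inE eqxx => /(_ isT erefl erefl).
  case=> [[_ e0]|[i' ei ee]]; first by rewrite e0 in e2.
  move: ee; rewrite /wsym ifT; last by lia.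
  by move=> ef; have := @f_small i'; rewrite -ef e2 => h1; have /h1 : i' < len by lia.
- move=> h' k' i e _ _ hb ? ? _; subst.
  have := hb (Wit h k i.+1 e); rewrite inE eqxx => /(_ isT erefl erefl).
  case=> [[] // |[i' [<-] ->]].
  have -> : inord 0 = ord0 :> 'I_K by apply: val_inj; rewrite /= inordK.
  by rewrite /= input_sym ltnNge leq_addr /= addKn.
- move=> h' k' i hi _ _ ? ? _.
  have -> : inord 0 = ord0 :> 'I_K by apply: val_inj; rewrite /= inordK.
  by rewrite /= input_sym hi.
- move=> h' k' c i /andP[c0 cK] _ _ ? ? _.
  have -> : (inord c == ord0 :> 'I_K) = false by rewrite -val_eqE /= inordK //; lia.
  by rewrite /written nth_nil.
- move=> h' k' t c i e _ _ hb ? ? cK; subst.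
  have := hb (Head h k t c i); rewrite inE eqxx => /(_ isT erefl erefl) [_ ei].
  have := hb (Cell h k t c i e); rewrite !inE eqxx orbT => /(_ isT erefl erefl cK) ->.
  by rewrite ffunE ei.
- move=> h' k' z /andP[zv /eqP zs] _ hb ? ?; subst; split=> //.
  by apply: view_pair; [apply: state_code_inj; exact: zs | exact: (@reads_inv 0)].
- move=> h' k' t z z' /and3P[zv zv' /eqP zs] _ hb ? ?; subst; split=> //.
  have := hb (View h k t z); rewrite inE eqxx => /(_ isT erefl erefl) [_ ez].
  apply: view_pair; last by apply: (@reads_inv t.+1) => b hb'; apply: hb; rewrite inE hb' orbT.
  apply: state_code_inj; rewrite -/(tb_state M z') zs /tb_next ez.
  by rewrite stepE; case: response.
- move=> h' k' t c i z /andP[zv cK] _ hb ? ?; subst; split=> //.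
  have := hb (View h k t z); rewrite inE eqxx => /(_ isT erefl erefl) [_ ez].
  have := hb (Head h k t c i); rewrite !inE eqxx orbT => /(_ isT erefl erefl) [_ ei].
  rewrite stepE /tb_right /tb_left ez -/(cfg t).
  case: response => q act /=; rewrite -ei; case: (act _).2 => /=; lia.
- move=> h' k' t c i z /andP[zv cK] _ hb ? ? _; subst.
  have := hb (View h k t z); rewrite inE eqxx => /(_ isT erefl erefl) [_ ez].
  have := hb (Head h k t c i); rewrite !inE eqxx orbT => /(_ isT erefl erefl) [_ ei].
  rewrite stepE /tb_write ez -/(cfg t).
  by case: response => q act /=; rewrite -ei eqxx.
- move=> h' k' t c i j e ij _ hb ? ? cK; subst.
  have := hb (Cell h k t c i e); rewrite inE eqxx => /(_ isT erefl erefl cK) ->.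
  have := hb (Head h k t c j); rewrite !inE eqxx orbT => /(_ isT erefl erefl) [_ ej].
  by rewrite stepE -/(cfg t); case: response => q act /=; rewrite -ej (negbTE ij).
- move=> h' k' _ _ hb ? ?; subst.
  have := hb (Cell h k T (tapes M) 0 1); rewrite inE eqxx => /(_ isT erefl erefl (ltnSn _)) e1.
  have -> : ord_max = inord (tapes M) :> 'I_K by apply: val_inj; rewrite /= inordK.
  by apply: (@sym_code_inj M); rewrite -e1.
Qed.

End Run.

Hypothesis reject : forall u, size u <= ell ->
  cell (iter T (@step M) (init M (pairing x u))) ord_max 0 <> Some (inl true).
Hypothesis ell_le : ell <= 2 ^ d.

(** With fewer seeds no leaf is ambiguous, so [f] can be chosen to give the only value of each leaf,
    and [der_run] turns the derived acceptance into an accepting run, against [reject]. *)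
Lemma item_seeds h k : der (Item h k) ->
  (h = 0 /\ U k) \/ (exists2 h', h = h'.+1 & P + m ^ d <= seeds h k).
Proof.
move=> /der_inv [[th [-> ->] uth]|[r []]]; first by left.
case: r => //= h' k' _ [<- <-] hb; right.
have hne y : y < P -> der (Ne h' k' y).
  by move=> yP; apply: hb; rewrite inE map_f ?orbT // mem_iota.
(* The grid has a point, its value comes from a bridge, and a bridge concludes only at a successor
   level. *)
have [h0 eh] : exists h0, h' = h0.+1.
  have := hne 0; rewrite /points expn_gt0 /= => /(_ isT) /der_inv [[th // _]|[r []]].
  case: r => //= h1 k1 y1 e1 _ [<- _ _] /(_ (Val h1 k1 1 y1 e1)).
  by rewrite inE eqxx => /(_ isT) /der_val [[h2 -> _]|[// _]]; exists h2.
exists h0 => //; rewrite leqNgt; apply/negP => /few_seeds-/(_ hne) na.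
have /choice[f hf] : forall i, exists e0, forall e, i < ell -> der (Val h' k' (2 ^ d + i) 0 e) -> e0 = e.
  move=> i; case: (EM (exists e, i < ell /\ der (Val h' k' (2 ^ d + i) 0 e))) => [[e0 [il d0]]|n].
    exists e0 => e _ de; case: (eqVneq e0 e) => // ne.
    case: (na i (leq_trans il ell_le)); exists e0, e; split=> //; exact/eqP.
  by exists 0 => e il de; case: n; exists e.
have hacc : der (Acc h' k') by apply: hb; rewrite inE eqxx.
exact: (reject (wit_of_size f)) (der_run hf hacc erefl erefl).
Qed.

Fixpoint weight h k : nat :=
  if h is h'.+1 then \sum_(u < W) weight h' (k * W + u) else `[< U k >].

(** Each of the at least [P + m ^ d] values of a derived copy rests on a derived item one level
    down. Distinct values lead to disjoint subtrees, so the bounds multiply. *)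
Lemma item_weight h k : der (Item h k) -> (P + m ^ d) ^ h <= weight h k.
Proof.
elim: h k => [|h ih] k.
  by move=> /item_seeds [[_ uk]|[h' //]]; rewrite /= asboolT.
move=> /item_seeds [[//]|[_ _ hs]].
rewrite /= expnS {1}/width (big_ord_mul _ _ (fun u => weight h (k * W + u))).
apply: (@leq_trans (seeds h.+1 k * (P + m ^ d) ^ h)); first by rewrite leq_mul2r hs orbT.
rewrite /seeds big_distrl /=; apply: leq_sum => y _.
rewrite big_distrl /=; apply: leq_sum => e _.
case: asboolP => // /der_val [[h' [<-] [_ _ _ di]]|[// _]].
by rewrite mul1n addnA; exact: ih.
Qed.

Lemma weightE h k : weight h k = \sum_(i < W ^ h) `[< U (k * W ^ h + i) >].
Proof.
elim: h k => [|h ih] k /=; first by rewrite expn0 big_ord1 muln1 addn0.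
rewrite expnS (big_ord_mul _ _ (fun i => `[< U (k * (W * W ^ h) + i) >] : nat)).
apply: eq_bigr => u _; rewrite ih.
by apply: eq_bigr => i _; rewrite mulnDl -mulnA addnA.
Qed.

Lemma goal_weight D : der (Item D 0) ->
  (P + m ^ d) ^ D <= \sum_(i < W ^ D) `[< U i >].
Proof. by move/item_weight; rewrite weightE mul0n. Qed.

End Soundness.

(** * Completeness: an accepted witness costs P seeds per copy *)

Section Completeness.
Variables (M : tm) (x : seq bool) (ell d m A T B : nat) (U : nat -> Prop) (u : seq bool).
Notation K := (tapes M).+1.
Notation P := (points d m).
Notation W := (width d m A).
Notation guard := (@guard M x ell d m A).
Notation body := (@body M d m A T).
Notation concl := (@concl M x).
Notation der := (@der M x ell d m A T B U).
Let cfg t := iter t (@step M) (init M (pairing x u)).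

Lemma sym_code_lt (e : symbol M) : 3 + #|extra M| <= B -> sym_code e < B.
Proof.
move=> B_sym; case: e => [[b|e]|] /=; [case: b; lia | | lia].
by apply: leq_trans B_sym; rewrite -addnS leq_add2l cardE index_mem mem_enum.
Qed.

Lemma head_le t c : head_pos (cfg t) c <= t.
Proof.
elim: t => // t ih; rewrite /cfg /= stepE -/(cfg t).
by case: response => q act /=; case: (act c).2 => /=; lia.
Qed.

Definition wit_sym i : nat := if i < size u then nth false u i : nat else 2.

(** The multi-affine extension of the part of the witness below tree node [s], scaled by m^j. The
    last digit of [y] in base m+1 is the coordinate that separates the children [2 * s] and
    [2 * s + 1]; the leaf [2 ^ d + i] carries symbol [i]. *)
Fixpoint extension j s y : nat :=
  if j is j'.+1 then
    interp m (y %% m.+1) (extension j' (2 * s) (y %/ m.+1)) (extension j' (2 * s).+1 (y %/ m.+1))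
  else wit_sym (s - 2 ^ d).

Lemma wit_sym_lt i : wit_sym i < 3.
Proof. by rewrite /wit_sym; case: ifP => // _; case: nth. Qed.

(** Symbols are at most 2, and the weights of each interpolation add up to m. *)
Lemma extension_le j s y : extension j s y <= 2 * m ^ j.
Proof.
elim: j s y => [|j ih] s y /=; first by have := wit_sym_lt (s - 2 ^ d); rewrite expn0; lia.
have r : y %% m.+1 <= m by rewrite -ltnS ltn_mod.
have := ih (2 * s) (y %/ m.+1); have := ih (2 * s).+1 (y %/ m.+1).
move: (extension _ _ _) (extension _ _ _) (y %% _) r => e f p r h1 h2.
rewrite /interp expnS.
have : (m - p) * e <= (m - p) * (2 * m ^ j) by rewrite leq_mul2l h2 orbT.
have : p * f <= p * (2 * m ^ j) by rewrite leq_mul2l h1 orbT.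
have -> : 2 * (m * m ^ j) = (m - p) * (2 * m ^ j) + p * (2 * m ^ j).
  by rewrite -mulnDl subnK // mulnCA.
by move=> g1 g2; exact: leq_add g2 g1.
Qed.

Hypothesis m_gt0 : 0 < m.
Hypothesis A_gt : 2 * m ^ d < A.

Lemma extension_lt j s y : j <= d -> extension j s y < A.
Proof.
move=> jd; apply: leq_ltn_trans (extension_le j s y) (leq_ltn_trans _ A_gt).
by rewrite leq_mul2l /= leq_pexp2l.
Qed.

Definition good v := v %% A == extension d 1 (v %/ A).

(** The digits of [v] in base [W] locate a seed within the nested copies; each digit, a pair of a
    point and a value, has to lie on the graph of the extension. *)
Fixpoint all_good D v : bool :=
  if D is D'.+1 then good (v %% W) && all_good D' (v %/ W) else v == 0.

Lemma width_gt0 : 0 < W.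
Proof. by rewrite /width muln_gt0 expn_gt0 /=; apply: leq_ltn_trans A_gt. Qed.

Lemma all_good_lt D v : all_good D v -> v < W ^ D.
Proof.
elim: D v => [|D ih] v /=; first by move/eqP ->.
by case/andP=> _ /ih; rewrite ltn_divLR ?width_gt0 // expnSr.
Qed.

Lemma card_all_good D : \sum_(v < W ^ D) all_good D v = P ^ D.
Proof.
elim: D => [|D ih]; first by rewrite !expn0 big_ord1.
rewrite expnSr (big_ord_mul _ _ (fun v => all_good D.+1 v : nat)) expnSr -ih big_distrl /=.
apply: eq_bigr => p _.
have hA : 0 < A by apply: leq_ltn_trans A_gt.
rewrite (eq_bigr (fun v : 'I_W => all_good D p * good v)); last first.
  move=> v _; rewrite modnMDl divnMDl ?width_gt0 // modn_small // divn_small // addn0.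
  by rewrite andbC mulnb.
rewrite -big_distrr /= /width (big_ord_mul _ _ (fun v => good v : nat)); congr (_ * _).
rewrite (eq_bigr (fun=> 1)); first by rewrite sum1_card card_ord.
move=> y _; rewrite (bigD1 (Ordinal (extension_lt 1 y (leqnn d)))) //=.
have e1 v : v < A -> good (y * A + v) = (v == extension d 1 y).
  by move=> vA; rewrite /good modnMDl divnMDl // modn_small // divn_small // addn0.
rewrite e1 ?extension_lt // eqxx big1 // => v nv.
rewrite e1 //; case: eqP => // e; case/eqP: nv; exact: val_inj.
Qed.

Hypothesis u_ell : size u <= ell.
Hypothesis ell_le : ell <= 2 ^ d.
Hypothesis B_small : 20 <= B.
Hypothesis B_P : P <= B.
Hypothesis B_A : A <= B.
Hypothesis B_leaf : 2 * 2 ^ d <= B.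
Hypothesis B_m : m < B.
Hypothesis B_x : xlen x <= B.
Hypothesis B_T : T < B.
Hypothesis B_sym : 3 + #|extra M| <= B.
Hypothesis B_view : #|view M| <= B.
Hypothesis B_K : K <= B.
Hypothesis accept : cell (cfg T) ord_max 0 = Some (inl true).

Section Copy.
Variables h k : nat.
Hypothesis B_h : h.+1 < B.
Hypothesis B_k : k < B.
Hypothesis seeded : forall y, y < P -> der (Item h (k * W + y * A + extension d 1 y)).

Lemma der_rule r a : guard r -> concl r = a -> all (fun i => i < B) (rule_code r) ->
  (forall b, b \in body r -> der b) -> der a.
Proof. by move=> g <- c b; exact: DerRule. Qed.

(** Induction down the tree: the values on the line through [y] are known one level up, and all
    pairs of them interpolate to the same value at the child. *)
Lemma der_extension i s y : i <= d -> 2 ^ i <= s < 2 ^ i.+1 -> y < m.+1 ^ (d - i) ->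
  der (Val h.+1 k s y (extension (d - i) s y)).
Proof.
elim: i s y => [|i ih] s y id hs hy.
  have -> : s = 1 by move: hs; rewrite expn0 expn1; lia.
  rewrite subn0 in hy *; have eA := extension_lt 1 y (leqnn d).
  apply: (@der_rule (RBridge h k y (extension d 1 y))) => //=.
  - by rewrite hy eA.
  - by have := leq_trans hy B_P; lia.
  - by move=> b; rewrite inE => /eqP ->; exact: seeded.
have es : s = 2 * s./2 + odd s by rewrite mul2n addnC odd_double_half.
have hs2 : 2 ^ i <= s./2 < 2 ^ i.+1.
  by move: hs; rewrite {1}es [2 ^ i.+2]expnS [2 ^ i.+1]expnS; case: (odd s); lia.
have s0 : 0 < s./2 by case/andP: hs2 => h1 _; apply: leq_trans h1; rewrite expn_gt0.
have sB : s < B.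
  case/andP: hs => _ hs; apply: leq_trans hs (leq_trans _ B_leaf).
  by rewrite -expnS leq_exp2l.
have dj : d - i = (d - i.+1).+1 by lia.
have jd : d - i.+1 <= d by exact: leq_subr.
set j := d - i.+1 in hy dj jd *.
have yB : y < B.
  apply: leq_trans hy (leq_trans _ B_P); exact: leq_pexp2l.
pose e0 := extension j (2 * s./2) y; pose e1 := extension j (2 * s./2).+1 y.
have e0A : e0 < A by exact: extension_lt.
have e1A : e1 < A by exact: extension_lt.
have par p : p <= m -> der (Val h.+1 k s./2 (y * m.+1 + p) (interp m p e0 e1)).
  move=> pm; have hp : y * m.+1 + p < m.+1 ^ (d - i) by rewrite dj expnSr; nia.
  have := ih _ _ (ltnW id) hs2 hp; rewrite dj /=.
  by rewrite modnMDl divnMDl // modn_small ?divn_small ?ltnS // addn0.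
have eA := extension_lt s y jd.
apply: (@der_rule (RVal h.+1 k s y (extension j s y))) => //=.
- by case/andP: hs => hs _; apply: leq_trans hs; rewrite expnS leq_pmulr // expn_gt0.
- by lia.
move=> b /allpairsPdep[q [p [hq hp ->]]].
rewrite mem_iota ltnS in hq; rewrite mem_iota add0n in hp.
case/andP: hq => _ qm; case/andP: hp => _ pq.
case eb : (odd s) es => es.
- rewrite es addn1 -/e1; apply: (@der_rule (RDec1 h.+1 k s./2 y e1 e0 p q)) => //=.
  + by rewrite s0 pq.
  + by lia.
  + move=> b'; rewrite !inE => /orP[] /eqP ->; apply: par; lia.
- rewrite es addn0 -/e0; apply: (@der_rule (RDec0 h.+1 k s./2 y e0 e1 p q)) => //=.
  + by rewrite s0 pq.
  + by lia.
  + move=> b'; rewrite !inE => /orP[] /eqP ->; apply: par; lia.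
Qed.

Definition wit_prev i := if i is i'.+1 then wit_sym i' else 0.

(** Carried on beyond the end of the witness, up to [T.+1], because these symbols also supply the
    blanks of the input tape up to cell [T]. *)
Lemma der_wit i : i <= T.+1 -> der (Wit h.+1 k i (wit_prev i)).
Proof.
elim: i => [|i ih] iT; first by apply: (@der_rule (RWit0 h.+1 k)) => //=; lia.
have dw := ih (ltnW iT); have i3 := wit_sym_lt i.
have [/andP[ie e2]|hn] := boolP ((i < ell) && (wit_prev i < 2)).
  have il : i < 2 ^ d by exact: leq_trans ell_le.
  apply: (@der_rule (RWit h.+1 k i (wit_sym i) (wit_prev i))) => //=.
  - by rewrite i3 e2.
  - by lia.
  move=> b; rewrite !inE => /orP[/eqP -> //|/eqP ->].
  have := @der_extension d (2 ^ d + i) 0 (leqnn d); rewrite subnn /= addKn.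
  by apply; rewrite ?expnS; lia.
have w2 : wit_prev i < 3 by case: (i) => // i'; exact: wit_sym_lt.
have e2 : wit_sym i = 2.
  rewrite /wit_sym; case: ltnP => // iu; move: hn; rewrite (leq_trans iu u_ell) /=.
  case: (i) iu => // i' iu; rewrite /= /wit_sym (ltnW iu).
  by case: nth.
rewrite /= e2; apply: (@der_rule (RWitEnd h.+1 k i (wit_prev i))) => //=.
- by move: hn; rewrite negb_and -leqNgt -leqNgt; case/orP => hn; apply/orP; [right | left; lia].
- by lia.
- by move=> b; rewrite inE => /eqP ->.
Qed.

(** Cells up to [T] suffice, as no head gets beyond cell [t] within [t] steps. *)
Definition der_conf t :=
  (forall c, c < K -> der (Head h.+1 k t c (head_pos (cfg t) (inord c)))) /\
  (forall c i, c < K -> i <= T -> der (Cell h.+1 k t c i (sym_code (cell (cfg t) (inord c) i)))).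

Lemma der_conf0 : der_conf 0.
Proof.
split=> [c cK|c i cK iT].
  by apply: (@der_rule (RHead0 h.+1 k c)) => //=; lia.
have [c0|c0] := posnP c.
  rewrite c0; have -> : inord 0 = ord0 :> 'I_K by apply: val_inj; rewrite /= inordK.
  rewrite /= input_code; case: ltnP => ix.
    by apply: (@der_rule (RCellX h.+1 k i)) => //=; lia.
  have := wit_sym_lt (i - xlen x); rewrite -/(wit_sym (i - xlen x)) => w3.
  apply: (@der_rule (RCellW h.+1 k (i - xlen x) (wit_sym (i - xlen x)))) => //=.
  - by rewrite subnKC.
  - by lia.
  - by move=> b; rewrite inE => /eqP ->; apply: (@der_wit (i - xlen x).+1); lia.
have -> : sym_code (cell (cfg 0) (inord c) i) = 2.
  have e0 : (inord c == ord0 :> 'I_K) = false by rewrite -val_eqE /= inordK //; lia.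
  by rewrite /= e0 /written nth_nil.
by apply: (@der_rule (RCellB h.+1 k c i)) => //=; [rewrite c0 cK | lia].
Qed.

Lemma der_reads t b : t <= T -> der_conf t ->
  b \in reads M h.+1 k t (view_code (view_of (cfg t))) -> der b.
Proof.
move=> tT [hh hc] /mapP[c]; rewrite mem_iota add0n => cK ->.
rewrite /tb_read view_codeK ffunE.
have ht := head_le t (inord c); set i := head_pos _ _ in ht *.
have sB := sym_code_lt (cell (cfg t) (inord c) i) B_sym.
apply: (@der_rule (RRead h.+1 k t c i (sym_code (cell (cfg t) (inord c) i)))) => //=.
- by lia.
- by move=> b'; rewrite !inE => /orP[/eqP ->|/eqP ->]; [exact: hh | apply: hc; lia].
Qed.

Lemma der_view t : t <= T ->
  der_conf t /\ der (View h.+1 k t (view_code (view_of (cfg t)))).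
Proof.
elim: t => [|t ih] tT.
  split; first exact: der_conf0.
  have zB := view_code_lt (view_of (cfg 0)).
  apply: (@der_rule (RView0 h.+1 k (view_code (view_of (cfg 0))))) => //=.
  - by rewrite zB /tb_state view_codeK eqxx.
  - by have := leq_trans zB B_view; rewrite /=; lia.
  - by move=> b; apply: der_reads der_conf0.
have [[hh hc] dv] := ih (ltnW tT).
have zB := view_code_lt (view_of (cfg t)).
have zB' := view_code_lt (view_of (cfg t.+1)).
have zb := leq_trans zB B_view.
have zb' := leq_trans zB' B_view.
have dc : der_conf t.+1.
  split=> [c cK|c i cK iT].
    have ht := head_le t (inord c).
    apply: (@der_rule (RHead h.+1 k t c (head_pos (cfg t) (inord c)) (view_code (view_of (cfg t))))) => /=.
    - by rewrite zB.
    - congr Head; rewrite stepE /tb_right /tb_left view_codeK -/(cfg t).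
      by case: response => q act /=; case: (act _).2 => /=; lia.
    - by lia.
    - by move=> b; rewrite !inE => /orP[] /eqP ->; [exact: dv | exact: hh].
  have [ei|ni] := eqVneq i (head_pos (cfg t) (inord c)).
    apply: (@der_rule (RCellNew h.+1 k t c i (view_code (view_of (cfg t))))) => /=.
    - by rewrite zB.
    - congr Cell; rewrite stepE /tb_write view_codeK -/(cfg t).
      by case: response => q act /=; rewrite ei eqxx.
    - by lia.
    - by move=> b; rewrite !inE => /orP[] /eqP ->; [exact: dv | rewrite ei; exact: hh].
  have ht := head_le t (inord c).
  have sB := sym_code_lt (cell (cfg t) (inord c) i) B_sym.
  apply: (@der_rule (RCell h.+1 k t c i (head_pos (cfg t) (inord c))
     (sym_code (cell (cfg t) (inord c) i)))) => //=.
  - congr Cell; rewrite stepE -/(cfg t).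
    by case: response => q act /=; rewrite (negbTE ni).
  - by lia.
  - by move=> b; rewrite !inE => /orP[] /eqP ->; [exact: hc | exact: hh].
split=> //.
apply: (@der_rule (RView h.+1 k t (view_code (view_of (cfg t))) (view_code (view_of (cfg t.+1))))) => //=.
- rewrite zB zB' /tb_state /tb_next !view_codeK /= [in X in _ == X]/=.
  by rewrite stepE -/(cfg t); case: response => q act /=.
- by rewrite /= in zb'; lia.
- by move=> b; rewrite inE => /orP[/eqP ->|] //; exact: der_reads.
Qed.

Lemma der_item : der (Item h.+1 k).
Proof.
apply: (@der_rule (RGoal h.+1 k)) => //=; first by lia.
move=> b; rewrite inE => /orP[/eqP ->|/mapP[y]].
  have [[_ hc] _] := der_view (leqnn T).
  apply: (@der_rule (RAcc h.+1 k)) => //=; first by lia.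
  move=> b'; rewrite inE => /eqP ->; have := hc (tapes M) 0 (ltnSn _) (leq0n _).
  have -> : inord (tapes M) = ord_max :> 'I_K by apply: val_inj; rewrite /= inordK.
  by rewrite accept.
rewrite mem_iota add0n => yP ->.
have yA := extension_lt 1 y (leqnn d).
have yP' : y < P by [].
apply: (@der_rule (RNe h.+1 k y (extension d 1 y))) => //=; first by lia.
move=> b'; rewrite inE => /eqP ->.
by have := @der_extension 0 1 y (leq0n d) isT; rewrite subn0; apply.
Qed.

End Copy.

(** Induction on the level [h]: the index of an item records the [D - h] positions chosen in the
    enclosing copies, and the item is derivable when all of them are good. *)
Lemma der_goal D : D < B -> W ^ D <= B -> (forall v, all_good D v -> U v) -> der (Item D 0).
Proof.
move=> DB WB hU.
suff h : forall h k, h <= D -> all_good (D - h) k -> der (Item h k).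
  by apply: h => //; rewrite subnn.
elim=> [|h ih] k hD gk; first by apply: DerSeed; apply: hU; rewrite subn0 in gk.
have kB : k < B.
  apply: leq_trans (all_good_lt gk) (leq_trans _ WB).
  by rewrite leq_pexp2l ?width_gt0 // leq_subr.
have hA : 0 < A by apply: leq_ltn_trans A_gt.
apply: der_item => // [|y yP]; first lia.
have eA := extension_lt 1 y (leqnn d).
have vW : y * A + extension d 1 y < W by rewrite /width; nia.
apply: ih; first exact: ltnW.
have -> : D - h = (D - h.+1).+1 by lia.
rewrite /= -addnA modnMDl divnMDl ?width_gt0 // modn_small // divn_small // addn0 gk andbT.
by rewrite /good modnMDl divnMDl // modn_small // divn_small // addn0.
Qed.

End Completeness.

(** * The digraph of the iterated system *)

Section Digits.
Variable C : nat.

Fixpoint encode (l : seq nat) : nat := if l is i :: l' then i + C * encode l' else 0.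

Definition digit i v := v %/ C ^ i %% C.

Lemma encode_lt l : all (fun i => i < C) l -> encode l < C ^ size l.
Proof. by elim: l => //= i l ih /andP[iC /ih]; rewrite expnS; nia. Qed.

Lemma encode_inj l l' : size l = size l' -> all (fun i => i < C) l ->
  all (fun i => i < C) l' -> encode l = encode l' -> l = l'.
Proof.
elim: l l' => [|i l ih] [|i' l'] //= [sl] /andP[iC lC] /andP[iC' lC'] e.
have [e1 e2] : i = i' /\ encode l = encode l'.
  have := congr1 (modn^~ C) e; have := congr1 (divn^~ C) e.
  rewrite !(mulnC C) !(addnC i) !(addnC i') !modnMDl !modn_small //.
  by rewrite !divnMDl ?divn_small ?addn0 //; lia.
by rewrite e1 (ih _ sl).
Qed.

Lemma digit_encode l i : i < size l -> all (fun i => i < C) l -> digit i (encode l) = nth 0 l i.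
Proof.
elim: l i => //= a l ih [|i] /= il /andP[aC lC].
  by rewrite /digit expn0 divn1 mulnC addnC modnMDl modn_small.
rewrite -ih // /digit expnS divnMA; congr (_ %/ _ %% _).
by rewrite mulnC addnC divnMDl ?divn_small ?addn0 //; lia.
Qed.

End Digits.

Definition rule_at (v : nat -> nat) : option rule :=
  nth None
   [:: Some (RBridge (v 1) (v 2) (v 3) (v 4));
       Some (RGoal (v 1) (v 2));
       Some (RNe (v 1) (v 2) (v 3) (v 4));
       Some (RVal (v 1) (v 2) (v 3) (v 4) (v 5));
       Some (RDec0 (v 1) (v 2) (v 3) (v 4) (v 5) (v 6) (v 7) (v 8));
       Some (RDec1 (v 1) (v 2) (v 3) (v 4) (v 5) (v 6) (v 7) (v 8));
       Some (RWit0 (v 1) (v 2));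
       Some (RWit (v 1) (v 2) (v 3) (v 4) (v 5));
       Some (RWitEnd (v 1) (v 2) (v 3) (v 4));
       Some (RCellW (v 1) (v 2) (v 3) (v 4));
       Some (RCellX (v 1) (v 2) (v 3));
       Some (RCellB (v 1) (v 2) (v 3) (v 4));
       Some (RHead0 (v 1) (v 2) (v 3));
       Some (RRead (v 1) (v 2) (v 3) (v 4) (v 5) (v 6));
       Some (RView0 (v 1) (v 2) (v 3));
       Some (RView (v 1) (v 2) (v 3) (v 4) (v 5));
       Some (RHead (v 1) (v 2) (v 3) (v 4) (v 5) (v 6));
       Some (RCellNew (v 1) (v 2) (v 3) (v 4) (v 5) (v 6));
       Some (RCell (v 1) (v 2) (v 3) (v 4) (v 5) (v 6) (v 7));
       Some (RAcc (v 1) (v 2))] (v 0).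

Lemma rule_at_code r : rule_at (nth 0 (rule_code r)) = Some r.
Proof. by case: r. Qed.

Lemma rule_at_ext v v' : (forall i, i < 9 -> v i = v' i) -> rule_at v = rule_at v'.
Proof. by move=> e; rewrite /rule_at !e. Qed.

Lemma rule_code_at B v r : rule_at v = Some r -> 0 < B -> (forall i, i < 9 -> v i < B) ->
  all (fun i => i < B) (rule_code r).
Proof.
move=> + B0 h; have h0 := h 0 isT; have h1 := h 1 isT; have h2 := h 2 isT.
have h3 := h 3 isT; have h4 := h 4 isT; have h5 := h 5 isT; have h6 := h 6 isT.
have h7 := h 7 isT; have h8 := h 8 isT; rewrite /rule_at.
move: (v 0) h0 => t h0.
do 20 (case: t h0 => [|t] h0; first by move=> [<-] /=; lia).
by rewrite /= nth_nil.
Qed.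

Lemma size_atom_code a : size (atom_code a) = 8. Proof. by case: a. Qed.
Lemma size_rule_code r : size (rule_code r) = 9. Proof. by case: r. Qed.

Section Graph.
Variables (M : tm) (x : seq bool) (ell d m A T B D : nat).
Notation K := (tapes M).+1.
Notation P := (points d m).
Notation W := (width d m A).
Notation guard := (@guard M x ell d m A).
Notation body := (@body M d m A T).
Notation concl := (@concl M x).
Notation der := (@der M x ell d m A T B).

(* Rule variables are below [B]; then all coordinates of atoms are below [B ^ 3]. *)
Notation C := (B ^ 3).
Notation N := (C ^ 9).

Definition acode (a : atom) := encode C (atom_code a).

Definition vars (c i : nat) := digit C i c.
Definition valid c := all (fun i => vars c i < B) (iota 0 9).

Definition base_body c c' : bool :=
  valid c && (if rule_at (vars c) is Some r then guard r && (c' \in map acode (body r)) else false).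

Definition base_head c c' : bool :=
  valid c && (if rule_at (vars c) is Some r then guard r && (c' == acode (concl r)) else false).

(** A node packs a tag, a copy below [B] and a code below [N]. The prime of a rule has the next tag
    and the same copy and code, whence the shift by [B * N] in [is_mate]. *)
Definition cnode tag j c := (tag * B + j) * N + c.
Definition tag_of v := v %/ N %/ B.
Definition copy_of v := (v %/ N) %% B.
Definition code_of v := v %% N.

Definition goal := acode (Item D 0).

Definition is_hlp v := odd (tag_of v) && (tag_of v < 11).
Definition is_prm v := [&& ~~ odd (tag_of v), 0 < tag_of v & tag_of v < 11].
Definition is_atm v := 10 < tag_of v.
Definition is_free v := (tag_of v == 0) || is_hlp v.
Definition is_mate v w := is_hlp v && (w == v + B * N).

(* Tags: 0 root, odd tags below 11 rules, followed by their primes, then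
   11 seeds, 12 private copies of the goal and 13 atoms.  Every seed has one
   private copy of the goal for each [j < B], so that no rule node sees the
   goals of all the copies of the system. *)
Definition rule_body v w : bool :=
  let j := copy_of v in let c := code_of v in
  let t' := tag_of w in let j' := copy_of w in let c' := code_of w in
  nth false [:: false;
    [&& t' == 13, j == j' & base_body c c'];
    false;
    [&& t' == 13, j == j' & c' == goal];
    false;
    [&& t' == 11, j' == 0 & c == c'];
    false;
    (t' == 12) && (c == c');
    false;
    [&& t' == 13, j == j' & c' == goal]] (tag_of v).

Definition rule_head v w : bool :=
  let j := copy_of v in let c := code_of v in
  let t' := tag_of w in let j' := copy_of w in let c' := code_of w in
  (j == j') && nth false [:: false;
    false;
    (t' == 13) && base_head c c';
    false;
    (t' == 13) && (c == c');
    false;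
    [&& t' == 13, c < C & c' == acode (Item 0 c)];
    false;
    (t' == 11) && (c == c');
    false;
    (t' == 12) && (c == c')] (tag_of v).

Definition edge_code v w : bool :=
  [|| [&& v == 0, w != 0 & is_free w], is_hlp v && (is_mate v w || rule_body v w)
    | is_prm v && rule_head v w].

Definition nodes := 14 * B * N.

(** Edges lead from the root to free nodes, from rules to primes and atoms, and from primes to
    atoms. Atoms are sinks, so even circular rules between atoms create no directed cycle. *)
Definition rank v := if v == 0 then 0 else if is_free v then 1 else if is_prm v then 2 else 3.

Lemma rule_body_atm v w : rule_body v w -> is_atm w.
Proof.
rewrite /rule_body /is_atm; move: (tag_of v) => t.
do 10 (case: t => [|t] /=; first by [move=> // | case/andP => /eqP -> | case/and3P => /eqP ->]).
by rewrite nth_nil.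
Qed.

Lemma rule_head_atm v w : rule_head v w -> is_atm w.
Proof.
rewrite /rule_head /is_atm => /andP[_]; move: (tag_of v) => t.
do 11 (case: t => [|t] /=; first by [move=> // | case/andP => /eqP -> | case/and3P => /eqP ->]).
by rewrite nth_nil.
Qed.

Hypothesis B_small : 20 <= B.

Lemma C_ge : 4 * (B * B) <= C.
Proof. by rewrite !expnS expn0; nia. Qed.

Lemma N_gt0 : 0 < N.
Proof. by rewrite !expn_gt0; have := B_small; lia. Qed.

Lemma B_gt0 : 0 < B. Proof. by have := B_small; lia. Qed.

Lemma encode_code_lt l : size l <= 9 -> all (fun i => i < C) l -> encode C l < N.
Proof.
move=> sl lC; apply: leq_trans (encode_lt lC) _.
by rewrite leq_pexp2l // expn_gt0 B_gt0.
Qed.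

Lemma valid_code r : all (fun i => i < B) (rule_code r) ->
  [/\ encode C (rule_code r) < N, valid (encode C (rule_code r)) &
      rule_at (vars (encode C (rule_code r))) = Some r].
Proof.
move=> h; have hC : all (fun i => i < C) (rule_code r).
  by apply: sub_all h => i iB; have := C_ge; nia.
have e i : i < 9 -> vars (encode C (rule_code r)) i = nth 0 (rule_code r) i.
  by move=> i9; rewrite /vars digit_encode // size_rule_code.
split; first by apply: encode_code_lt; rewrite ?size_rule_code.
- apply/allP => i; rewrite mem_iota add0n => /= i9; rewrite e //.
  by apply: (allP h); rewrite mem_nth // size_rule_code.
- by rewrite (rule_at_ext e) rule_at_code.
Qed.

Lemma valid_rule c r : valid c -> rule_at (vars c) = Some r ->
  all (fun i => i < B) (rule_code r).
Proof.
move=> hv e; apply: (rule_code_at e B_gt0) => i i9.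
by apply: (allP hv); rewrite mem_iota.
Qed.

Lemma cnodeE tag j c : j < B -> c < N ->
  [/\ tag_of (cnode tag j c) = tag, copy_of (cnode tag j c) = j & code_of (cnode tag j c) = c].
Proof.
move=> jB cN; rewrite /tag_of /copy_of /code_of /cnode.
rewrite divnMDl ?N_gt0 // (divn_small cN) addn0 divnMDl ?B_gt0 // divn_small // addn0.
by rewrite !modnMDl !modn_small.
Qed.

Lemma cnode_of v : v = cnode (tag_of v) (copy_of v) (code_of v).
Proof. by rewrite /cnode -divn_eq -divn_eq. Qed.

Lemma copy_lt v : copy_of v < B. Proof. by rewrite ltn_mod B_gt0. Qed.
Lemma code_lt v : code_of v < N. Proof. by rewrite ltn_mod N_gt0. Qed.

Lemma tag_lt v : (v < nodes) = (tag_of v < 14).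
Proof. by rewrite /tag_of !ltn_divLR ?N_gt0 ?B_gt0. Qed.

Lemma cnode_lt tag j c : tag < 14 -> j < B -> c < N -> cnode tag j c < nodes.
Proof. by move=> t14 jB cN; rewrite tag_lt; have [-> _ _] := cnodeE tag jB cN. Qed.

Lemma mateE v : [/\ tag_of (v + B * N) = (tag_of v).+1, copy_of (v + B * N) = copy_of v &
  code_of (v + B * N) = code_of v].
Proof.
have -> : v + B * N = cnode (tag_of v).+1 (copy_of v) (code_of v).
  by rewrite {1}(cnode_of v) /cnode; lia.
exact: cnodeE (copy_lt v) (code_lt v).
Qed.

Lemma tags v : [|| is_free v, is_prm v | is_atm v].
Proof. by rewrite /is_free /is_hlp /is_prm /is_atm; case: (tag_of v) => //= t; case: odd => /=; lia. Qed.

Lemma hlp_free v : is_hlp v -> is_free v. Proof. by rewrite /is_free => ->; rewrite orbT. Qed.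

Lemma prm_free v : is_prm v -> ~~ is_free v.
Proof.
rewrite /is_prm /is_free /is_hlp => /and3P[/negbTE -> t0 _] /=.
by rewrite orbF -lt0n.
Qed.

Lemma atm_free v : is_atm v -> ~~ is_free v && ~~ is_prm v.
Proof.
rewrite /is_prm /is_free /is_hlp /is_atm => h.
by rewrite !(ltnNge _ 11) h /= !andbF orbF -lt0n (leq_trans _ h).
Qed.

Lemma root_free : is_free 0. Proof. by rewrite /is_free /tag_of !div0n. Qed.
Lemma root_hlp : ~~ is_hlp 0. Proof. by rewrite /is_hlp /tag_of !div0n. Qed.

Lemma mate_prm v w : is_mate v w -> is_prm w.
Proof.
case/andP=> /andP[od t11] /eqP ->; rewrite /is_prm; have [-> _ _] := mateE v.
rewrite /= od /=; have : tag_of v != 10 by apply: contraTneq od => ->.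
lia.
Qed.

Lemma prm_mate w : is_prm w -> exists2 v, v <= w & is_hlp v && is_mate v w.
Proof.
case/and3P=> o t0 t11.
pose v := cnode (tag_of w).-1 (copy_of w) (code_of w).
have [e1 e2 e3] := cnodeE (tag_of w).-1 (copy_lt w) (code_lt w).
have hv : is_hlp v.
  rewrite /is_hlp e1; case: (tag_of w) o t0 t11 => //= t; rewrite negbK => -> _; lia.
have ew : w = v + B * N.
  rewrite {1}(cnode_of w) /v /cnode; case: (tag_of w) t0 => // t _; lia.
by exists v; [by rewrite ew leq_addr | rewrite /is_mate hv -ew eqxx].
Qed.

Lemma edge_rank v w : edge_code v w -> rank v < rank w.
Proof.
have r0 w' : w' != 0 -> 0 < rank w' by move=> h; rewrite /rank (negbTE h); case: ifP => //; case: ifP.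
have ratm w' : is_atm w' -> rank w' = 3.
  move=> h; have /andP[/negbTE h1 /negbTE h2] := atm_free h; rewrite /rank h1 h2.
  by case: eqP h1 => // ->; rewrite root_free.
have rprm w' : is_prm w' -> rank w' = 2.
  move=> h; have /negbTE h1 := prm_free h; rewrite /rank h1 h.
  by case: eqP h1 => // ->; rewrite root_free.
have rhlp w' : is_hlp w' -> rank w' = 1.
  move=> h; rewrite /rank (hlp_free h); case: eqP h => // ->; by rewrite (negbTE root_hlp).
case/or3P=> [/and3P[/eqP -> w0 _]|/andP[hv /orP[/mate_prm|/rule_body_atm]]|/andP[pv /rule_head_atm]] => [|h|h|h].
- exact: r0.
- by rewrite rhlp // rprm.
- by rewrite rhlp // ratm.
- by rewrite rprm // ratm.
Qed.

Lemma edge_irr : irreflexive (fun v w : 'I_nodes => edge_code v w).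
Proof. by move=> v; apply/negP => /edge_rank; rewrite ltnn. Qed.

Definition graph : digraph := Digraph edge_irr.

Lemma graph_acyclic : acyclic graph.
Proof. by apply: (@acyclic_rank graph (fun v : 'I_nodes => rank v)) => v w; exact: edge_rank. Qed.

Lemma rule_head_fun v w w' : rule_head v w -> rule_head v w' -> w = w'.
Proof.
move=> h h'; suff [e1 e2 e3] : [/\ tag_of w = tag_of w', copy_of w = copy_of w' & code_of w = code_of w'].
  by rewrite (cnode_of w) (cnode_of w') e1 e2 e3.
move: h h'; rewrite /rule_head => /andP[/eqP <-] + /andP[/eqP <-].
move: (tag_of v) => t.
do 2 (case: t => [|t] //=).
case: t => [|t] /=.
  move=> /andP[/eqP -> /andP[_ h]] /andP[/eqP -> /andP[_]]; move: h; case: rule_at => // r.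
  by move=> /andP[_ /eqP ->] /andP[_ /eqP ->].
case: t => [|t] //=.
case: t => [|t] /=; first by move=> /andP[/eqP -> /eqP <-] /andP[/eqP -> /eqP <-].
case: t => [|t] //=.
case: t => [|t] /=; first by move=> /and3P[/eqP -> _ /eqP ->] /and3P[/eqP -> _ /eqP ->].
case: t => [|t] //=.
case: t => [|t] /=; first by move=> /andP[/eqP -> /eqP <-] /andP[/eqP -> /eqP <-].
case: t => [|t] //=.
case: t => [|t] /=; first by move=> /andP[/eqP -> /eqP <-] /andP[/eqP -> /eqP <-].
by rewrite nth_nil.
Qed.

Lemma nodes_gt0 : 0 < nodes.
Proof. by rewrite /nodes muln_gt0 N_gt0 andbT muln_gt0 B_gt0. Qed.

Definition root : graph := Ordinal nodes_gt0.

Lemma graph_edgeE (v w : graph) : edge v w =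
  [|| (v == root) && (w != root) && is_free w, is_hlp v && (is_mate v w || rule_body v w)
    | is_prm v && rule_head v w].
Proof. by rewrite -andbA. Qed.

Lemma hlp_has_mate (v : graph) : is_hlp v -> exists w : graph, is_mate v w.
Proof.
move=> hv; have wl : v + B * N < nodes.
  rewrite tag_lt; have [-> _ _] := mateE v; case/andP: hv => _; lia.
by exists (Ordinal wl); rewrite /is_mate hv /=.
Qed.

Lemma prm_has_mate (w : graph) : is_prm w -> exists2 v : graph, is_hlp v & is_mate v w.
Proof.
move=> /prm_mate[v vw /andP[hv mv]].
by exists (Ordinal (leq_ltn_trans vw (ltn_ord w))).
Qed.

Lemma mate_fun (v w w' : graph) : is_mate v w -> is_mate v w' -> w = w'.
Proof. by case/andP=> _ /eqP e /andP[_ /eqP e']; apply: val_inj; rewrite /= e. Qed.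

Lemma mate_inj (v v' w : graph) : is_mate v w -> is_mate v' w -> v = v'.
Proof.
by case/andP=> _ /eqP e /andP[_ /eqP]; rewrite e => /addIn e'; apply: val_inj.
Qed.

Lemma head_fun (v w w' : graph) : rule_head v w -> rule_head v w' -> w = w'.
Proof. by move=> h h'; apply: val_inj; exact: rule_head_fun h h'. Qed.

Lemma graph_complete (S : {set graph}) :
  (forall Y : graph -> Prop, (forall u, u \in S -> Y u) ->
     (forall v p w : graph, is_hlp v -> is_mate v p -> rule_head p w ->
        (forall a : graph, rule_body v a -> Y a) -> Y w) -> forall a : graph, is_atm a -> Y a) ->
  power_dominates (root |: S).
Proof.
apply: (horn_complete (free := fun v : graph => is_free v) (prm := fun v : graph => is_prm v) graph_edgeE).
- by move=> v; exact: tags.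
- by move=> v w; exact: mate_prm.
- exact: mate_fun.
- exact: prm_has_mate.
- by move=> v w; exact: rule_body_atm.
- exact: head_fun.
- by move=> v; exact: hlp_free.
- by move=> v; exact: prm_free.
- exact: root_free.
- exact: root_hlp.
Qed.

Lemma graph_sound (S : {set graph}) (I : graph -> Prop) : power_dominates S ->
  (forall v p w : graph, is_hlp v -> is_mate v p -> rule_head p w ->
     (forall a : graph, rule_body v a -> I a) -> I w) ->
  (forall v, v \in S -> is_atm v -> I v) ->
  (forall v a : graph, v \in S -> is_hlp v -> rule_body v a -> I a) ->
  (forall v p a : graph, p \in S -> is_hlp v -> is_mate v p -> rule_body v a -> I a) ->
  forall a : graph, is_atm a -> I a.
Proof.
apply: (horn_sound (free := fun v : graph => is_free v) (prm := fun v : graph => is_prm v) graph_edgeE).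
- by move=> v w; exact: mate_prm.
- exact: mate_inj.
- exact: prm_has_mate.
- exact: hlp_has_mate.
- by move=> v w; exact: rule_body_atm.
- by move=> v w; exact: rule_head_atm.
- by move=> v; exact: prm_free.
- by move=> v; exact: atm_free.
Qed.

Definition nd tag j c : graph := insubd root (cnode tag j c).

Lemma ndE tag j c : tag < 14 -> j < B -> c < N -> nd tag j c = cnode tag j c :> nat.
Proof. by move=> ? ? ?; rewrite /nd val_insubd cnode_lt. Qed.

Lemma nd_parts tag j c : tag < 14 -> j < B -> c < N ->
  [/\ tag_of (nd tag j c) = tag, copy_of (nd tag j c) = j & code_of (nd tag j c) = c].
Proof. by move=> ? ? ?; rewrite ndE //; exact: cnodeE. Qed.

Lemma nd_of (v : graph) : v = nd (tag_of v) (copy_of v) (code_of v).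
Proof.
apply: val_inj; rewrite [RHS]ndE ?copy_lt ?code_lt -?cnode_of //.
by rewrite -tag_lt ltn_ord.
Qed.

Lemma acode_inj a b : all (fun i => i < C) (atom_code a) -> all (fun i => i < C) (atom_code b) ->
  acode a = acode b -> a = b.
Proof.
move=> ha hb /encode_inj e; apply: atom_code_inj.
by apply: e; rewrite ?size_atom_code.
Qed.

Lemma acode_lt8 a : all (fun i => i < C) (atom_code a) -> acode a < N.
Proof. by apply: encode_code_lt; rewrite size_atom_code. Qed.

Lemma B_le_C : B <= C. Proof. by have := C_ge; have := B_small; nia. Qed.
Lemma C_le_N : C <= N. Proof. by rewrite -{1}(expn1 C) leq_pexp2l // expn_gt0 B_gt0. Qed.

Hypothesis m_gt0 : 0 < m.
Hypothesis ell_le : ell <= 2 ^ d.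
Hypothesis A_gt : 2 * m ^ d < A.
Hypothesis D_gt0 : 0 < D.
Hypothesis B_D : D < B.
Hypothesis B_W : W ^ D <= B.
Hypothesis B_leaf : 2 * 2 ^ d <= B.
Hypothesis B_m : m < B.
Hypothesis B_x : xlen x <= B.
Hypothesis B_T : T < B.
Hypothesis B_sym : 3 + #|extra M| <= B.
Hypothesis B_view : #|view M| <= B.
Hypothesis B_K : K <= B.

Lemma W_le : W <= B.
Proof.
apply: leq_trans B_W; case: D D_gt0 => // D' _.
by rewrite expnS leq_pmulr // expn_gt0 (width_gt0 A_gt).
Qed.

Lemma P_le : P <= B.
Proof. by apply: leq_trans W_le; rewrite /width leq_pmulr //; apply: leq_ltn_trans A_gt. Qed.

Lemma A_le : A <= B.
Proof. by apply: leq_trans W_le; rewrite /width leq_pmull // expn_gt0. Qed.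

(** The largest coordinates, such as [k * W + y * A + e] and the interpolated values, are only
    quadratic in [B], which leaves room below [B ^ 3]. *)
Lemma acoords r b : guard r -> all (fun i => i < B) (rule_code r) ->
  b \in concl r :: body r -> all (fun i => i < C) (atom_code b).
Proof.
have hW := W_le; have hA := A_le; have hP := P_le; have hC := C_ge.
move: C hC => C' hC.
have mulB a c : a < B -> c <= B -> a * c <= B * B by move=> ? ?; apply: leq_mul => //; exact: ltnW.
have hBB : B <= B * B by nia.
have hBC a : a <= B -> a < C' by have := B_small; nia.
have hi p e f : p <= m -> e < B -> f < B -> interp m p e f <= B * B + B * B.
  move=> pm eB fB; rewrite /interp; apply: leq_add; rewrite mulnC; apply: mulB => //; have := B_m; lia.
have hs (e : symbol M) : sym_code e < B by exact: sym_code_lt.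
have hr h k t z b' : t <= B -> h <= B -> k <= B -> b' \in reads M h k t z -> all (fun i => i < C') (atom_code b').
  move=> ? ? ? /mapP[c]; rewrite mem_iota add0n => cK ->.
  have cB : c <= B by apply: leq_trans (ltnW cK) B_K.
  have sB : tb_read M z c <= B by apply: ltnW; exact: hs.
  by rewrite /= !hBC //; have := B_small; lia.
have h20 := B_small; have bm := B_m; have bx := B_x; have bT := B_T; have bl := B_leaf; have bK := B_K.
have BC : B < C' by nia.
have two c c' : b \in [:: c; c'] -> b = c \/ b = c' by rewrite !inE => /orP[] /eqP; auto.
have one c : b \in [:: c] -> b = c by rewrite inE => /eqP.
have three c c' c2 : b \in [:: c; c'; c2] -> [\/ b = c, b = c' | b = c2].
  by rewrite !inE => /or3P[] /eqP; [constructor 1 | constructor 2 | constructor 3].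
case: r => /=.
- move=> h k y e /andP[yP eA] hc /two[] -> /=; first by lia.
  have := mulB k W; have := mulB y A; lia.
- move=> h k _ hc; rewrite !inE => /or3P[/eqP ->|/eqP ->|/mapP[y]] /=; [lia|lia|].
  by rewrite mem_iota add0n => yP -> /=; lia.
- by move=> h k y e _ hc /two[] -> /=; lia.
- move=> h k s y e s1 hc; rewrite inE => /orP[/eqP -> /=|/allpairsPdep[q [p [hq hp ->]]] /=]; first by lia.
  by move: hq hp; rewrite !mem_iota /=; lia.
- move=> h k s y e f p q /and3P[s0 pq qm] hc /three.
  have hp := hi p e f; have hq := hi q e f; have hy : y * m.+1 <= B * B by apply: mulB; lia.
  by case=> -> /=; lia.
- move=> h k s y e f p q /and3P[s0 pq qm] hc /three.
  have hp := hi p f e; have hq := hi q f e; have hy : y * m.+1 <= B * B by apply: mulB; lia.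
  by case=> -> /=; lia.
- by move=> h k _ hc /one -> /=; lia.
- by move=> h k i e e' /and3P[e3 e2 il] hc /three[] -> /=; lia.
- by move=> h k i e _ hc /two[] -> /=; lia.
- by move=> h k i e _ hc /two[] -> /=; lia.
- by move=> h k i ix hc /one -> /=; case: nth => /=; lia.
- by move=> h k c i hcK hc /one -> /=; lia.
- by move=> h k c hcK hc /one -> /=; lia.
- by move=> h k t c i e _ hc /three[] -> /=; lia.
- move=> h k z _ hc; rewrite inE => /orP[/eqP -> /=|]; first by lia.
  by apply: hr; lia.
- move=> h k t z z' _ hc; rewrite !inE => /or3P[/eqP -> /=|/eqP -> /=|]; [lia|lia|].
  by apply: hr; lia.
- move=> h k t c i z _ hc /three.
  have : tb_right M z c <= 1 by rewrite /tb_right; case: (_.2).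
  by move=> r1; case=> -> /=; lia.
- move=> h k t c i z _ hc /three.
  have : tb_write M z c < B by exact: hs.
  by move=> r1; case=> -> /=; lia.
- by move=> h k t c i j e _ hc /three[] -> /=; lia.
- by move=> h k _ hc /two[] -> /=; lia.
Qed.

Lemma acode_lt r b : guard r -> all (fun i => i < B) (rule_code r) ->
  b \in concl r :: body r -> acode b < N.
Proof. by move=> g c /(acoords g c); apply: encode_code_lt; rewrite size_atom_code. Qed.

Lemma goal_coords : all (fun i => i < C) (atom_code (Item D 0)).
Proof. by rewrite /=; have := C_ge; have := B_D; have := B_small; nia. Qed.

(** * Accepted inputs admit a small dominating set *)

Section Yes.
Variable u : seq bool.
Hypothesis u_ell : size u <= ell.
Hypothesis accept :
  cell (iter T (@step M) (init M (pairing x u))) ord_max 0 = Some (inl true).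
Let U v : bool := all_good d m A u D v.
Let S : {set graph} := [set v : graph | [&& tag_of v == 11, copy_of v == 0 & U (code_of v)]].

Lemma good_lt v : U v -> v < B.
Proof. by move/(all_good_lt A_gt) => h; apply: leq_trans h B_W. Qed.

Lemma card_seeds : #|S| <= P ^ D.
Proof.
rewrite -(card_all_good u m_gt0 A_gt D).
have -> : \sum_(v < W ^ D) all_good d m A u D v = #|[set v : 'I_(W ^ D) | U v]|.
  rewrite -sum1_card [RHS]big_mkcond /=; apply: eq_bigr => v _; rewrite inE /U.
  by case: all_good.
apply: leq_trans (leq_imset_card (fun v : 'I_(W ^ D) => nd 11 0 v) _).
apply/subset_leq_card/subsetP => v; rewrite inE => /and3P[/eqP t /eqP j uv].
apply/imsetP; exists (Ordinal (all_good_lt A_gt uv)); first by rewrite inE.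
by rewrite [LHS]nd_of t j.
Qed.

(** The goal is derived in every copy. Rules of tag 9 then give the private goals, those of tag 7
    all seeds, chosen or not, and those of tag 3 every other atom of each copy. *)
Lemma seeds_dominate : power_dominates (root |: S).
Proof.
apply: graph_complete => Y hS hY.
have use t j c w : odd t -> t < 11 -> j < B -> c < N -> rule_head (nd t.+1 j c) (w : graph) ->
    (forall a : graph, rule_body (nd t j c) a -> Y a) -> Y w.
  move=> ot t11 jB cN; have t14 : t.+1 < 14 by lia.
  have [e1 e2 e3] := nd_parts (ltnW t14) jB cN.
  have hv : is_hlp (nd t j c) by rewrite /is_hlp e1 ot.
  have mt : is_mate (nd t j c) (nd t.+1 j c).
    by rewrite /is_mate hv !ndE ?(ltnW t14) // /cnode; apply/eqP; lia.
  exact: hY hv mt.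
have NB : B <= N := leq_trans B_le_C C_le_N.
have der_Y j a : j < B -> der U a -> acode a < N /\ Y (nd 13 j (acode a)).
  move=> jB; elim=> [th uth|r g rc _ ih].
    have thB := good_lt uth.
    have iN : acode (Item 0 th) < N.
      apply: acode_lt8 => /=; have := leq_trans thB B_le_C; have := C_ge; have := B_small; nia.
    split=> //; apply: (use 5 j th) => //; first exact: leq_trans NB.
      have [e1 e2 e3] := @nd_parts 6 j th isT jB (leq_trans thB NB).
      have [f1 f2 f3] := @nd_parts 13 j _ isT jB iN.
      rewrite /rule_head e1 e2 e3 f1 f2 f3 !eqxx /= ?eqxx ?andbT.
      exact: leq_trans thB B_le_C.
    move=> a' ; have [e1 e2 e3] := @nd_parts 5 j th isT jB (leq_trans thB NB).
    rewrite /rule_body e1 e2 e3 /= => /and3P[/eqP t0 /eqP j0 /eqP c0].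
    by apply: hS; rewrite inE t0 j0 -c0 !eqxx.
  have aN := acode_lt g rc (mem_head _ _); split=> //.
  have [cN cv cr] := valid_code rc.
  apply: (use 1 j _ _ isT isT jB cN).
    have [e1 e2 e3] := @nd_parts 2 j _ isT jB cN.
    have [f1 f2 f3] := @nd_parts 13 j _ isT jB aN.
    by rewrite /rule_head e1 e2 e3 f1 f2 f3 !eqxx /= /base_head cv cr g eqxx.
  move=> a'; have [e1 e2 e3] := @nd_parts 1 j _ isT jB cN.
  rewrite /rule_body e1 e2 e3 /= => /and3P[/eqP t0 /eqP j0].
  rewrite /base_body cv cr g /= => /mapP[b hb eb].
  by rewrite (nd_of a') t0 -j0 eb; case: (ih b hb).
have dg : der U (Item D 0).
  apply: (der_goal m_gt0 A_gt u_ell ell_le B_small P_le A_le B_leaf B_m B_x B_T B_sym B_view B_K accept) => //.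
have gY j : j < B -> Y (nd 13 j goal) by move=> jB; case: (der_Y j _ jB dg).
have hj (w : graph) := copy_lt w; have hc (w : graph) := code_lt w.
have fin (w : graph) t s : odd t -> t < 11 ->
    (forall j c, j < B -> c < N -> rule_head (nd t.+1 j c) w = (j == copy_of w) && (c == code_of w) ) ->
    (forall a : graph, rule_body (nd t (copy_of w) (code_of w)) a -> Y a) -> tag_of w = s -> Y w.
  move=> ot t11 hh hb _; apply: (use t (copy_of w) (code_of w)) => //.
  by rewrite hh // !eqxx.
have goal_body t (w a : graph) : (t == 3) || (t == 9) ->
    rule_body (nd t (copy_of w) (code_of w)) a -> Y a.
  move=> ht; have t14 : t < 14 by case/orP: ht => /eqP ->.
  have [e1 e2 e3] := nd_parts t14 (hj w) (hc w).
  have : [&& tag_of a == 13, copy_of w == copy_of a & code_of a == goal] -> Y a.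
    by case/and3P=> /eqP t0 /eqP j0 /eqP c0; rewrite (nd_of a) t0 c0; apply: gY.
  by rewrite /rule_body e1 e2 e3; case/orP: ht => /eqP ->.
have Y12 (w : graph) : tag_of w = 12 -> Y w.
  move=> tw; apply: (fin w 9 _ isT isT _ _ tw) => [j c jB cN|a]; last exact: goal_body.
  by have [e1 e2 e3] := @nd_parts 10 j c isT jB cN; rewrite /rule_head e1 e2 e3 tw.
move=> w wa; have : tag_of w < 14 by rewrite -tag_lt ltn_ord.
rewrite /is_atm in wa => w14.
have [tw|[tw|tw]] : tag_of w = 11 \/ tag_of w = 12 \/ tag_of w = 13 by lia.
- apply: (fin w 7 _ isT isT _ _ tw) => [j c jB cN|a].
    by have [e1 e2 e3] := @nd_parts 8 j c isT jB cN; rewrite /rule_head e1 e2 e3 tw.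
  have [e1 e2 e3] := @nd_parts 7 _ _ isT (hj w) (hc w).
  by rewrite /rule_body e1 e2 e3 /= => /andP[/eqP /Y12].
- exact: Y12.
- apply: (fin w 3 _ isT isT _ _ tw) => [j c jB cN|a]; last exact: goal_body.
  by have [e1 e2 e3] := @nd_parts 4 j c isT jB cN; rewrite /rule_head e1 e2 e3 tw.
Qed.

Lemma graph_yes : pds_opt graph <= (P ^ D).+1.
Proof.
rewrite /pds_opt; case: arg_minnP => [|S0 _ min0]; first exact: power_dominates_setT.
apply: leq_trans (min0 _ seeds_dominate) _.
by rewrite cardsU1; have := card_seeds; case: (root \notin S); lia.
Qed.

End Yes.

(** * Rejected inputs force large dominating sets *)

Section No.
Hypothesis reject : forall u, size u <= ell ->
  cell (iter T (@step M) (init M (pairing x u))) ord_max 0 <> Some (inl true).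
Variable S : {set graph}.
Hypothesis S_dom : power_dominates S.
Hypothesis S_lt : #|S| < B.
Let U c := exists2 v : graph, v \in S & code_of v = c.
Let J j := exists2 v : graph, v \in S & copy_of v = j.

Lemma fresh_copy : exists2 j, j < B & ~ J j.
Proof.
apply: contrapT => h; move: S_lt; apply/negP; rewrite -leqNgt.
pose f (v : graph) : 'I_B := Ordinal (copy_lt v).
apply: leq_trans (leq_imset_card f _).
rewrite -[leqLHS](card_ord B) -cardsT; apply/subset_leq_card/subsetP => j _.
have [v vS vj] : J j by apply: contrapT => nj; apply: h; exists j.
by apply/imsetP; exists v => //; apply: val_inj.
Qed.

(** A chosen node is charged twice: its code counts as a seed and its copy as spoilt. Atoms of a
    spoilt copy are given away, all others must be derivable from [U]; a private goal may be due to
    its copy or to its seed. *)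
Definition sound_inv (v : nat) : Prop :=
  [/\ tag_of v = 11 -> U (code_of v),
      tag_of v = 12 -> J (copy_of v) \/ U (code_of v) &
      tag_of v = 13 -> J (copy_of v) \/
        exists a, [/\ code_of v = acode a, all (fun i => i < C) (atom_code a) & der U a]].

Lemma rule_body_inv v a : rule_body v a -> J (copy_of v) -> U (code_of v) -> sound_inv a.
Proof.
rewrite /rule_body /sound_inv => + hj hu; move: (tag_of v) => t.
do 1 (case: t => [|t] //=).
case: t => [|t] /=; first by case/and3P=> /eqP ta /eqP <- _; split; rewrite ta // => _; left.
case: t => [|t] //=.
case: t => [|t] /=; first by case/and3P=> /eqP ta /eqP <- _; split; rewrite ta // => _; left.
case: t => [|t] //=.
case: t => [|t] /=; first by case/and3P=> /eqP ta _ /eqP <-; split; rewrite ta.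
case: t => [|t] //=.
case: t => [|t] /=; first by case/andP=> /eqP ta /eqP <-; split; rewrite ta // => _; right.
case: t => [|t] //=.
case: t => [|t] /=; first by case/and3P=> /eqP ta /eqP <- _; split; rewrite ta // => _; left.
by rewrite nth_nil.
Qed.

Lemma seed_coords c : c < C -> all (fun i => i < C) (atom_code (Item 0 c)).
Proof. by move=> cC; rewrite /= cC; have := C_ge; have := B_small; nia. Qed.

(** Otherwise the invariant, which then survives all rules, would hold for the goal of an untouched
    copy [j0], where it says precisely that the goal is derivable. *)
Lemma goal_derivable : der U (Item D 0).
Proof.
apply: contrapT => ng; have [j0 j0B nj0] := fresh_copy.
have goalN : goal < N by apply: acode_lt8 goal_coords.
have inv_goal j : j < B -> sound_inv (nd 13 j goal) -> J j.
  move=> jB [_ _]; have [-> -> ->] := @nd_parts 13 j goal isT jB goalN.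
  case/(_ erefl) => // -[a [ea ha da]]; case: ng.
  by rewrite (acode_inj goal_coords ha ea).
suff h : forall a : graph, is_atm a -> sound_inv a.
  have [e1 _ _] := @nd_parts 13 j0 goal isT j0B goalN.
  by apply: nj0; apply: inv_goal => //; apply: h; rewrite /is_atm e1.
apply: (graph_sound S_dom).
- move=> v p w hv /andP[_ /eqP ep].
  have [t1 t2 t3] := mateE v; rewrite -ep in t1 t2 t3.
  have vj := copy_lt v; have vc := code_lt v.
  rewrite /rule_head /rule_body t1 t2 t3 => /andP[/eqP jw] hw hb.
  case/andP: hv => ot t11; move: (tag_of v) ot t11 hw hb => t.
  have goal_case : (forall a : graph, [&& tag_of a == 13, copy_of v == copy_of a & code_of a == goal] ->
      sound_inv a) -> J (copy_of v).
    move=> hb; apply: inv_goal => //; apply: hb.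
    by have [-> -> ->] := @nd_parts 13 _ goal isT vj goalN; rewrite !eqxx.
  case: t => [//|t]; case: t => [|t] /=.
    move=> _ _ /andP[/eqP tw /andP[cv]]; case er: rule_at => [r|] // /andP[g /eqP cw] hb.
    have rc := valid_rule cv er.
    split; rewrite tw // => _; rewrite -jw.
    case: (EM (J (copy_of v))) => nj; [by left | right].
    exists (concl r); split=> //; first exact: (acoords g rc (mem_head _ _)).
    apply: DerRule => // b hbr.
    have hbc := acoords g rc (mem_behead (s := concl r :: body r) hbr).
    have hbN := acode_lt8 hbc.
    have [e1 e2 e3] := @nd_parts 13 _ _ isT vj hbN.
    have [_ _] : sound_inv (nd 13 (copy_of v) (acode b)).
      by apply: hb; rewrite e1 e2 e3 !eqxx /= /base_body cv er g map_f.
    rewrite e1 e2 e3 => /(_ erefl) [//|[a [ea ha da]]].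
    by rewrite (acode_inj hbc ha ea).
  case: t => [//|t]; case: t => [|t] /=.
    by move=> _ _ /andP[/eqP tw _] /goal_case gj; split; rewrite tw // -jw; left.
  case: t => [//|t]; case: t => [|t] /=.
    move=> _ _ /and3P[/eqP tw cC /eqP cw] hb; split; rewrite tw // => _; right.
    exists (Item 0 (code_of v)); split=> //; first exact: seed_coords.
    apply: DerSeed; have [e1 e2 e3] := @nd_parts 11 0 _ isT B_gt0 vc.
    have [hu _ _] : sound_inv (nd 11 0 (code_of v)) by apply: hb; rewrite e1 e2 e3 !eqxx.
    by move: hu; rewrite e1 e3; apply.
  case: t => [//|t]; case: t => [|t] /=.
    move=> _ _ /andP[/eqP tw /eqP cw] hb; split; rewrite tw // => _; rewrite -cw.
    (* The body contains the private goals for all copies, among them the untouched [j0], for which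
       only [U] remains possible. *)
    have [e1 e2 e3] := @nd_parts 12 j0 _ isT j0B vc.
    have [_ hu _] : sound_inv (nd 12 j0 (code_of v)) by apply: hb; rewrite e1 e3 !eqxx.
    by move: hu; rewrite e1 e2 e3 => /(_ erefl) [].
  case: t => [//|t]; case: t => [|t] /=.
    by move=> _ _ /andP[/eqP tw _] /goal_case gj; split; rewrite tw // -jw; left.
  by move=> _ _; rewrite nth_nil.
- move=> v vS _; have hj : J (copy_of v) by exists v.
  by split=> // _; [exists v | left | left].
- move=> v a vS hv hb; apply: rule_body_inv hb _ _; by exists v.
- move=> v p a pS hv /andP[_ /eqP ep] hb; have [t1 t2 t3] := mateE v; rewrite -ep in t2 t3.
  by apply: rule_body_inv hb _ _; exists p.
Qed.

(** Each seed of [U] is the code of some chosen node, so [U] has at most [#|S|] elements. *)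
Lemma graph_no : (P + m ^ d) ^ D <= #|S|.
Proof.
apply: leq_trans (goal_weight reject ell_le goal_derivable) _.
have -> : \sum_(i < W ^ D) `[< U i >] = #|[set i : 'I_(W ^ D) | `[< U i >]]|.
  rewrite -sum1_card [RHS]big_mkcond /=; apply: eq_bigr => i _; rewrite inE.
  by case: asbool.
pose f (v : graph) : 'I_N := Ordinal (code_lt v).
apply: leq_trans (leq_imset_card f _).
have WN : W ^ D <= N := leq_trans B_W (leq_trans B_le_C C_le_N).
have winj : injective (widen_ord WN) by move=> i i' /(congr1 val) /= /val_inj.
rewrite -(card_imset _ winj).
apply/subset_leq_card/subsetP => _ /imsetP[i + ->]; rewrite inE => /asboolP[v vS vi].
by apply/imsetP; exists v => //; apply: val_inj.
Qed.

End No.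

End Graph.

(** * Computing the digraph *)

Lemma PC_head : PC (fun _ a => head 0 a).
Proof. by apply: PC_ext (PC_nth 0) => x a; rewrite nth0. Qed.

Lemma PC_nth1 i : PC (fun _ a => nth 0 (behead a) i).
Proof. exact: PC_behead (PC_nth i). Qed.

Lemma PC_nth2 i : PC (fun _ a => nth 0 (behead (behead a)) i).
Proof. exact: PC_behead (PC_nth1 i). Qed.

Lemma PC_head1 : PC (fun _ a => head 0 (behead a)).
Proof. exact: PC_behead PC_head. Qed.

Lemma PC_nth_cases (l : seq (seq bool -> seq nat -> bool)) f : PC f ->
  foldr (fun (p : seq bool -> seq nat -> bool) => and (PC (fun x a => p x a))) True l ->
  PC (fun x a => nth false [seq p x a | p <- l] (f x a)).
Proof.
elim: l f => [|p l ih] f hf /=.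
  by move=> _; apply: PC_ext (PC_lit 0) => x a; rewrite nth_nil.
case=> hp hl.
apply: PC_ext (PC_if (PC_eq hf (PC_lit 0)) hp (ih _ (PC_pred hf) hl)) => x a.
by case: (f x a).
Qed.

Lemma PC_bool (p : seq bool -> seq nat -> bool) (q : seq bool -> seq nat -> bool) :
  (forall x a, p x a = q x a) -> PC p -> PC q.
Proof. by move=> e; apply: PC_ext => x a; rewrite e. Qed.

(** A function that is constant from [n] on is a finite table; the transition data of the fixed
    verifier are of this kind. *)
Lemma PC_finite1 (F : nat -> nat) n f : (forall z, F (minn z n) = F z) ->
  PC f -> PC (fun x a => F (f x a)).
Proof.
move=> hF hf; apply: PC_ext (PC_table [seq F i | i <- iota 0 n.+1] (PC_minn hf (PC_lit n))) => x a.
have h1 : minn (f x a) n < n.+1 by rewrite ltnS geq_minr.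
by rewrite (nth_map 0) ?size_iota // nth_iota // add0n.
Qed.

Lemma PC_finite2 (F : nat -> nat -> nat) n k f g : (forall z c, F (minn z n) (minn c k) = F z c) ->
  PC f -> PC g -> PC (fun x a => F (f x a) (g x a)).
Proof.
move=> hF hf hg.
pose G i := F (i %/ k.+1) (i %% k.+1).
apply: PC_ext (PC_table [seq G i | i <- iota 0 (n.+1 * k.+1)]
  (PC_add (PC_mul (PC_minn hf (PC_lit n)) (PC_lit k.+1)) (PC_minn hg (PC_lit k)))) => x a.
have h1 : minn (f x a) n <= n := geq_minr _ _.
have h2 : minn (g x a) k < k.+1 by rewrite ltnS geq_minr.
have h3 : minn (f x a) n * k.+1 + minn (g x a) k < n.+1 * k.+1 by nia.
rewrite (nth_map 0) ?size_iota // nth_iota // add0n /G.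
by rewrite modnMDl divnMDl // modn_small // divn_small // addn0.
Qed.

Section Tables.
Variable M : tm.
Notation K := (tapes M).+1.

Lemma view_at_minn z : view_at M (minn z #|view M|) = view_at M z.
Proof.
rewrite /view_at; case: (leqP z #|view M|) => h //.
by rewrite !nth_default // -cardE // ltnW.
Qed.

Lemma inord_minn c : inord (minn c K) = inord c :> 'I_K.
Proof.
rewrite /inord /insubd; case: (ltnP c K) => h //.
by rewrite !insubF ?ltnn // ltnNge h.
Qed.

Lemma PC_tb_read f g : PC f -> PC g -> PC (fun x a => tb_read M (f x a) (g x a)).
Proof. by apply: (PC_finite2 (n := #|view M|) (k := K)) => z c; rewrite /tb_read view_at_minn inord_minn. Qed.

Lemma PC_tb_write f g : PC f -> PC g -> PC (fun x a => tb_write M (f x a) (g x a)).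
Proof. by apply: (PC_finite2 (n := #|view M|) (k := K)) => z c; rewrite /tb_write view_at_minn inord_minn. Qed.

Lemma PC_tb_right f g : PC f -> PC g -> PC (fun x a => tb_right M (f x a) (g x a)).
Proof. by apply: (PC_finite2 (n := #|view M|) (k := K)) => z c; rewrite /tb_right view_at_minn inord_minn. Qed.

Lemma PC_tb_left f g : PC f -> PC g -> PC (fun x a => tb_left M (f x a) (g x a)).
Proof. by apply: (PC_finite2 (n := #|view M|) (k := K)) => z c; rewrite /tb_left view_at_minn inord_minn. Qed.

Lemma PC_tb_state f : PC f -> PC (fun x a => tb_state M (f x a)).
Proof. by apply: (PC_finite1 (n := #|view M|)) => z; rewrite /tb_state view_at_minn. Qed.

Lemma PC_tb_next f : PC f -> PC (fun x a => tb_next M (f x a)).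
Proof. by apply: (PC_finite1 (n := #|view M|)) => z; rewrite /tb_next view_at_minn. Qed.

End Tables.

Lemma pairing_bit x i : nth false (pairing x [::]) i =
  (if i < 2 * size x then isbit true x (i %/ 2) else i == 2 * size x) :> nat.
Proof.
rewrite /pairing /isbit; elim: x i => [|b x ih] i.
  by rewrite muln0; case: i => [|[|i]] //=; rewrite nth_nil.
case: i => [|[|i]] /=; [by case: b | have -> : (1 < 2 * (size x).+1) = true; [lia | by case: b] |].
have -> : i.+2 %/ 2 = (i %/ 2).+1 by rewrite -addn2 divnDr // divnn addn1.
have -> : (i.+2 < 2 * (size x).+1) = (i < 2 * size x) by lia.
have -> : (i.+2 == 2 * (size x).+1) = (i == 2 * size x) by lia.
exact: ih.
Qed.

Lemma PC_pairing f : PC f -> PC (fun x a => nth false (pairing x [::]) (f x a)).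
Proof.
move=> hf; have h2 : PC (fun x a => 2 * size x) by apply: PC_mul (PC_lit 2) PC_size.
apply: PC_ext (PC_if (PC_ltn hf h2) (PC_isbit true (PC_divn hf (PC_lit 2))) (PC_eq hf h2)) => x a.
by rewrite pairing_bit.
Qed.

Lemma mem_map_has (T : eqType) (f : T -> nat) (c : nat) (s : seq T) :
  (c \in map f s) = has (fun b => c == f b) s.
Proof. by elim: s => //= b s ih; rewrite inE ih. Qed.

Lemma has_allpairs_dep (T : Type) (f : nat -> nat -> T) (p : pred T) (s : seq nat) (t : nat -> seq nat) :
  has p [seq f i j | i <- s, j <- t i] = has (fun i => has (fun j => p (f i j)) (t i)) s.
Proof. by elim: s => //= i s ih; rewrite has_cat ih has_map. Qed.

Section EdgePC.
Variables (M : tm) (ell d m A T B D : seq bool -> nat).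
Notation K := (tapes M).+1.
Hypothesis ell_PC : PC (fun x _ => ell x).
Hypothesis leaf_PC : PC (fun x _ => 2 ^ d x).
Hypothesis points_PC : PC (fun x _ => points (d x) (m x)).
Hypothesis m_PC : PC (fun x _ => m x).
Hypothesis A_PC : PC (fun x _ => A x).
Hypothesis T_PC : PC (fun x _ => T x).
Hypothesis B_PC : PC (fun x _ => B x).
Hypothesis D_PC : PC (fun x _ => D x).

Ltac pc_leaf := first
  [ exact: PC_lit | exact: PC_nth | exact: PC_nth1 | exact: PC_nth2 | exact: PC_head | exact: PC_head1
  | exact: PC_size | assumption ].

Ltac pc1 := lazymatch goal with
  | |- PC (fun x a => S (@?f x a)) => refine (PC_succ _)
  | |- PC (fun x a => addn (@?f x a) (@?g x a)) => refine (PC_add _ _)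
  | |- PC (fun x a => subn (@?f x a) (@?g x a)) => refine (PC_sub _ _)
  | |- PC (fun x a => muln (@?f x a) (@?g x a)) => refine (PC_mul _ _)
  | |- PC (fun x a => divn (@?f x a) (@?g x a)) => refine (PC_divn _ _)
  | |- PC (fun x a => modn (@?f x a) (@?g x a)) => refine (PC_modn _ _)
  | |- PC (fun x a => expn (@?f x a) ?n) => first [pc_leaf | refine (PC_expn_lit _ _)]
  | |- PC (fun x a => nat_of_bool (andb (@?f x a) (@?g x a))) => refine (PC_and _ _)
  | |- PC (fun x a => nat_of_bool (orb (@?f x a) (@?g x a))) => refine (PC_or _ _)
  | |- PC (fun x a => nat_of_bool (negb (@?f x a))) => refine (PC_not _)
  | |- PC (fun x a => nat_of_bool (leq (@?f x a) (@?g x a))) => refine (PC_leq _ _)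
  | |- PC (fun x a => nat_of_bool (@eq_op _ (@?f x a) (@?g x a))) => refine (PC_eq _ _)
  | |- PC (fun x a => tb_read _ (@?f x a) (@?g x a)) => refine (@PC_tb_read M _ _ _ _)
  | |- PC (fun x a => tb_write _ (@?f x a) (@?g x a)) => refine (@PC_tb_write M _ _ _ _)
  | |- PC (fun x a => tb_right _ (@?f x a) (@?g x a)) => refine (@PC_tb_right M _ _ _ _)
  | |- PC (fun x a => tb_left _ (@?f x a) (@?g x a)) => refine (@PC_tb_left M _ _ _ _)
  | |- PC (fun x a => tb_state _ (@?f x a)) => refine (@PC_tb_state M _ _)
  | |- PC (fun x a => tb_next _ (@?f x a)) => refine (@PC_tb_next M _ _)
  | |- PC (fun x a => nat_of_bool (nth false (pairing x [::]) (@?f x a))) => refine (PC_pairing _)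
  | |- _ => pc_leaf
  end.

Lemma PC_vars (f : fn) i : PC f -> PC (fun x a => vars (B x) (f x a) i).
Proof. move=> hf; rewrite /vars /digit; repeat pc1. Qed.

Lemma PC_valid (f : fn) : PC f -> PC (fun x a => valid (B x) (f x a)).
Proof.
move=> hf; rewrite /valid /=; repeat first [apply: PC_vars | pc1].
Qed.

(** As [rule_at] is a lookup in a list, case analysis on the decoded rule amounts to one
    computability goal per constructor. *)
Lemma PC_rule_cases (G : seq bool -> seq nat -> rule -> bool) (f : fn) : PC f ->
  let v x a := vars (B x) (f x a) in
  foldr (fun (r : seq bool -> seq nat -> rule) => and (PC (fun x a => G x a (r x a)))) True
   [:: fun x a => RBridge (v x a 1) (v x a 2) (v x a 3) (v x a 4);
       fun x a => RGoal (v x a 1) (v x a 2);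
       fun x a => RNe (v x a 1) (v x a 2) (v x a 3) (v x a 4);
       fun x a => RVal (v x a 1) (v x a 2) (v x a 3) (v x a 4) (v x a 5);
       fun x a => RDec0 (v x a 1) (v x a 2) (v x a 3) (v x a 4) (v x a 5) (v x a 6) (v x a 7) (v x a 8);
       fun x a => RDec1 (v x a 1) (v x a 2) (v x a 3) (v x a 4) (v x a 5) (v x a 6) (v x a 7) (v x a 8);
       fun x a => RWit0 (v x a 1) (v x a 2);
       fun x a => RWit (v x a 1) (v x a 2) (v x a 3) (v x a 4) (v x a 5);
       fun x a => RWitEnd (v x a 1) (v x a 2) (v x a 3) (v x a 4);
       fun x a => RCellW (v x a 1) (v x a 2) (v x a 3) (v x a 4);
       fun x a => RCellX (v x a 1) (v x a 2) (v x a 3);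
       fun x a => RCellB (v x a 1) (v x a 2) (v x a 3) (v x a 4);
       fun x a => RHead0 (v x a 1) (v x a 2) (v x a 3);
       fun x a => RRead (v x a 1) (v x a 2) (v x a 3) (v x a 4) (v x a 5) (v x a 6);
       fun x a => RView0 (v x a 1) (v x a 2) (v x a 3);
       fun x a => RView (v x a 1) (v x a 2) (v x a 3) (v x a 4) (v x a 5);
       fun x a => RHead (v x a 1) (v x a 2) (v x a 3) (v x a 4) (v x a 5) (v x a 6);
       fun x a => RCellNew (v x a 1) (v x a 2) (v x a 3) (v x a 4) (v x a 5) (v x a 6);
       fun x a => RCell (v x a 1) (v x a 2) (v x a 3) (v x a 4) (v x a 5) (v x a 6) (v x a 7);
       fun x a => RAcc (v x a 1) (v x a 2)] ->
  PC (fun x a => nat_of_bool (if rule_at (vars (B x) (f x a)) is Some r then G x a r else false)).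
Proof.
move=> hf v; set l := [:: _, _ & _] => hl.
have h : foldr (fun (p : seq bool -> seq nat -> bool) => and (PC (fun x a => p x a))) True
    [seq (fun x a => G x a (r x a)) | r <- l].
  by elim: l hl => //= r l ih [h1 h2]; split=> //; exact: ih.
have := PC_nth_cases (PC_vars 0 hf) h; apply: PC_bool => x a.
rewrite /rule_at /l /=; move: (vars (B x) (f x a) 0) => t.
by do 20 (case: t => [//|t] /=); rewrite !nth_nil.
Qed.

Ltac pc2 := lazymatch goal with
  | |- PC (fun x a => vars _ _ _) => refine (PC_vars _ _)
  | |- PC (fun x a => nat_of_bool (valid _ _)) => refine (PC_valid _)
  | |- _ => pc1
  end.

Lemma PC_reads_has h k t z c :
  PC h -> PC k -> PC t -> PC z -> PC c ->
  PC (fun x a => has (fun b => c x a == acode (B x) b) (reads M (h x a) (k x a) (t x a) (z x a))).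
Proof.
move=> hh hk ht hz hc.
apply: (@PC_bool (fun x a => has (fun i => c x a == acode (B x)
   (Read (h x a) (k x a) (t x a) i (tb_read M (z x a) i))) (iota 0 K))).
  by move=> x a; rewrite /reads has_map.
apply: (PC_has (PC_lit K)); rewrite /acode /=.
have bh := PC_behead hh; have bk := PC_behead hk; have bt := PC_behead ht.
have bz := PC_behead hz; have bc := PC_behead hc.
by repeat pc2.
Qed.

Lemma PC_base_body : PC (fun x a => base_body M x (ell x) (d x) (m x) (A x) (T x) (B x)
   (nth 0 a 0) (nth 0 a 1)).
Proof.
pose G x a r := guard M x (ell x) (d x) (m x) (A x) r &&
   has (fun b => nth 0 a 1 == acode (B x) b) (body M (d x) (m x) (A x) (T x) r).
apply: (@PC_bool (fun x a => valid (B x) (nth 0 a 0) &&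
   (if rule_at (vars (B x) (nth 0 a 0)) is Some r then G x a r else false))).
  move=> x a; rewrite /base_body; congr (_ && _).
  by case: rule_at => // r; rewrite mem_map_has.
apply: PC_and; first by pc2; pc2.
apply: PC_rule_cases; first exact: PC_nth.
have goal_has : PC (fun x a => has (fun y => nth 0 a 1 == acode (B x)
    (Ne (vars (B x) (nth 0 a 0) 1) (vars (B x) (nth 0 a 0) 2) y)) (iota 0 (points (d x) (m x)))).
  by apply: (PC_has points_PC); rewrite /acode /=; repeat pc2.
have val_has : PC (fun x a => has (fun q => has (fun p => nth 0 a 1 == acode (B x)
    (Dec (vars (B x) (nth 0 a 0) 1) (vars (B x) (nth 0 a 0) 2) (vars (B x) (nth 0 a 0) 3)
         (vars (B x) (nth 0 a 0) 4) (vars (B x) (nth 0 a 0) 5) p q)) (iota 0 q)) (iota 0 (m x).+1)).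
  apply: (PC_has (PC_succ m_PC)); apply: PC_has; first exact: PC_head.
  by rewrite /acode /=; repeat pc2.
have pv i : PC (fun x a => vars (B x) (nth 0 a 0) i) by apply: PC_vars; exact: PC_nth.
rewrite /foldr.
split; first by rewrite /G /= /width /acode /=; repeat pc2.
split.
  apply: (@PC_bool (fun x a => (nth 0 a 1 == acode (B x) (Acc (vars (B x) (nth 0 a 0) 1) (vars (B x) (nth 0 a 0) 2)))
     || has (fun y => nth 0 a 1 == acode (B x)
    (Ne (vars (B x) (nth 0 a 0) 1) (vars (B x) (nth 0 a 0) 2) y)) (iota 0 (points (d x) (m x))))).
    by move=> x a; rewrite /G /= has_map.
  by apply: PC_or goal_has; rewrite /acode /=; repeat pc2.
split; first by rewrite /G /= ?/interp ?/xlen ?/acode /=; repeat pc2.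
split.
  apply: PC_bool (PC_and (PC_ltn (PC_lit 1) (pv 3)) val_has) => x a.
  by rewrite /G [body _ _ _ _ _ _]/body has_allpairs_dep.
do 10 (split; first by rewrite /G /= ?/interp ?/xlen ?/acode /=; repeat pc2).
split.
  rewrite /G /guard /body; apply: PC_and; first by repeat pc2.
  by apply: PC_reads_has; repeat pc2.
split.
  apply: (@PC_bool (fun x a => guard M x (ell x) (d x) (m x) (A x)
     (RView (vars (B x) (nth 0 a 0) 1) (vars (B x) (nth 0 a 0) 2) (vars (B x) (nth 0 a 0) 3)
       (vars (B x) (nth 0 a 0) 4) (vars (B x) (nth 0 a 0) 5)) &&
     ((nth 0 a 1 == acode (B x) (View (vars (B x) (nth 0 a 0) 1) (vars (B x) (nth 0 a 0) 2)
        (vars (B x) (nth 0 a 0) 3) (vars (B x) (nth 0 a 0) 4))) ||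
     has (fun b => nth 0 a 1 == acode (B x) b) (reads M (vars (B x) (nth 0 a 0) 1) (vars (B x) (nth 0 a 0) 2)
        (vars (B x) (nth 0 a 0) 3).+1 (vars (B x) (nth 0 a 0) 5))))) => //.
  apply: PC_and; first by rewrite /guard; repeat pc2.
  apply: PC_or; first by rewrite /acode /=; repeat pc2.
  by apply: PC_reads_has; repeat pc2.
do 4 (split; first by rewrite /G /= ?/interp ?/xlen ?/acode /=; repeat pc2).
by [].
Qed.

Lemma PC_base_head : PC (fun x a => base_head M x (ell x) (d x) (m x) (A x) (B x)
   (nth 0 a 0) (nth 0 a 1)).
Proof.
rewrite /base_head; apply: PC_and; first by pc2; pc2.
apply: PC_rule_cases; first exact: PC_nth.
rewrite /foldr; do 20 (split; [rewrite /= /acode /= /interp /xlen /width; by repeat pc2 | ]).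
by [].
Qed.

Lemma PC_tag_of f : PC f -> PC (fun x a => tag_of (B x) (f x a)).
Proof. by move=> hf; rewrite /tag_of; repeat pc2. Qed.

Lemma PC_copy_of f : PC f -> PC (fun x a => copy_of (B x) (f x a)).
Proof. by move=> hf; rewrite /copy_of; repeat pc2. Qed.

Lemma PC_code_of f : PC f -> PC (fun x a => code_of (B x) (f x a)).
Proof. by move=> hf; rewrite /code_of; repeat pc2. Qed.

Ltac pc3 := lazymatch goal with
  | |- PC (fun x a => tag_of _ _) => refine (PC_tag_of _)
  | |- PC (fun x a => copy_of _ _) => refine (PC_copy_of _)
  | |- PC (fun x a => code_of _ _) => refine (PC_code_of _)
  | |- PC (fun x a => nat_of_bool (base_body _ _ _ _ _ _ _ _ _ _)) =>
    refine (@PC_comp2 (fun x u v => base_body M x (ell x) (d x) (m x) (A x) (T x) (B x) u v) _ _ PC_base_body _ _)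
  | |- PC (fun x a => nat_of_bool (base_head _ _ _ _ _ _ _ _ _)) =>
    refine (@PC_comp2 (fun x u v => base_head M x (ell x) (d x) (m x) (A x) (B x) u v) _ _ PC_base_head _ _)
  | |- _ => pc2
  end.

Lemma PC_rule_body : PC (fun x a => rule_body M x (ell x) (d x) (m x) (A x) (T x) (B x) (D x)
   (nth 0 a 0) (nth 0 a 1)).
Proof.
pose j := fun x a => copy_of (B x) (nth 0 a 0); pose c := fun x a => code_of (B x) (nth 0 a 0).
pose t' := fun x a => tag_of (B x) (nth 0 a 1); pose j' := fun x a => copy_of (B x) (nth 0 a 1).
pose c' := fun x a => code_of (B x) (nth 0 a 1).
pose no := fun (x : seq bool) (a : seq nat) => false.
pose l : seq (seq bool -> seq nat -> bool) := [:: no;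
  fun x a => [&& t' x a == 13, j x a == j' x a &
    base_body M x (ell x) (d x) (m x) (A x) (T x) (B x) (c x a) (c' x a)];
  no;
  fun x a => [&& t' x a == 13, j x a == j' x a & c' x a == goal (B x) (D x)];
  no;
  fun x a => [&& t' x a == 11, j' x a == 0 & c x a == c' x a];
  no;
  fun x a => (t' x a == 12) && (c x a == c' x a);
  no;
  fun x a => [&& t' x a == 13, j x a == j' x a & c' x a == goal (B x) (D x)]].
apply: (@PC_nth_cases l (fun x a => tag_of (B x) (nth 0 a 0))); first by repeat pc3.
rewrite /l /no /goal /acode /j /c /t' /j' /c' /=.
by do 10 (split; first by repeat pc3).
Qed.

Lemma PC_rule_head : PC (fun x a => rule_head M x (ell x) (d x) (m x) (A x) (B x)
   (nth 0 a 0) (nth 0 a 1)).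
Proof.
rewrite /rule_head; apply: PC_and; first by repeat pc3.
pose c := fun x a => code_of (B x) (nth 0 a 0).
pose t' := fun x a => tag_of (B x) (nth 0 a 1).
pose c' := fun x a => code_of (B x) (nth 0 a 1).
pose no := fun (x : seq bool) (a : seq nat) => false.
pose l : seq (seq bool -> seq nat -> bool) := [:: no; no;
  fun x a => (t' x a == 13) && base_head M x (ell x) (d x) (m x) (A x) (B x) (c x a) (c' x a);
  no;
  fun x a => (t' x a == 13) && (c x a == c' x a);
  no;
  fun x a => [&& t' x a == 13, c x a < B x ^ 3 & c' x a == acode (B x) (Item 0 (c x a))];
  no;
  fun x a => (t' x a == 11) && (c x a == c' x a);
  no;
  fun x a => (t' x a == 12) && (c x a == c' x a)].
apply: (@PC_nth_cases l (fun x a => tag_of (B x) (nth 0 a 0))); first by repeat pc3.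
rewrite /l /no /acode /c /t' /c' /=.
by do 11 (split; first by repeat pc3).
Qed.

Lemma PC_is_hlp f : PC f -> PC (fun x a => is_hlp (B x) (f x a)).
Proof.
move=> hf; apply: PC_bool (PC_and (PC_eq (PC_modn (PC_tag_of hf) (PC_lit 2)) (PC_lit 1))
   (PC_ltn (PC_tag_of hf) (PC_lit 11))) => x a.
by rewrite /is_hlp modn2 eqb1.
Qed.

Lemma PC_is_prm f : PC f -> PC (fun x a => is_prm (B x) (f x a)).
Proof.
move=> hf; apply: PC_bool (PC_and (PC_not (PC_eq (PC_modn (PC_tag_of hf) (PC_lit 2)) (PC_lit 1)))
   (PC_and (PC_ltn (PC_lit 0) (PC_tag_of hf)) (PC_ltn (PC_tag_of hf) (PC_lit 11)))) => x a.
by rewrite /is_prm modn2 eqb1.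
Qed.

Definition edge_fn : fn := fun x a => edge_code M x (ell x) (d x) (m x) (A x) (T x) (B x) (D x)
   (nth 0 a 0) (nth 0 a 1).

Lemma PC_edge : PC edge_fn.
Proof.
rewrite /edge_fn /edge_code /is_free /is_mate.
apply: PC_or.
  do 2 (apply: PC_and; first by repeat pc3).
  by apply: PC_or; [repeat pc3 | apply: PC_is_hlp; pc3].
apply: PC_or; apply: PC_and.
- by apply: PC_is_hlp; pc3.
- apply: PC_or PC_rule_body; apply: PC_and; first by apply: PC_is_hlp; pc3.
  by repeat pc3.
- by apply: PC_is_prm; pc3.
- exact: PC_rule_head.
Qed.

Definition size_fn (x : seq bool) : nat := nodes (B x).

Lemma PC_size_fn : PC (fun x _ => size_fn x).
Proof. by rewrite /size_fn /nodes; repeat pc3. Qed.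

(** The offset [N.+1] skips the unary number of nodes and its terminating 0; row and column are then
    quotient and remainder. *)
Definition graph_bit : fn := fun x a =>
  let i := nth 0 a 0 in let N := size_fn x in
  if i < N then 1 else if i == N then 0
  else edge_fn x [:: (i - N.+1) %/ N; (i - N.+1) %% N].

Lemma PC_graph_bit : PC graph_bit.
Proof.
have hN := PC_size_fn.
apply: PC_if; first by apply: PC_ltn (PC_nth 0) hN.
  exact: PC_lit.
apply: PC_if; first by apply: PC_eq (PC_nth 0) hN.
  exact: PC_lit.
have hi : PC (fun x a => nth 0 a 0 - (size_fn x).+1) by apply: PC_sub (PC_nth 0) (PC_succ hN).
apply: (@PC_comp2 (fun x u v => edge_fn x [:: u; v])).
- exact: PC_edge.
- exact: PC_divn.
- exact: PC_modn.
Qed.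

Definition graph_len (x : seq bool) := size_fn x + 1 + size_fn x * size_fn x.

Lemma PC_graph_len : PC (fun x _ => graph_len x).
Proof. by have hN := PC_size_fn; rewrite /graph_len; repeat pc3. Qed.

End EdgePC.

Lemma allpairs_iota (T : Type) (F : nat -> nat -> T) a n :
  [seq F v w | v <- iota 0 a, w <- iota 0 n] = mkseq (fun i => F (i %/ n) (i %% n)) (a * n).
Proof.
elim: a => [|a ih] //.
rewrite -{1}addn1 iotaD allpairs_cat ih add0n /mkseq mulSnr iotaD map_cat; congr (_ ++ _).
rewrite /= cats0 add0n -[in RHS](addn0 (a * n)) iotaDl -map_comp; apply/eq_in_map => w.
rewrite mem_iota add0n => /= wn.
by rewrite divnMDl ?(leq_ltn_trans _ wn) // modnMDl divn_small // modn_small // addn0.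
Qed.

Lemma count_encode_set (G : digraph) (S : {set G}) : count id (encode_set S) = #|S|.
Proof.
rewrite /encode_set count_map -sum1_count big_enum_cond sum1_card.
by apply: eq_card => v.
Qed.

Section Encode.
Variables (M : tm) (ell d m A T B D : seq bool -> nat) (x : seq bool).
Hypothesis B_small : 20 <= B x.

Lemma encode_graph :
  encode_digraph (graph M x (ell x) (d x) (m x) (A x) (T x) (D x) B_small) =
  mkseq (fun i => graph_bit M ell d m A T B D x [:: i] != 0) (graph_len B x).
Proof.
rewrite /encode_digraph.
have -> : #|graph M x (ell x) (d x) (m x) (A x) (T x) (D x) B_small| = size_fn B x by exact: card_ord.
set F := edge_code M x (ell x) (d x) (m x) (A x) (T x) (B x) (D x).
have -> : [seq edge v w | v <- enum (graph M x (ell x) (d x) (m x) (A x) (T x) (D x) B_small),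
              w <- enum (graph M x (ell x) (d x) (m x) (A x) (T x) (D x) B_small)] =
   [seq F v w | v <- iota 0 (size_fn B x), w <- iota 0 (size_fn B x)].
  by rewrite -(val_enum_ord (size_fn B x)) [RHS]allpairs_mapl [RHS]allpairs_mapr.
rewrite allpairs_iota /graph_len /mkseq; set N := size_fn B x.
rewrite -addnA iotaD map_cat add0n; congr (_ ++ _).
  apply: (@eq_from_nth _ false); rewrite ?size_nseq ?size_map ?size_iota // => i iN.
  by rewrite nth_nseq iN (nth_map 0) ?size_iota // nth_iota // add0n /graph_bit /= -/N iN.
rewrite add1n /=; congr (_ :: _); first by rewrite /graph_bit /= -/N ltnn eqxx.
rewrite -[in RHS](addn0 N.+1) iotaDl -map_comp; apply/eq_in_map => i _.
rewrite /graph_bit /= -/N ltnNge (leq_trans (leqnSn N) (leq_addr _ _)) /=.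
have -> : (N.+1 + i == N) = false by lia.
by rewrite addKn /edge_fn /= -/F; case: (F _ _).
Qed.

End Encode.

(** * Choice of the parameters *)

Lemma computes_in_leq M x y t t' : t <= t' -> computes_in M x y t -> computes_in M x y t'.
Proof.
move=> tt [f c]; rewrite /computes_in -(subnK tt) iterD.
set s := iter t _ _ in f c *.
suff -> : iter (t' - t) (@step M) s = s by [].
by elim: (t' - t) => //= n ->; rewrite /step f.
Qed.

Lemma size_lt_loglen x : size x < 2 ^ loglen x.
Proof. exact: trunc_log_ltn. Qed.

(** A bound 2^polylog is at most n^polylog. Lengths whose logarithm is below 2 go into the constant;
    otherwise the factor [K * 2 ^ K], from replacing l+1 by 2l, is absorbed into a power of the
    logarithm. *)
Lemma budget_polylog p q : exists C c, forall x,
  budget p x [::] ^ q <= C * size x ^ (trunc_log 2 (size x) ^ c) + C.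
Proof.
pose K := q * (p + 2) + p.
exists (2 ^ (K * 2 ^ K)), (K * 2 ^ K + K) => x.
have h1 : budget p x [::] ^ q <= 2 ^ (K * loglen x ^ K).
  have h : budget p x [::] <= 2 ^ (p * loglen x ^ p + 2).
    rewrite /budget /qpoly /= expnD; have : 0 < 2 ^ (p * loglen x ^ p) by rewrite expn_gt0.
    lia.
  apply: (@leq_trans ((2 ^ (p * loglen x ^ p + 2)) ^ q)).
    by case: (q) => // q'; rewrite leq_exp2r.
  rewrite -expnM leq_exp2l //.
  have l1 : 0 < loglen x ^ p by rewrite expn_gt0.
  apply: (@leq_trans ((q * (p + 2)) * loglen x ^ p)); first by nia.
  apply: leq_mul; first by rewrite leq_addr.
  by rewrite leq_pexp2l // /K leq_addl.
apply: leq_trans h1 _; rewrite /loglen; set l := trunc_log 2 (size x).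
have [l2|l2] := ltnP l 2.
  apply: leq_trans (leq_addl _ _); rewrite leq_exp2l // leq_mul //.
  by case: (K) => // K'; rewrite leq_exp2r.
apply: leq_trans (leq_addr _ _).
apply: (@leq_trans (size x ^ (l ^ (K * 2 ^ K + K)))); last by rewrite leq_pmull // expn_gt0.
have x2 : 2 <= size x.
  rewrite leqNgt; apply/negP => xs; move: l2; rewrite /l.
  by case: (size x) xs => [|[|]].
apply: (@leq_trans (2 ^ (l ^ (K * 2 ^ K + K)))); last first.
  by case: (l ^ _) => // e; rewrite leq_exp2r.
rewrite leq_exp2l //.
apply: (@leq_trans (K * (2 * l) ^ K)).
  by rewrite leq_mul2l; case: (K) => // K'; rewrite leq_exp2r //; lia.
rewrite expnMn mulnA expnD leq_mul //.
by apply: ltnW; apply: leq_trans (ltn_expl _ (isT : 1 < 2)) _; case: (K * _) => // e; rewrite leq_exp2r.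
Qed.

(** Bernoulli's inequality in the form (m+1)^d (m-d) <= m^(d+1), where m-d is at least m/2. *)
Lemma expn_bernoulli m d : 2 * d <= m -> m.+1 ^ d <= 2 * m ^ d.
Proof.
case: m => [|m]; first by case: d.
move=> dm; have h : forall e, e <= d -> m.+2 ^ e * (m.+1 - e) <= m.+1 ^ e.+1.
  elim=> [|e ih] ed; first by rewrite expn0 mul1n subn0 expn1.
  rewrite expnSr (expnS m.+1 e.+1) -mulnA.
  have h1 : m.+2 * (m.+1 - e.+1) <= m.+1 * (m.+1 - e) by nia.
  apply: leq_trans (leq_mul (leqnn _) h1) _.
  by rewrite mulnCA leq_mul2l /= ih // ltnW.
have := h d (leqnn d); rewrite expnS.
have : m.+1 <= 2 * (m.+1 - d) by lia.
move: (m.+2 ^ d) (m.+1 ^ d) => u v h1 h2.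
have : m.+1 * u <= m.+1 * (2 * v) by nia.
by rewrite leq_pmul2l.
Qed.

Section Instances.
Variables (V : tm) (c C0 cV Cst kk : nat).

Definition ell (x : seq bool) := size x ^ c + c.
(** Large enough for the 2^d leaves to hold a witness of length [ell]. *)
Definition dimf (x : seq bool) := (2 * c).+1 * loglen x.
Definition sidef x := 2 * dimf x.
Definition Qf x := sidef x ^ dimf x.
Definition Pf x := points (dimf x) (sidef x).
Definition Af x := (2 * Qf x).+1.
Definition Tf x := C0 * (xlen x + ell x) ^ cV + C0.
Definition halfdepth x := Cst * loglen x ^ kk.
Definition Df x := 2 * halfdepth x.
(** A sum of exponents, each large enough for one or more of the lower bounds that the system
    imposes on [B]. *)
Definition size_exp := 8 * (2 * c).+1 ^ 2 + 4 + (2 + 2 * (2 * c).+1) + (C0 + 1 + ((2 * c).+1 + 2) * cV)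
  + (3 + #|extra V|) + #|view V| + (tapes V).+1 + 20.
Definition Bf x := 2 ^ (size_exp * halfdepth x * loglen x ^ 2).
Definition thr x := (Pf x + Qf x) ^ Df x.

Hypothesis Cst_gt0 : 0 < Cst.

Lemma halfdepth_gt0 x : 0 < halfdepth x.
Proof. by rewrite /halfdepth muln_gt0 Cst_gt0 expn_gt0. Qed.

Lemma Bf_ge e x : e <= size_exp -> 2 ^ (e * halfdepth x * loglen x ^ 2) <= Bf x.
Proof. by move=> h; rewrite leq_exp2l // !leq_mul. Qed.

Lemma Bf_ge1 e x : e <= size_exp -> 2 ^ (e * loglen x) <= Bf x.
Proof.
move=> h; apply: leq_trans (Bf_ge x h); rewrite leq_exp2l // -mulnA leq_mul2l; apply/orP; right.
by have := halfdepth_gt0 x; have : 0 < loglen x by []; rewrite expnS expn1; nia.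
Qed.

Lemma Bf_const e x : e <= size_exp -> e < Bf x.
Proof.
move=> h; apply: leq_trans (Bf_ge1 x h); apply: leq_trans (ltn_expl e (isT : 1 < 2)) _.
by rewrite leq_exp2l // leq_pmulr.
Qed.

Lemma ell_le x : ell x <= 2 ^ dimf x.
Proof.
have h1 : size x ^ c <= 2 ^ (c * loglen x).
  rewrite mulnC expnM; case: (c) => // c'; rewrite leq_exp2r //; apply: ltnW; exact: size_lt_loglen.
have h2 : c <= 2 ^ (c * loglen x).
  apply: leq_trans (ltnW (ltn_expl c (isT : 1 < 2))) _; by rewrite leq_exp2l // leq_pmulr.
apply: (@leq_trans (2 ^ (c * loglen x).+1)); first by rewrite expnS /ell; lia.
rewrite leq_exp2l // /dimf; have : 0 < loglen x by []; nia.
Qed.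

Lemma Pf_le x : Pf x <= 2 ^ (2 * (2 * c).+1 ^ 2 * loglen x ^ 2).
Proof.
apply: (@leq_trans ((2 ^ sidef x) ^ dimf x)).
  rewrite /Pf /points; case: (dimf x) => // e; rewrite leq_exp2r //; exact: ltn_expl.
rewrite -expnM leq_exp2l // /sidef /dimf !expnS !expn0; nia.
Qed.

Lemma Qf_le x : Qf x <= Pf x.
Proof. by rewrite /Qf /Pf /points; case: (dimf x) => // e; rewrite leq_exp2r. Qed.

Lemma width_le x : width (dimf x) (sidef x) (Af x) <= 2 ^ ((4 * (2 * c).+1 ^ 2 + 2) * loglen x ^ 2).
Proof.
have hp := Pf_le x; have hq := Qf_le x; rewrite /width -/(Pf x) /Af.
have p0 : 0 < Pf x by rewrite expn_gt0.
have l0 : 0 < loglen x ^ 2 by rewrite expn_gt0.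
set u := 2 * (2 * c).+1 ^ 2 * loglen x ^ 2 in hp.
apply: (@leq_trans (2 ^ u * (2 ^ 2 * 2 ^ u))); first by apply: leq_mul => //; lia.
by rewrite -!expnD leq_exp2l // /u; lia.
Qed.

Lemma width_exp_le x : width (dimf x) (sidef x) (Af x) ^ Df x <= Bf x.
Proof.
apply: (@leq_trans ((2 ^ ((4 * (2 * c).+1 ^ 2 + 2) * loglen x ^ 2)) ^ Df x)).
  by case: (Df x) => // e; rewrite leq_exp2r // width_le.
rewrite -expnM.
have -> : (4 * (2 * c).+1 ^ 2 + 2) * loglen x ^ 2 * Df x =
   (8 * (2 * c).+1 ^ 2 + 4) * halfdepth x * loglen x ^ 2 by rewrite /Df; lia.
apply: Bf_ge; rewrite /size_exp; lia.
Qed.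

Lemma thr_le x : thr x <= Bf x.
Proof.
apply: leq_trans (width_exp_le x); rewrite /thr; case: (Df x) => // e; rewrite leq_exp2r //.
rewrite /width -/(Pf x) /Af; have := Qf_le x.
have q0 : 0 < Qf x by rewrite expn_gt0 /sidef /dimf; lia.
nia.
Qed.

Lemma Bf_small x : 20 <= Bf x. Proof. by apply/ltnW/Bf_const; rewrite /size_exp; lia. Qed.

Lemma Df_lt x : Df x < Bf x.
Proof.
apply: (@leq_trans (2 ^ (2 * halfdepth x * loglen x ^ 2))); last by apply: Bf_ge; rewrite /size_exp; lia.
apply: leq_trans (ltn_expl _ (isT : 1 < 2)) _; rewrite leq_exp2l // leq_pmulr //.
Qed.

Lemma leaf_le x : 2 * 2 ^ dimf x <= Bf x.
Proof.
rewrite -expnS; apply: leq_trans (Bf_ge1 (e := (2 * c).+2) x _); last by rewrite /size_exp; lia.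
by rewrite leq_exp2l // /dimf; have : 0 < loglen x by []; nia.
Qed.

Lemma side_lt x : sidef x < Bf x.
Proof.
apply: leq_trans (Bf_ge1 (e := 2 * (2 * c).+1) x _); last by rewrite /size_exp; lia.
by apply: leq_trans (ltn_expl _ (isT : 1 < 2)) _; rewrite leq_exp2l // /sidef /dimf; lia.
Qed.

Lemma xlen_le2 x : xlen x <= 2 ^ (2 * loglen x).
Proof.
apply: (@leq_trans (2 ^ (loglen x).+1)); last by rewrite leq_exp2l //; have : 0 < loglen x by []; lia.
by rewrite expnS /xlen; have := size_lt_loglen x; lia.
Qed.

Lemma xlen_le x : xlen x <= Bf x.
Proof. by apply: leq_trans (xlen_le2 x) (Bf_ge1 x _); rewrite /size_exp; lia. Qed.

Lemma Tf_lt x : Tf x < Bf x.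
Proof.
apply: leq_trans (Bf_ge1 (e := C0 + 1 + ((2 * c).+1 + 2) * cV) x _); last by rewrite /size_exp; lia.
have l0 : 0 < loglen x by [].
have h : xlen x + ell x <= 2 ^ (((2 * c).+1 + 2) * loglen x).
  apply: (@leq_trans (2 ^ (2 * loglen x) * 2 ^ dimf x)).
    have := xlen_le2 x; have := ell_le x.
    have : 1 < 2 ^ (2 * loglen x) by rewrite -{1}(expn0 2) ltn_exp2l //; lia.
    have : 1 < 2 ^ dimf x by rewrite -{1}(expn0 2) ltn_exp2l // /dimf; lia.
    nia.
  by rewrite -expnD leq_exp2l // /dimf; lia.
have h2 : (xlen x + ell x) ^ cV <= 2 ^ (((2 * c).+1 + 2) * cV * loglen x).
  rewrite mulnAC expnM; by case: (cV) => // e; rewrite leq_exp2r.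
have h3 : C0 * (xlen x + ell x) ^ cV + C0 < 2 ^ C0.+1 * 2 ^ (((2 * c).+1 + 2) * cV * loglen x).
  have := ltn_expl C0 (isT : 1 < 2); have : 0 < 2 ^ (((2 * c).+1 + 2) * cV * loglen x) by rewrite expn_gt0.
  rewrite expnS; move: h2; move: (2 ^ _) (_ ^ cV) (2 ^ C0) => w v u; nia.
apply: leq_trans h3 _; rewrite -expnD leq_exp2l //; nia.
Qed.

Lemma sym_le x : 3 + #|extra V| <= Bf x.
Proof. by apply/ltnW/Bf_const; rewrite /size_exp; lia. Qed.

Lemma view_le x : #|view V| <= Bf x.
Proof. by apply/ltnW/Bf_const; rewrite /size_exp; lia. Qed.

Lemma tapes_le x : (tapes V).+1 <= Bf x.
Proof. by apply/ltnW/Bf_const; rewrite /size_exp; lia. Qed.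

Lemma side_gt0 x : 0 < sidef x. Proof. rewrite /sidef /dimf; have : 0 < loglen x by []. nia. Qed.

Lemma Df_gt0 x : 0 < Df x. Proof. by rewrite /Df; have := halfdepth_gt0 x; lia. Qed.

(** One level gains a factor 3/2 by [expn_bernoulli], two levels gain 9/4 and so at least 2; hence
    the depth is twice [halfdepth]. *)
Lemma gap x : 2 ^ halfdepth x * Pf x ^ Df x <= thr x.
Proof.
rewrite /thr /Df; move: (halfdepth x) => e; rewrite !expnM -expnMn.
case: e => // e; rewrite leq_exp2r //.
have := @expn_bernoulli (sidef x) (dimf x) (leqnn _).
rewrite -/(Qf x) -/(points _ _) -/(Pf x) !expnS !expn0 !muln1; nia.
Qed.

Definition inst x : digraph :=
  graph V x (ell x) (dimf x) (sidef x) (Af x) (Tf x) (Df x) (Bf_small x).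

Lemma inst_yes x u : size u <= ell x ->
  cell (iter (Tf x) (@step V) (init V (pairing x u))) ord_max 0 = Some (inl true) ->
  pds_opt (inst x) <= (Pf x ^ Df x).+1.
Proof.
apply: graph_yes.
- exact: side_gt0.
- exact: ell_le.
- exact: leqnn.
- exact: Df_gt0.
- exact: Df_lt.
- exact: width_exp_le.
- exact: leaf_le.
- exact: side_lt.
- exact: xlen_le.
- exact: Tf_lt.
- exact: sym_le.
- exact: view_le.
- exact: tapes_le.
Qed.

Lemma inst_no x (S : {set inst x}) :
  (forall u, size u <= ell x ->
    cell (iter (Tf x) (@step V) (init V (pairing x u))) ord_max 0 <> Some (inl true)) ->
  power_dominates S -> thr x <= #|S|.
Proof.
move=> rej pd; rewrite leqNgt; apply/negP => lt.
have SB : #|S| < Bf x by apply: leq_trans lt (thr_le x).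
have := graph_no (side_gt0 x) (ell_le x) (leqnn _) (Df_gt0 x) (Df_lt x) (width_exp_le x)
  (leaf_le x) (side_lt x) (xlen_le x) (Tf_lt x) (sym_le x) (view_le x) (tapes_le x) rej pd SB.
by rewrite -/(Qf x) -/(Pf x) -/(thr x) leqNgt lt.
Qed.

Lemma PC_ell : PC (fun x _ => ell x).
Proof. by apply: PC_add (PC_lit c); apply: PC_expn_lit; exact: PC_size. Qed.

Lemma PC_dimf : PC (fun x _ => dimf x).
Proof. by apply: PC_mul PC_loglen; exact: PC_lit. Qed.

Lemma PC_sidef : PC (fun x _ => sidef x).
Proof. exact: PC_mul (PC_lit 2) PC_dimf. Qed.

Lemma PC_halfdepth : PC (fun x _ => halfdepth x).
Proof. exact: PC_mul (PC_lit Cst) (PC_expn_lit kk PC_loglen). Qed.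

Lemma PC_Df : PC (fun x _ => Df x).
Proof. exact: PC_mul (PC_lit 2) PC_halfdepth. Qed.

Lemma PC_xlen : PC (fun x _ => xlen x).
Proof. exact: PC_succ (PC_succ (PC_mul (PC_lit 2) PC_size)). Qed.

Lemma PC_Tf : PC (fun x _ => Tf x).
Proof.
apply: PC_add (PC_lit C0); apply: PC_mul (PC_lit C0) _.
exact: PC_expn_lit (PC_add PC_xlen PC_ell).
Qed.

Lemma PC_Bf : PC (fun x _ => Bf x).
Proof.
apply: (@PC_exp2 _ (size_exp * Cst + kk + 2)).
  by apply: PC_mul (PC_expn_lit 2 PC_loglen); apply: PC_mul (PC_lit _) PC_halfdepth.
move=> x; rewrite /halfdepth mulnA -mulnA -expnD; apply: leq_mul; first by lia.
by rewrite leq_pexp2l //; lia.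
Qed.

Lemma PC_exp_below (f g : seq bool -> nat) : PC (fun x _ => f x) -> PC (fun x _ => g x) ->
  (forall x, f x ^ g x <= Bf x) -> PC (fun x _ => f x ^ g x).
Proof.
move=> hf hg le; apply: PC_ext (PC_capped_exp hf hg PC_Bf) => x a.
exact/minn_idPl.
Qed.

Lemma Pf_le_B x : Pf x <= Bf x.
Proof.
apply: leq_trans (width_exp_le x); apply: (@leq_trans (width (dimf x) (sidef x) (Af x))).
  by rewrite /width -/(Pf x) leq_pmulr.
have := Df_gt0 x; case: (Df x) => // e _; rewrite expnS leq_pmulr // expn_gt0.
by rewrite (@width_gt0 _ (sidef x)).
Qed.

Lemma PC_Pf : PC (fun x _ => Pf x).
Proof. exact: (PC_exp_below (PC_succ PC_sidef) PC_dimf Pf_le_B). Qed.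

Lemma PC_Qf : PC (fun x _ => Qf x).
Proof. by apply: (PC_exp_below PC_sidef PC_dimf) => x; apply: leq_trans (Qf_le x) (Pf_le_B x). Qed.

Lemma PC_Af : PC (fun x _ => Af x).
Proof. exact: PC_succ (PC_mul (PC_lit 2) PC_Qf). Qed.

Lemma PC_leaf : PC (fun x _ => 2 ^ dimf x).
Proof.
by apply: (PC_exp_below (PC_lit 2) PC_dimf) => x; apply: leq_trans (leaf_le x); rewrite leq_pmull.
Qed.

Lemma PC_thr : PC (fun x _ => thr x).
Proof. exact: (PC_exp_below (PC_add PC_Pf PC_Qf) PC_Df thr_le). Qed.

Definition inst_len := graph_len Bf.
Definition inst_bit := graph_bit V ell dimf sidef Af Tf Bf Df.
Definition accept_fn : fn := fun x a => nth 0 a 0 < thr x.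

Lemma PC_inst_len : PC (fun x _ => inst_len x).
Proof. exact: PC_graph_len PC_Bf. Qed.

Lemma PC_inst_bit : PC inst_bit.
Proof.
apply: PC_graph_bit.
- exact: PC_ell.
- exact: PC_leaf.
- exact: PC_Pf.
- exact: PC_sidef.
- exact: PC_Af.
- exact: PC_Tf.
- exact: PC_Bf.
- exact: PC_Df.
Qed.

Lemma PC_accept_fn : PC accept_fn.
Proof. exact: PC_ltn (PC_nth 0) PC_thr. Qed.

(** The encoded digraph is no longer than a power of the budget, so every phase, the run of [M]
    included, takes time polynomial in the budget; [F] collects these times. *)
Lemma decide_by_approx (M : tm) (Cm cm : nat) (L : language) :
  (forall x, exists S : {set inst x},
     computes_in M (encode_digraph (inst x)) (encode_set S)
        (Cm * size (encode_digraph (inst x)) ^ cm + Cm) /\ (#|S| < thr x <-> L x)) ->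
  DTIME_n_polylog L.
Proof.
move=> hM.
have [pl hl] := PC_inst_len; have [pb hb] := PC_inst_bit; have [pa ha] := PC_accept_fn.
have r0 : 0 < dr0 M by [].
pose p := pl + pb + pa.
have le_p q x a : q <= p -> forall e, budget q x a ^ e <= budget p x a ^ e.
  by move=> h [|e] //; rewrite leq_exp2r // budgetW.
have lenb x : inst_len x <= budget p x [::] ^ pl.
  have [h _] := hl _ (dmk M) _ r0; apply: leq_trans (h x [::]) (le_p _ _ _ _ _); rewrite /p; lia.
pose G x := (budget p x [::] + budget p x [::] ^ pl) ^ pb.
have hG x i : i < inst_len x -> budget pb x [:: i] ^ pb <= G x.
  move=> il; rewrite /G; have il' := leq_trans (ltnW il) (lenb x).
  apply: leq_trans (le_p _ _ _ _ _) _; first by rewrite /p; lia.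
  case: (pb) => // e; rewrite leq_exp2r // /budget /=.
  by rewrite /budget /= in il'; lia.
have [code [K [bK hK]]] := decider_run (hl _ (dmk M) _ r0) (hb _ (dmk M) _ r0) (ha _ (dmk M) _ r0) hG.
pose F b := b ^ pl + b ^ pl * (3 * (b + b ^ pl) ^ pb + 6) + 4 * (Cm * (b ^ pl) ^ cm + Cm) + 2 * b ^ pl +
   (b + b ^ pl) ^ pa + 10.
have [q hq] : poly_bounded F by rewrite /F; pb.
have [C [e he]] := budget_polylog p q.
exists e => //; exists (cmd_tm K code), C => x.
have [S [cS hS]] := hM x.
have enc : encode_digraph (inst x) = instance inst_len inst_bit x by rewrite /inst encode_graph.
rewrite enc in cS; have [s hr hs] := hK x _ _ cS.
exists (accept_fn x [:: count id (encode_set S)] != 0); split; last first.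
  rewrite count_encode_set -hS /accept_fn /=; by case: ltnP.
have [t tT ex] := hr; apply: (exec_computes bK ex) => //.
apply: leq_trans tT _; apply: leq_trans (he x).
apply: leq_trans (hq _ (budget_gt1 _ _ _)).
have cnt : count id (encode_set S) <= budget p x [::] ^ pl.
  rewrite count_encode_set; apply: leq_trans (max_card _) (leq_trans _ (lenb x)).
  by rewrite card_ord /inst_len /graph_len /size_fn; lia.
have sz : size (encode_set S) <= budget p x [::] ^ pl.
  rewrite size_map -cardE; apply: leq_trans (lenb x).
  by rewrite card_ord /inst_len /graph_len /size_fn; lia.
rewrite /F.
have szi : size (instance inst_len inst_bit x) ^ cm <= (budget p x [::] ^ pl) ^ cm.
  by rewrite size_mkseq; case: (cm) => // u; rewrite leq_exp2r // lenb.
have decb : budget pa x [:: count id (encode_set S)] ^ pa <= (budget p x [::] + budget p x [::] ^ pl) ^ pa.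
  apply: leq_trans (le_p _ _ _ _ _) _; first by rewrite /p; lia.
  case: (pa) => // u; rewrite leq_exp2r //.
  by move: cnt; rewrite /budget /=; lia.
have lenb' : budget pl x [::] ^ pl <= budget p x [::] ^ pl by apply: le_p; rewrite /p; lia.
have tb : 4 * (Cm * size (instance inst_len inst_bit x) ^ cm + Cm) <=
    4 * (Cm * (budget p x [::] ^ pl) ^ cm + Cm) by rewrite leq_mul2l /= leq_add2r leq_mul2l szi orbT.
rewrite leq_add2r; apply: leq_add decb; apply: leq_add; last by rewrite leq_mul2l sz.
apply: leq_add tb; apply: leq_add lenb' _; exact: leq_mul (lenb x) (leqnn _).
Qed.

End Instances.

(** * The gap *)

Import Order.TTheory GRing.Theory Num.Theory.
Local Open Scope classical_set_scope.
Local Open Scope ring_scope.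

Lemma ln2_gt0 (R : realType) : 0 < ln (2 : R).
Proof. by rewrite ln_gt0 // ltr1n. Qed.

Lemma log2_ge1 (R : realType) n : (2 <= n)%N -> 1 <= log2 (n%:R : R).
Proof.
move=> n2; rewrite /log2 ler_pdivlMr ?ln2_gt0 // mul1r ler_ln ?posrE ?ltr0n ?ler_nat //.
exact: ltnW.
Qed.

Lemma log2_le (R : realType) n e : (0 < n)%N -> (n <= 2 ^ e)%N -> log2 (n%:R : R) <= e%:R.
Proof.
move=> n0 ne; rewrite /log2 ler_pdivrMr ?ln2_gt0 // mulr_natl -lnXn ?ltr0n //.
by rewrite ler_ln ?posrE ?exprn_gt0 ?ltr0n // -natrX ler_nat.
Qed.

(* With [Y = K h l^2] the exponent is at most [Y / Y `^ a], and the size of [Cst]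
   and [kk] makes [Y `^ a >= h `^ a >= 2 K l^2]. *)
Lemma quasi_poly_ratio_le (R : realType) (eps a : R) (n K h l Cst kk : nat) :
  0 < a -> a < 1 -> a <= eps -> (2 <= n)%N -> (n <= 2 ^ (K * h * l ^ 2))%N ->
  (0 < K)%N -> (0 < l)%N -> (0 < Cst)%N -> h = (Cst * l ^ kk)%N ->
  2 <= kk%:R * a -> (2 * K)%:R <= Cst%:R `^ a ->
  quasi_poly_ratio eps n <= 2 `^ (h%:R / 2).
Proof.
move=> a0 a1 ae n2 nle K0 l0 C0 hE ka Ca.
have h0 : (0 < h)%N by rewrite hE muln_gt0 C0 expn_gt0 l0.
rewrite /quasi_poly_ratio; apply: ler_powR; first by rewrite ler1n.
have g1 : 1 <= log2 (n%:R : R) by exact: log2_ge1.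
apply: (@le_trans _ _ (log2 (n%:R : R) `^ (1 - a))); first by apply: ler_powR => //; lra.
set Y := (K * h * l ^ 2)%N in nle.
have l2 : (0 < l ^ 2)%N by rewrite sqrn_gt0.
have Y0 : (0 < Y)%N by rewrite /Y; nia.
have gY : log2 (n%:R : R) <= Y%:R by apply: log2_le => //; exact: ltnW.
apply: (@le_trans _ _ (Y%:R `^ (1 - a))).
  by apply: ge0_ler_powR => //; rewrite ?nnegrE ?ler0n //; lra.
rewrite powRB; last by apply/implyP; rewrite pnatr_eq0 -lt0n.
rewrite powRr1 ?ler0n //.
have hY : (2 * K * l ^ 2)%:R <= (Y%:R : R) `^ a.
  apply: (@le_trans _ _ (h%:R `^ a)); last first.
    apply: ge0_ler_powR; rewrite ?nnegrE ?ler0n ?ler_nat //; first exact: ltW.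
    by rewrite /Y -mulnA mulnCA leq_pmulr // muln_gt0 K0.
  rewrite hE [in leRHS]natrM powRM ?ler0n // natrM.
  apply: ler_pM; rewrite ?ler0n //.
  rewrite !natrX -!powR_mulrn ?ler0n // -powRrM; apply: ler_powR => //.
  by rewrite ler1n.
rewrite ler_pdivrMr; last by apply: powR_gt0; rewrite ltr0n.
apply: le_trans (ler_wpM2l _ hY); last by rewrite divr_ge0 ?ler0n.
rewrite /Y !natrM; lra.
Qed.

(** There are [14 * B ^ 28] nodes and 14 is at most [B ^ 4], hence the factor 32. *)
Lemma inst_nodes V c C0 cV Cst kk (Cst_gt0 : (0 < Cst)%N) x :
  (2 <= #|inst V c C0 cV kk Cst_gt0 x| <=
    2 ^ (32 * size_exp V c C0 cV * halfdepth Cst kk x * loglen x ^ 2))%N.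
Proof.
rewrite card_ord /nodes.
have B20 := Bf_small V c C0 cV kk Cst_gt0 x; set B := Bf _ _ _ _ _ _ _ in B20 *.
have -> : (32 * size_exp V c C0 cV * halfdepth Cst kk x * loglen x ^ 2 =
   size_exp V c C0 cV * halfdepth Cst kk x * loglen x ^ 2 * 32)%N by lia.
rewrite expnM -/(Bf V c C0 cV Cst kk x) -/B -expnM.
apply/andP; split; first by have : (0 < B ^ (3 * 9))%N; [rewrite expn_gt0; lia | nia].
have -> : (14 * B * B ^ (3 * 9) = 14 * B ^ 28)%N by rewrite -mulnA -expnS.
have -> : (B ^ 32 = B ^ 4 * B ^ 28)%N by rewrite -expnD.
by rewrite leq_mul // (@leq_trans (B ^ 1)%N) ?leq_pexp2l //; lia.
Qed.

Lemma exists_exponents (R : realType) (a : R) (K : nat) : 0 < a -> exists Cst kk,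
  [/\ (4 <= Cst)%N, 2 <= kk%:R * a & (2 * K)%:R <= Cst%:R `^ a].
Proof.
move=> a0.
exists (4 + Num.bound ((2 * K)%:R `^ a^-1))%N, (Num.bound (2 / a)); split; first by lia.
  by rewrite -ler_pdivrMr //; apply/ltW/archi_boundP; rewrite divr_ge0 // ltW.
have e : (2 * K)%:R = ((2 * K)%:R `^ a^-1) `^ a.
  by rewrite -powRrM mulVf ?gt_eqF // powRr1 ?ler0n.
rewrite [leLHS]e; apply: ge0_ler_powR; rewrite ?nnegrE ?powR_ge0 ?ler0n //; first exact: ltW.
rewrite natrD; apply: (@le_trans _ _ (Num.bound ((2 * K)%:R `^ a^-1 : R))%:R).
  by apply/ltW/archi_boundP/powR_ge0.
by rewrite lerDr ler0n.
Qed.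

(** A factor 2 pays for the root in the dominating set. The gap 2^h exceeds the ratio by at least
    2^(h/2), which is at least 4 because [Cst] is. *)
Lemma inapproximable_gap (R : realType) (eps a : R) V c C0 cV Cst kk (Cst_gt0 : (0 < Cst)%N) x :
  0 < a -> a < 1 -> a <= eps -> (4 <= Cst)%N -> 2 <= kk%:R * a ->
  (2 * (32 * size_exp V c C0 cV))%:R <= Cst%:R `^ a ->
  quasi_poly_ratio eps #|inst V c C0 cV kk Cst_gt0 x| * ((Pf c x ^ Df Cst kk x).+1)%:R
    < (thr c Cst kk x)%:R.
Proof.
move=> a0 a1 ae C4 ka Ca.
have /andP[n2 nle] := inst_nodes V c C0 cV kk Cst_gt0 x.
have size_exp_gt0 : (0 < 32 * size_exp V c C0 cV)%N by rewrite /size_exp; lia.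
have r := quasi_poly_ratio_le a0 a1 ae n2 nle size_exp_gt0 (isT : 0 < loglen x)%N Cst_gt0 erefl ka Ca.
set h := (Cst * loglen x ^ kk)%N in r.
have h4 : (4 <= h)%N by rewrite /h; have : (0 < loglen x ^ kk)%N; [rewrite expn_gt0|nia].
set Q := (Pf c x ^ Df Cst kk x)%N.
have Q0 : (0 < Q)%N by rewrite !expn_gt0.
have g : (2 `^ (h%:R) : R) * Q%:R <= (thr c Cst kk x)%:R.
  by rewrite powR_mulrn ?ler0n // -natrX -natrM ler_nat; exact: gap.
apply: lt_le_trans g.
apply: (@le_lt_trans _ _ (2 `^ (h%:R / 2) * (2 * Q%:R))).
  apply: ler_pM => //; rewrite ?powR_ge0 ?ler0n //.
  by rewrite -natrM ler_nat; lia.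
rewrite mulrA ltr_pM2r ?ltr0n //.
have e : (h%:R : R) = h%:R / 2 + h%:R / 2 by lra.
rewrite [X in _ < _ `^ X]e powRD; last by rewrite pnatr_eq0 implybT.
rewrite ltr_pM2l; last by apply: powR_gt0.
apply: (@lt_le_trans _ _ (2 `^ 2 : R)).
  by rewrite powR_mulrn // expr2; lra.
by apply: ler_powR; [rewrite ler1n | rewrite ler_pdivlMr // -natrM ler_nat; lia].
Qed.

Lemma dag_inapproximable (R : realType) (eps : R) : 0 < eps ->
  directed_pds_approximable acyclic (quasi_poly_ratio eps) -> NP `<=` DTIME_n_polylog.
Proof.
move=> eps0 [M [Cm [cm hM]]] L [Lv [c [[cV _ [V [C0 hV]]] hL]]].
(* For large eps the exponent 1 - eps is negative; passing to a smaller [a < 1] only enlarges the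
   ratio to be beaten and keeps 1 - a positive. *)
pose a := Num.min eps (1 / 2).
have a0 : 0 < a by rewrite /a lt_min eps0; lra.
have a1 : a < 1 by rewrite /a gt_min; apply/orP; right; lra.
have ae : a <= eps by rewrite /a ge_min lexx.
have [Cst [kk [C4 ka Ca]]] := exists_exponents (32 * size_exp V c C0 cV) a0.
have Cst_gt0 : (0 < Cst)%N by lia.
apply: (@decide_by_approx V c C0 cV Cst kk Cst_gt0 M Cm cm) => x.
have [S [cS pS leS]] := hM (inst V c C0 cV kk Cst_gt0 x) (@graph_acyclic _ _ _ _ _ _ _ _ _ _).
exists S; split=> //.
(* The verdict of the verifier is the first cell of its output tape, at a time [Tf] that serves all
   witnesses of length at most [ell]. *)
have acc u : (size u <= ell c x)%N ->
    (cell (iter (Tf c C0 cV x) (@step V) (init V (pairing x u))) ord_max 0 = Some (inl true)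
     <-> Lv (pairing x u)).
  move=> su; have [b [cb <-]] := hV (pairing x u).
  have [_ out] : computes_in V (pairing x u) [:: b] (Tf c C0 cV x).
    apply: computes_in_leq cb; rewrite leq_add2r leq_mul2l; apply/orP; right.
    rewrite pairing_cat size_cat size_pairing0.
    by case: (cV) => // e; rewrite leq_exp2r // leq_add2l.
  by rewrite out /written /=; split=> [[]|->].
split=> [lt|/hL[u [su Lu]]].
  apply: contrapT => nL; move: lt; rewrite ltnNge => /negP; apply.
  apply: inst_no pS => u su /(acc _ su) Lu; apply: nL; apply/hL; by exists u.
rewrite -(ltr_nat R); apply: le_lt_trans leS _.
apply: le_lt_trans (inapproximable_gap Cst_gt0 x a0 a1 ae C4 ka Ca).
apply: ler_wpM2l; first exact: powR_ge0.
by rewrite ler_nat; apply: (@inst_yes _ _ _ _ _ _ _ _ u) => //; apply/acc.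
Qed.

Theorem theorem6 (R : realType) (eps : R) (eps_gt0 : 0 < eps)
    (NP_not_qpoly : ~ (NP `<=` DTIME_n_polylog)) :
  ~ directed_pds_approximable (fun=> True) (quasi_poly_ratio eps) /\
  ~ directed_pds_approximable acyclic (quasi_poly_ratio eps).
Proof.
have no := fun h => NP_not_qpoly (dag_inapproximable eps_gt0 h).
by split=> // -[M [C [c hM]]]; apply: no; exists M, C, c => G _; exact: hM.
Qed.
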